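(* Let $T$ be a semistandard hook-valued tableau, $i\ge1$, and $\mathcal U(T)=(P(T),Q(T))$. (1) If $f_i(T)\neq0$, then $f_i(P(T))=P(f_i(T))$ and $Q(T)=Q(f_i(T))$. (2) If $e_i(T)\neq0$, then $e_i(P(T))=P(e_i(T))$ and $Q(T)=Q(e_i(T))$.
   Context: French notation: row $1$ is the bottom row, rows numbered upward, columns left to right; cell $(r,c)$ is in row $r$, column $c$. A semistandard tableau of hook shape $U$ consists of a hook entry $x$, a leg $\ell_1<\dots<\ell_p$ above $x$ with $x<\ell_1$, and an arm $a_1\le\dots\le a_q$ to the right of $x$ with $x\le a_1$ ($p,q\ge0$, positive integers); $\mathsf L(U)$ is the leg, $\mathsf L^+(U)=(x,\ell_1,\dots,\ell_p)$ the extended leg, $\mathsf A(U)$ the arm. A (semistandard) hook-valued tableau (HVT) of partition shape $\lambda$ is a filling of the cells of $\lambda$ by such hook tableaux with $\max(A)\le\min(B)$ whenever the cell of $A$ is left of that of $B$ in the same row, and $\max(A)<\min(C)$ whenever the cell of $A$ is below that of $C$ in the same column. Arm excess = total number of arm entries; set-valued tableaux are HVT with arm excess $0$. Crystal operators: the column reading word $R(T)$ reads, for each column from left to right, the extended legs of its cells (cells top to bottom, each extended leg from top to bottom), followed by all arm entries of that column in weakly increasing order. Assign $-$ to each $i$ and $+$ to each $i+1$ in $R(T)$, and successively pair a $+$ that is adjacent to and left of a $-$, removing paired signs, until no more pairs. If there is no unpaired $-$, $f_i(T)=0$. Otherwise let $B$ be the cell containing the $i$ of the rightmost unpaired $-$.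 (M) If the cell $B^\uparrow$ above $B$ contains an $i+1$, $f_i$ removes an $i$ from $\mathsf A(B)$ and adds $i+1$ to $\mathsf A(B^\uparrow)$. (S) Otherwise, if the cell $B^\rightarrow$ right of $B$ contains an $i$ in $\mathsf L^+(B^\rightarrow)$, $f_i$ removes this $i$ from $\mathsf L^+(B^\rightarrow)$ and adds $i+1$ to $\mathsf L(B)$. (N) Otherwise $f_i$ changes that $i$ into $i+1$. If there is no unpaired $+$, $e_i(T)=0$; otherwise let $B$ be the cell containing the $i+1$ of the leftmost unpaired $+$. (M) If the cell $B^\downarrow$ below $B$ contains an $i$, $e_i$ removes the $i+1$ from $\mathsf A(B)$ and adds $i$ to $\mathsf A(B^\downarrow)$. (S) Otherwise, if the cell $B^\leftarrow$ left of $B$ contains an $i+1$ in $\mathsf L(B^\leftarrow)$, $e_i$ removes it and adds $i$ to $\mathsf L^+(B)$. (N) Otherwise $e_i$ changes that $i+1$ into $i$. Uncrowding bumping $\mathcal V_b$: if arm excess of $T$ is $0$, $\mathcal V_b(T)=T$. Otherwise let $c$ be the largest index of a column containing a cell with nonempty arm; among such cells in column $c$ let $(r,c)$ be the one whose arm contains the largest value. Let $a$ be the largest arm entry of $(r,c)$, $\ell$ its largest leg entry, and $(a,\ell]\cap\mathsf L_T(r,c)$ the set of leg entries $x$ of $(r,c)$ with $a<x\le\ell$. In column $c+1$ find the smallest entry $\ge a$. If none exists, attach a new empty cell on top of column $c+1$, with row $\tilde r$, and let $k$ be empty; otherwise let $k$ be this entry and $(\tilde r,c+1)$ its cell. (a)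 If $\tilde r\ne r$: remove $a$ from the arm of $(r,c)$, put $a$ in the position of $k$ in $(\tilde r,c+1)$ (as hook entry if the cell is new), append $k$ (if nonempty) to the arm of $(\tilde r,c+1)$. (b) If $\tilde r=r$: move $(a,\ell]\cap\mathsf L_T(r,c)$ from the leg of $(r,c)$ into the leg of $(r,c+1)$, remove $a$ from the arm of $(r,c)$, replace the hook entry of $(r,c+1)$ by $a$, append $k$ (if nonempty) to the arm of $(r,c+1)$. Uncrowding insertion: $\mathcal V(T)=\mathcal V_b^d(T)$, $d\ge1$ minimal such that $\mathsf{shape}(\mathcal V_b^d(T))\neq\mathsf{shape}(\mathcal V_b^{d-1}(T))$ or $\mathcal V_b^d(T)=\mathcal V_b^{d-1}(T)$. Uncrowding map: for $T\in\mathsf{HVT}(\lambda)$ with arm excess $\alpha$, set $P_0=T$, $Q_0$ the empty tableau of shape $\lambda/\lambda$; for $1\le i\le\alpha$ let $P_i=\mathcal V(P_{i-1})$, let $c$ be the index of the rightmost column of $P_{i-1}$ containing a cell with nonzero arm excess and $\tilde c$ the column of the cell $\mathsf{shape}(P_i)/\mathsf{shape}(P_{i-1})$; $Q_i$ is $Q_{i-1}$ with this cell added and filled with $\tilde c-c$. $\mathcal U(T)=(P(T),Q(T)):=(P_\alpha,Q_\alpha)$. *)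

(* Defs.v *)
From mathcomp Require Import all_boot all_order all_algebra.
Set Implicit Arguments. Unset Strict Implicit. Unset Printing Implicit Defensive.

(* Conventions: rows and columns are 0-indexed internally; row 0 is the
   BOTTOM row (French notation), column 0 the leftmost.  A tableau is the
   list of its rows, bottom row first. *)

(* A hook tableau: (hook entry x, leg l_1<...<l_p, arm a_1<=...<=a_q). *)
Definition hook := (nat * seq nat * seq nat)%type.
Definition hx (h : hook) : nat := h.1.1.
Definition hleg (h : hook) : seq nat := h.1.2.
Definition harm (h : hook) : seq nat := h.2.
Definition hextleg (h : hook) : seq nat := hx h :: hleg h.
Definition hentries (h : hook) : seq nat := hextleg h ++ harm h.
Definition hmax (h : hook) : nat := \max_(y <- hentries h) y.
Definition hmin (h : hook) : nat := foldr minn (hx h) (hentries h).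

Definition is_hook (h : hook) : bool :=
  [&& 0 < hx h, sorted ltn (hextleg h), sorted leq (harm h)
    & all (leq (hx h)) (harm h)].

Definition tableau := seq (seq hook).
Definition dflt_hook : hook := (0, [::], [::]).
Definition shape (T : tableau) : seq nat := map size T.
Definition in_tab (T : tableau) (r c : nat) : bool := c < size (nth [::] T r).
Definition cell (T : tableau) (r c : nat) : hook := nth dflt_hook (nth [::] T r) c.

Definition is_partition_shape (T : tableau) : bool :=
  sorted geq (shape T) && all (fun row => 0 < size row) T.

Definition is_HVT (T : tableau) : Prop :=
  is_partition_shape T /\
  (forall r c, in_tab T r c -> is_hook (cell T r c)) /\
  (forall r c1 c2, c1 < c2 -> in_tab T r c2 ->
      hmax (cell T r c1) <= hmin (cell T r c2)) /\
  (forall r1 r2 c, r1 < r2 -> in_tab T r2 c ->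
      hmax (cell T r1 c) < hmin (cell T r2 c)).

Definition set_cell {A : Type} (d : A) (T : seq (seq A)) (r c : nat) (h : A) :=
  set_nth [::] T r (set_nth d (nth [::] T r) c h).
Definition upd (T : tableau) r c (h : hook) : tableau := set_cell dflt_hook T r c h.

Definition ncols (T : tableau) : nat := size (nth [::] T 0).
Definition col_cells (T : tableau) (c : nat) : seq nat :=
  [seq r <- iota 0 (size T) | in_tab T r c].

(* a letter: (value, row, column, true = in extended leg / false = in arm) *)
Definition letter := (nat * nat * nat * bool)%type.
Definition lval (l : letter) : nat := l.1.1.1.
Definition lrow (l : letter) : nat := l.1.1.2.
Definition lcol (l : letter) : nat := l.1.2.
Definition lkind (l : letter) : bool := l.2.

Definition col_word (T : tableau) (c : nat) : seq letter :=
  flatten [seq [seq (v, r, c, true) | v <- rev (hextleg (cell T r c))]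
          | r <- rev (col_cells T c)]
  ++ sort (fun u v : letter => lval u <= lval v)
       (flatten [seq [seq (v, r, c, false) | v <- harm (cell T r c)]
                | r <- col_cells T c]).

Definition reading (T : tableau) : seq letter :=
  flatten [seq col_word T c | c <- iota 0 (ncols T)].

(* signs: true = '+' (letter i+1), false = '-' (letter i) *)
Definition sword (i : nat) (w : seq letter) : seq (bool * letter) :=
  [seq (lval l == i.+1, l) | l <- w & (lval l == i) || (lval l == i.+1)].

Fixpoint cancel1 (s : seq (bool * letter)) : seq (bool * letter) :=
  match s with
  | (true, _) :: (false, _) :: s' => s'
  | x :: s' => x :: cancel1 s'
  | [::] => [::]
  end.
Definition reduce_signs (s : seq (bool * letter)) := iter (size s) cancel1 s.
Definition unpaired (i : nat) (T : tableau) : seq (bool * letter) :=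
  reduce_signs (sword i (reading T)).

Definition arm_add v (h : hook) : hook := (hx h, hleg h, sort leq (v :: harm h)).
Definition arm_rem v (h : hook) : hook := (hx h, hleg h, rem v (harm h)).
Definition arm_repl v w (h : hook) : hook :=
  (hx h, hleg h, sort leq (w :: rem v (harm h))).
Definition set_ext (s : seq nat) (h : hook) : hook :=
  match s with y :: ys => (y, ys, harm h) | [::] => h end.
Definition ext_add v (h : hook) : hook := set_ext (sort leq (v :: hextleg h)) h.
Definition ext_rem v (h : hook) : hook := set_ext (rem v (hextleg h)) h.
Definition ext_repl v w (h : hook) : hook :=
  set_ext [seq (if y == v then w else y) | y <- hextleg h] h.
Definition leg_add v (h : hook) : hook := (hx h, sort leq (v :: hleg h), harm h).
Definition leg_rem v (h : hook) : hook := (hx h, rem v (hleg h), harm h).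

(* ---------- crystal operators (None = 0) ---------- *)
Definition f_move (i : nat) (T : tableau) (l : letter) : tableau :=
  let r := lrow l in let c := lcol l in
  if in_tab T r.+1 c && (i.+1 \in hentries (cell T r.+1 c)) then
    upd (upd T r c (arm_rem i (cell T r c))) r.+1 c (arm_add i.+1 (cell T r.+1 c))
  else if in_tab T r c.+1 && (i \in hextleg (cell T r c.+1)) then
    upd (upd T r c.+1 (ext_rem i (cell T r c.+1))) r c (leg_add i.+1 (cell T r c))
  else
    upd T r c ((if lkind l then ext_repl i i.+1 else arm_repl i i.+1) (cell T r c)).

Definition f_op (i : nat) (T : tableau) : option tableau :=
  match rev [seq p.2 | p <- unpaired i T & ~~ p.1] with
  | l :: _ => Some (f_move i T l)
  | [::] => None
  end.

Definition e_move (i : nat) (T : tableau) (l : letter) : tableau :=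
  let r := lrow l in let c := lcol l in
  if (0 < r) && in_tab T r.-1 c && (i \in hentries (cell T r.-1 c)) then
    upd (upd T r c (arm_rem i.+1 (cell T r c))) r.-1 c (arm_add i (cell T r.-1 c))
  else if (0 < c) && in_tab T r c.-1 && (i.+1 \in hleg (cell T r c.-1)) then
    upd (upd T r c.-1 (leg_rem i.+1 (cell T r c.-1))) r c (ext_add i (cell T r c))
  else
    upd T r c ((if lkind l then ext_repl i.+1 i else arm_repl i.+1 i) (cell T r c)).

Definition e_op (i : nat) (T : tableau) : option tableau :=
  match [seq p.2 | p <- unpaired i T & p.1] with
  | l :: _ => Some (e_move i T l)
  | [::] => None
  end.

Definition arm_excess (T : tableau) : nat := sumn [seq size (harm h) | h <- flatten T].
Definition col_has_arm (T : tableau) (c : nat) : bool :=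
  has (fun r => harm (cell T r c) != [::]) (col_cells T c).
Definition arm_col (T : tableau) : nat :=
  \max_(c <- iota 0 (ncols T) | col_has_arm T c) c.
Definition amax (h : hook) : nat := \max_(y <- harm h) y.

Definition Vb (T : tableau) : tableau :=
  if arm_excess T == 0 then T else
  let c := arm_col T in
  let rs := [seq r <- col_cells T c | harm (cell T r c) != [::]] in
  let M := \max_(r <- rs) amax (cell T r c) in
  let r := nth 0 [seq r <- rs | amax (cell T r c) == M] 0 in
  let h := cell T r c in
  let a := amax h in
  let ell := \max_(y <- hleg h) y in
  let ents := flatten [seq [seq (v, r') | v <- hentries (cell T r' c.+1)]
                      | r' <- col_cells T c.+1] in
  let cands := [seq p <- ents | a <= p.1] in
  let vals := [seq p.1 | p <- cands] in
  let kv := foldr minn (head 0 vals) vals in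
  let k : option nat := if cands is [::] then None else Some kv in
  let rt := if cands is [::] then size (col_cells T c.+1)
            else (nth (0, 0) [seq p <- cands | p.1 == kv] 0).2 in
  if rt != r then
    let T1 := upd T r c (arm_rem a h) in
    let target := if k is Some kv then arm_add kv (ext_repl kv a (cell T1 rt c.+1))
                  else (a, [::], [::]) in
    upd T1 rt c.+1 target
  else
    let S := [seq y <- hleg h | a < y <= ell] in
    let h1 : hook := (hx h, [seq y <- hleg h | ~~ (a < y <= ell)], rem a (harm h)) in
    let hb := if k is Some _ then cell T r c.+1 else (a, [::], [::]) in
    let h2 : hook := (a, sort leq (hleg hb ++ S),
                      if k is Some kv then sort leq (kv :: harm hb) else harm hb) in
    upd (upd T r c h1) r c.+1 h2.

(* V = Vb^d with d >= 1 minimal such that the shape changes or a fixed point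
   is reached.  Such d is at most (number of columns)+1, so the fuel
   (number of cells)+2 is sufficient. *)
Fixpoint Viter (n : nat) (T : tableau) : tableau :=
  match n with
  | 0 => T
  | n'.+1 => let T' := Vb T in
             if (shape T' != shape T) || (T' == T) then T' else Viter n' T'
  end.
Definition Vins (T : tableau) : tableau := Viter (size (flatten T)).+2 T.

(* recording skew tableaux: None = cell of the inner shape lambda *)
Definition rtableau := seq (seq (option int)).
Definition Q0 (T : tableau) : rtableau := [seq nseq (size row) None | row <- T].

Definition U_step (PQ : tableau * rtableau) : tableau * rtableau :=
  let (P, Q) := PQ in
  let P' := Vins P in
  let c := arm_col P in
  let rr := find (fun j => nth 0 (shape P') j != nth 0 (shape P) j) (iota 0 (size P')) in
  let ct := nth 0 (shape P) rr in
  (P', set_cell None Q rr ct (Some (Posz ct - Posz c)%R)).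

Definition Umap (T : tableau) : tableau * rtableau :=
  iter (arm_excess T) U_step (T, Q0 T).
Definition Ptab (T : tableau) : tableau := (Umap T).1.
Definition Qtab (T : tableau) : rtableau := (Umap T).2.

(* Main.v *)
(** A hook-valued tableau is determined by the numbers of hook, leg and arm entries of each value in each column: an entry [v] of a column lies in the row whose number is the number of hook entries [<= v] of that column.  In these coordinates each column contributes a reduced word [-^x +^y] to the signature rule, [f_i] and [e_i] change a few counts, and the bumping [V_b] changes only the counts of two adjacent columns [p] and [p + 1], keeping the reduction of their joint sign word.  Hence [V_b] and [f_i] act in the same or in a neighbouring column, and comparing counts gives [V_b (f_i T) = f_i (V_b T)].  As [e_i] inverts [f_i], and [f_i] keeps the shape and the number of arm entries of each column, the iterations of [V_b] on [T] and on [f_i T] stop simultaneously and record the same [Q]; the statement for [e_i] is the one for [f_i] read backwards. *)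

Require Import Defs.
From mathcomp Require Import all_boot all_order all_algebra.
From mathcomp Require Import zify.
Set Implicit Arguments. Unset Strict Implicit. Unset Printing Implicit Defensive.

(** The delicate point is that [f_i] may act on [T] and on [V_b T] in different columns and by
    different rules. This happens when the [i] to be changed is the bumped entry [a], the displaced
    entry [k], or a leg entry carried along. As the joint word of the columns [p] and [p + 1] keeps
    its reduction, a choice made in this pair of columns stays in the pair, and counting decides
    which of the two it is. The rule (S) is then forced: if [a = i] takes a leg entry [i+1] to
    column [p + 1], then [V_b (f_i T)], which bumps [i+1], leaves that leg entry behind, and (S) is
    the move that brings it back. The rule (M), in contrast, is invisible: it stays within one
    column, so in counts it only changes the value of an arm entry. Every relation between counts is
    an equation with indicators added on both sides, so that no truncated subtraction occurs and the
    agreement of two results is linear arithmetic. The signature rule is run over a common number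
    [N] of columns, since bumping can open a new column. *)

Lemma eq0_contra n : ~ 0 < n -> n = 0.
Proof. by case: n => // n []. Qed.

(** * Counts of entries by column *)

Record counts := Counts { nH : nat -> nat -> nat; nL : nat -> nat -> nat; nA : nat -> nat -> nat }.

Definition nE X c v := nH X c v + nL X c v.
(* Counting the hook entries [< v] of column [c]; an entry [v] of that column lies in row [hlt X c v.+1 - 1]. *)
Definition hlt X c v := \sum_(w < v) nH X c w.
(* An entry [v] of column [c] is in the row that [v] would occupy as a hook entry of column [c.+1]. *)
Definition tight X c v := (hlt X c.+1 v).+1 == hlt X c v.+1.

(** [valid_row] is the row condition: if [v] lies in row [r] of column [c], then at most the [r]
    hook entries below row [r] of column [c.+1] are [< v]. [valid_height] says, without naming a
    shape, that column [c.+1] is no higher than column [c], because [hlt] is the height of the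
    column for large values. *)
Record valid X : Prop := Valid {
  valid_ext : forall c v, nE X c v <= 1;
  valid_row : forall c v, 0 < nE X c v + nA X c v -> hlt X c.+1 v < hlt X c v.+1;
  valid_height : forall c v, exists w, hlt X c.+1 v <= hlt X c w }.

(* Column [c] reads [+^E(i+1) -^E(i) -^A(i) +^A(i+1)], since its extended legs are read downwards and before its arms; this reduces to [-^xs +^ys]. *)
Definition xs i X c := nE X c i + nA X c i - nE X c i.+1.
Definition ys i X c := nA X c i.+1 + (nE X c i.+1 - (nE X c i + nA X c i)).

(** With column [d] reading [-^(x d) +^(y d)], this is the number of [+] left unpaired by the
    columns before [c]; [open_minus x y n c] is the number of [-] left unpaired by the [n] columns
    starting at [c]. *)
Fixpoint open_plus (x y : nat -> nat) c :=
  if c is d.+1 then y d + (open_plus x y d - x d) else 0.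
Fixpoint open_minus (x y : nat -> nat) n c :=
  if n is n'.+1 then x c + (open_minus x y n' c.+1 - y c) else 0.

(** The column of the rightmost unpaired [-]. The [+] arriving from the left do not suffice for the
    [-] of column [c], hence none of them survives, and the later [-] must all be paired by the [+]
    of column [c] itself. [e_pick] is the mirror image. *)
Definition f_pick (x y : nat -> nat) N c :=
  [&& c < N, open_plus x y c < x c & open_minus x y (N - c.+1) c.+1 <= y c].
Definition e_pick (x y : nat -> nat) N c :=
  [&& c < N, open_minus x y (N - c.+1) c.+1 < y c & open_plus x y c <= x c].

Notation f_at i X := (f_pick (xs i X) (ys i X)).
Notation e_at i X := (e_pick (xs i X) (ys i X)).

(* The case (S) of [f_i]: the entry [i] of the next cell of the row must be its hook entry. *)
Definition slides X i c :=
  [&& tight X c i, 0 < nH X c.+1 i & nH X c i.+1 == 0].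

Definition arm_shift c x y X X' := forall d v, [/\ nH X' d v = nH X d v, nL X' d v = nL X d v &
  nA X' d v + (d == c) && (v == x) = nA X d v + (d == c) && (v == y)].

(** The entry changes its value but not its kind; the positivity tests select whether it is a hook
    or a leg entry. *)
Definition ext_shift c x y X X' := forall d v, [/\
  nH X' d v + [&& 0 < nH X c x, d == c & v == x] = nH X d v + [&& 0 < nH X c x, d == c & v == y],
  nL X' d v + [&& 0 < nL X c x, d == c & v == x] = nL X d v + [&& 0 < nL X c x, d == c & v == y] &
  nA X' d v = nA X d v].

(** The net effect of (S): when the hook entry [i] is removed, the leg entry [i+1] of the same cell
    becomes the hook entry, and a leg entry [i+1] appears in the other cell. So one hook entry
    changes its value, and one leg entry [z] passes from column [g] to column [h]. *)
Definition leg_slide c x y g h z X X' := forall d v, [/\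
  nH X' d v + (d == c) && (v == x) = nH X d v + (d == c) && (v == y),
  nL X' d v + (d == g) && (v == z) = nL X d v + (d == h) && (v == z) & nA X' d v = nA X d v].

(** [F_arm] covers both (M) and the case (N) of an arm entry. Under (M) the cell above has hook
    entry [i+1], which pairs with one [i] of the column, so an unpaired [-] forces an arm entry
    [i]. *)
Inductive f_rel i c X X' : Prop :=
| F_slide of slides X i c & 0 < nL X c.+1 i.+1 &
  leg_slide c.+1 i i.+1 c.+1 c i.+1 X X'
| F_arm of ~~ slides X i c & 0 < nA X c i &
  arm_shift c i i.+1 X X'
| F_ext of ~~ slides X i c & nA X c i = 0 & 0 < nE X c i &
  ext_shift c i i.+1 X X'.

(* The choices made by [V_b]: it bumps [a] out of column [p]; [hk] tells whether the entry [k] exists. *)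
Record V_sel X p a (hk : bool) (k : nat) : Prop := VSel {
  Vsel_right : forall d v, p < d -> nA X d v = 0;
  Vsel_arm : 0 < nA X p a;
  Vsel_max : forall v, a < v -> nA X p v = 0;
  Vsel_k : hk -> (0 < nE X p.+1 k) && (a <= k);
  Vsel_min : forall v, a <= v -> (hk -> v < k) -> nE X p.+1 v = 0 }.

(* The leg entries that move to column [p.+1]: the first two conditions say that the bumping is of type (b). *)
Definition moved X p a (hk : bool) k v :=
  if [&& hk ==> (0 < nH X p.+1 k), tight X p a, a < v & hlt X p v.+1 == hlt X p a.+1]
  then nL X p v else 0.

(** The entry [a] takes over the kind of [k]: it becomes a hook entry if [k] is one or does not
    exist, and a leg entry otherwise. Both types of bumping are covered, since [moved] vanishes in
    type (a). *)
Definition V_rel X p a hk k Y : Prop := forall d v, [/\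
  nH Y d v + [&& hk, 0 < nH X p.+1 k, d == p.+1 & v == k] =
  nH X d v + [&& hk ==> (0 < nH X p.+1 k), d == p.+1 & v == a],
  nL Y d v + [&& hk, nH X p.+1 k == 0, d == p.+1 & v == k] + (d == p) * moved X p a hk k v =
  nL X d v + [&& hk, nH X p.+1 k == 0, d == p.+1 & v == a] + (d == p.+1) * moved X p a hk k v &
  nA Y d v + (d == p) && (v == a) = nA X d v + [&& hk, d == p.+1 & v == k]].

(** * Elementary facts on hook counts and on the moved leg entries *)

Lemma hltS X c v : hlt X c v.+1 = hlt X c v + nH X c v.
Proof. by rewrite /hlt big_ord_recr. Qed.

Lemma hlt_mono X c v w : v <= w -> hlt X c v <= hlt X c w.
Proof.
move=> le; rewrite -(subnKC le); elim: (w - v) => [|n IH]; first by rewrite addn0.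
by rewrite addnS hltS (leq_trans IH) ?leq_addr.
Qed.

Lemma hlt_gap X c v w : v <= w -> (forall u, v <= u < w -> nH X c u = 0) -> hlt X c w = hlt X c v.
Proof.
move=> le; rewrite -(subnKC le); elim: (w - v) => [|n IH] h; first by rewrite addn0.
by rewrite addnS hltS IH => [|u hu]; rewrite ?h //; lia.
Qed.

Lemma hlt_move X X' c b b' x y :
  (forall w, nH X' c w + b && (w == x) = nH X c w + b' && (w == y)) ->
  forall v, hlt X' c v + b && (x < v) = hlt X c v + b' && (y < v).
Proof.
move=> h; elim=> [|v IH]; first by rewrite /hlt !big_ord0; lia.
by rewrite !hltS; move: (h v); lia.
Qed.

Lemma hlt_eq X X' c : (forall w, nH X' c w = nH X c w) -> forall v, hlt X' c v = hlt X c v.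
Proof. by move=> h v; apply: eq_bigr => w _; apply: h. Qed.

Lemma valid_unique_hook X c v : valid X -> 0 < nH X c v -> nH X c v = 1 /\ nL X c v = 0.
Proof. by move=> /valid_ext/(_ c v); rewrite /nE; lia. Qed.

(** The moved leg entries lie in the row in which column [p.+1] has hook entry [k], and the row
    condition bounds them by that hook entry. *)
Lemma moved_le X p a hk k v : valid X -> V_sel X p a hk k ->
  hk -> 0 < moved X p a hk k v -> v <= k.
Proof.
move=> vX sX hk_; rewrite /moved hk_ /=; case: ifP => // /and4P[Hk t av hr] Lv.
rewrite leqNgt; apply/negP => kv.
have := valid_row (c := p) (v := v) vX; rewrite /nE => /(_ ltac:(lia)).
have := hlt_mono X p.+1 kv; rewrite hltS.
have /andP[_ ak] := Vsel_k sX hk_.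
have := hlt_mono X p.+1 ak. move: t; rewrite /tight; lia.
Qed.

Lemma V_relE X Y p a hk k v : V_rel X p a hk k Y ->
  [/\ nH Y p v = nH X p v, nL Y p v + moved X p a hk k v = nL X p v &
      nA Y p v + (v == a) = nA X p v] /\
  [/\ nH Y p.+1 v + [&& hk, 0 < nH X p.+1 k & v == k] =
        nH X p.+1 v + (hk ==> (0 < nH X p.+1 k)) && (v == a),
      nL Y p.+1 v + [&& hk, nH X p.+1 k == 0 & v == k] =
        nL X p.+1 v + [&& hk, nH X p.+1 k == 0 & v == a] + moved X p a hk k v &
      nA Y p.+1 v = nA X p.+1 v + hk && (v == k)].
Proof.
move=> rX; split; [move: (rX p v)|move: (rX p.+1 v)]; rewrite eqxx mul1n.
  have -> : p == p.+1 = false by lia.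
  by rewrite mul0n !andbF !addn0.
have -> : p.+1 == p = false by lia.
by rewrite mul0n /= !addn0.
Qed.

(** * The joint sign word of the columns [p] and [p.+1] *)

Lemma open_plusS x y c : open_plus x y c.+1 = y c + (open_plus x y c - x c).
Proof. by []. Qed.

Lemma open_minusS x y n c : open_minus x y n.+1 c = x c + (open_minus x y n c.+1 - y c).
Proof. by []. Qed.

(** The two equations say that [-^(x p) +^(y p) -^(x p.+1) +^(y p.+1)] keeps its reduction, which is
    all that the other columns see of it. Only the value at [p.+1], taken between the two columns,
    can differ. *)
Lemma block_plus x y x' y' p : (forall d, d != p -> d != p.+1 -> x' d = x d /\ y' d = y d) ->
  x' p + (x' p.+1 - y' p) = x p + (x p.+1 - y p) ->
  y' p.+1 + (y' p - x' p.+1) = y p.+1 + (y p - x p.+1) ->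
  forall c, c != p.+1 -> open_plus x' y' c = open_plus x y c.
Proof.
move=> h ex ey.
have low c : c <= p -> open_plus x' y' c = open_plus x y c.
  elim: c => //= c IH lt; rewrite IH; last exact: ltnW.
  by have [-> ->] := h c ltac:(lia) ltac:(lia).
have high n : open_plus x' y' (p.+2 + n) = open_plus x y (p.+2 + n).
  elim: n => [|n IH]; first by rewrite addn0 !open_plusS low //; lia.
  by rewrite addnS (open_plusS x') (open_plusS x) IH; have [-> ->] := h (p.+2 + n) ltac:(lia) ltac:(lia).
move=> c ne; have [/low//|lt] := leqP c p.
by have -> : c = p.+2 + (c - p.+2) by lia.
Qed.

Lemma block_minus x y x' y' p N : (forall d, d != p -> d != p.+1 -> x' d = x d /\ y' d = y d) ->
  x' p + (x' p.+1 - y' p) = x p + (x p.+1 - y p) ->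
  y' p.+1 + (y' p - x' p.+1) = y p.+1 + (y p - x p.+1) -> p.+1 < N ->
  forall c, c != p.+1 -> open_minus x' y' (N - c) c = open_minus x y (N - c) c.
Proof.
move=> h ex ey ltN.
have high n c : p.+1 < c -> open_minus x' y' n c = open_minus x y n c.
  elim: n c => //= n IH c lt; rewrite IH; last exact: ltnW.
  by have [-> ->] := h c ltac:(lia) ltac:(lia).
have low n : n <= p -> open_minus x' y' (N - (p - n)) (p - n) = open_minus x y (N - (p - n)) (p - n).
  elim: n => [|n IH] le.
    rewrite subn0; have -> : N - p = (N - p.+2).+2 by lia.
    by rewrite !open_minusS high //; lia.
  have -> : N - (p - n.+1) = (N - (p - n)).+1 by lia.
  rewrite (open_minusS x') (open_minusS x); have -> : (p - n.+1).+1 = p - n by lia.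
  by rewrite IH; last lia; have [-> ->] := h (p - n.+1) ltac:(lia) ltac:(lia).
move=> c ne; have [le|/high//] := leqP c p.+1.
have -> : c = p - (p - c) by lia.
by apply: low; lia.
Qed.

Lemma moved_gt0 X p a hk k v : 0 < moved X p a hk k v ->
  [/\ hk ==> (0 < nH X p.+1 k), tight X p a, a < v, hlt X p v.+1 = hlt X p a.+1 &
      0 < nL X p v /\ moved X p a hk k v = nL X p v].
Proof. by rewrite /moved; case: ifP => // /and4P[? ? ? /eqP ?] ?; split. Qed.

(** The moved entries are the entries above [a] in the leg of one cell. So if [i+1] moves and
    [a < i], any [i] in an extended leg of column [p] moves with it; if [i] moves, a leg entry [i+1]
    follows unless [i+1] is a hook entry of the column. *)
Lemma moved_facts X p a hk k i : valid X -> V_sel X p a hk k ->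
  let s := moved X p a hk k in
  [/\ s i <= nL X p i, s i.+1 <= nL X p i.+1, 0 < s i -> a < i & 0 < s i.+1 -> a <= i] /\
  [/\ 0 < s i -> hk -> i <= k, 0 < s i.+1 -> hk -> i < k,
      a < i -> 0 < s i.+1 -> nH X p i.+1 = 0 /\ nE X p i = s i,
      0 < s i -> nH X p i.+1 = 0 -> s i.+1 = nL X p i.+1 &
      hk -> 0 < s i + s i.+1 -> 0 < nH X p.+1 k].
Proof.
move=> vX sX s; split; split.
- by rewrite /s /moved; case: ifP.
- by rewrite /s /moved; case: ifP.
- by rewrite /s /moved; case: ifP => // /and4P[].
- by rewrite /s /moved; case: ifP => // /and4P[].
- by move=> h1 h2; apply: moved_le h1.
- by move=> h1 h2; apply: moved_le h1.
- move=> lt /moved_gt0[b1 b2 _ h2 [h3 _]]; rewrite /s /moved b1 b2 lt /= /nE.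
  move: (valid_ext vX p i.+1); rewrite /nE.
  have := hlt_mono X p lt; rewrite -h2 !hltS; case: eqP; lia.
- move=> /moved_gt0[b1 b2 h1 h2 _] h3; rewrite /s /moved b1 b2 (hltS _ _ i.+1) h2 h3 addn0 eqxx.
  by rewrite ltnS ltnW.
- move=> hk_; rewrite addn_gt0 => /orP[] /moved_gt0[h *]; exact: (implyP h).
Qed.

Lemma V_relE_ext X Y p a hk k v : V_rel X p a hk k Y ->
  nE Y p v + moved X p a hk k v = nE X p v /\
  nE Y p.+1 v + hk && (v == k) = nE X p.+1 v + (v == a) + moved X p a hk k v.
Proof.
move=> /(V_relE v)[[h1 h2 _] [h4 h5 _]]; rewrite /nE; split; first lia.
move: (moved X p a hk k v) h2 h5 => s h2 h5; case: hk h4 h5 => /=; last lia.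
by case: posnP; case: (v == k); case: (v == a); rewrite /= ?andbT ?andbF /=; lia.
Qed.

Lemma V_sel_k X p a hk k i : V_sel X p a hk k ->
  let k0 := hk && (i == k) in let k1 := hk && (i.+1 == k) in
  [/\ k0 -> 0 < nE X p.+1 i /\ a <= i, k1 -> 0 < nE X p.+1 i.+1 /\ a <= i.+1,
      k1 -> a <= i -> nE X p.+1 i = 0, a <= i -> hk && (k <= i) = false -> nE X p.+1 i = 0 &
      a <= i.+1 -> hk && (k <= i.+1) = false -> nE X p.+1 i.+1 = 0].
Proof.
move=> sX /=; split.
- by case/andP=> hk_ /eqP ek; have := Vsel_k sX hk_; rewrite -ek => /andP[].
- by case/andP=> hk_ /eqP ek; have := Vsel_k sX hk_; rewrite -ek => /andP[].
- by case/andP=> hk_ /eqP ek ai; apply: (Vsel_min sX) => // _; rewrite -ek.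
- by move=> ai h; apply: (Vsel_min sX) => //; move: h; case: (hk) => /=; lia.
- by move=> ai h; apply: (Vsel_min sX) => //; move: h; case: (hk) => /=; lia.
Qed.

Lemma le1_bool n : n <= 1 -> exists b : bool, n = b.
Proof. by case: n => [|[|n]] // _; [exists false | exists true]. Qed.

(** The case [a < i]. Here [e0, e1] and [f0, f1] are the multiplicities of [i, i+1] in the extended
    legs of columns [p] and [p.+1], [s, t] those of the moved leg entries, and [c0, c1] tell whether
    [k] is [i] or [i+1]. As [a] is the largest arm entry, column [p] has no arm entries [i] or
    [i+1]. *)
Lemma block_lo (e0 e1 f0 f1 s t c0 c1 : bool) :
  [&& s ==> e0, t ==> e1, c0 ==> f0, c1 ==> f1 && ~~ f0,
    s ==> (f0 == c0) && (~~ c0 ==> (f1 == c1)) & t ==> [&& ~~ f0, f1 == c1 & e0 == s]] ->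
  let x := e0 - s - (e1 - t) in let y := e1 - t - (e0 - s) in
  let g0 := f0 + s in let g1 := f1 + t - c1 in
  x + (g0 - g1 - y) = e0 - e1 + (f0 - f1 - (e1 - e0)) /\
  c1 + (g1 - g0) + (y - (g0 - g1)) = f1 - f0 + (e1 - e0 - (f0 - f1)).
Proof. by case: e0; case: e1; case: f0; case: f1; case: s; case: t; case: c0; case: c1. Qed.

(** The case [a = i]: column [p] has [m.+1] arm entries [i] before bumping and [m] afterwards. *)
Lemma block_eq (e m : nat) (e1 f0 f1 t c1 : bool) :
  [&& t ==> e1, c1 ==> f1 && ~~ f0, ~~ f0 ==> (f1 == c1) & t ==> ~~ f0 && (f1 == c1)] ->
  let x := e + m - (e1 - t) in let y := e1 - t - (e + m) in
  let g0 := f0 + 1 in let g1 := f1 + t - c1 in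
  x + (g0 - g1 - y) = e + m.+1 - e1 + (f0 - f1 - (e1 - (e + m.+1))) /\
  c1 + (g1 - g0) + (y - (g0 - g1)) = f1 - f0 + (e1 - (e + m.+1) - (f0 - f1)).
Proof.
rewrite (addnS e); move: (e + m) => M.
by case: e1; case: f0; case: f1; case: t; case: c1 => //= _; case: M => [|[|M]] /=; lia.
Qed.

(** The case [a = i+1]: one of [n.+1] arm entries [i+1] leaves column [p], and column [p.+1] has an
    [i+1] in its extended legs afterwards. *)
Lemma block_hi (x y n f0 : nat) (f1 : bool) : f0 <= 1 ->
  x + (f0 - 1 - (n + y)) = x + (f0 - f1 - (n.+1 + y)) /\
  f1 + (1 - f0) + (n + y - (f0 - 1)) = f1 - f0 + (n.+1 + y - (f0 - f1)).
Proof. case: f1; lia. Qed.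

(* Bumping keeps the reduced sign word of the columns [p] and [p.+1] together. *)
Lemma V_block X Y p a hk k i : valid X -> valid Y -> V_sel X p a hk k -> V_rel X p a hk k Y ->
  [/\ forall d, d != p -> d != p.+1 -> xs i Y d = xs i X d /\ ys i Y d = ys i X d,
  xs i Y p + (xs i Y p.+1 - ys i Y p) = xs i X p + (xs i X p.+1 - ys i X p) &
  ys i Y p.+1 + (ys i Y p - xs i Y p.+1) = ys i X p.+1 + (ys i X p - xs i X p.+1)].
Proof.
move=> vX vY sX rX.
suff [e1 e2] : xs i Y p + (xs i Y p.+1 - ys i Y p) = xs i X p + (xs i X p.+1 - ys i X p) /\
  ys i Y p.+1 + (ys i Y p - xs i Y p.+1) = ys i X p.+1 + (ys i X p - xs i X p.+1).
  split=> //.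
  move=> d np nq; rewrite /xs /ys /nE.
  move: (rX d i) (rX d i.+1); rewrite (negPf np) (negPf nq) !andbF !mul0n !addn0.
  by move=> [-> -> ->] [-> -> ->].
have [[s1 s2 s3 s4] [s5 s6 s7 _ _]] := moved_facts i vX sX.
have {}s7 lt h := proj2 (s7 lt h).
have s8 : moved X p a hk k i <= nE X p i by apply: leq_trans s1 _; rewrite /nE leq_addl.
have s9 : moved X p a hk k i.+1 <= nE X p i.+1 by apply: leq_trans s2 _; rewrite /nE leq_addl.
have [[_ _ aP] [_ _ aQ]] := V_relE i rX; have [[_ _ aP1] [_ _ aQ1]] := V_relE i.+1 rX.
have [eP eQ] := V_relE_ext i rX; have [eP1 eQ1] := V_relE_ext i.+1 rX.
have [k1 k2 k3 k4 k5] := V_sel_k i sX.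
have Aq v := Vsel_right sX v (ltnSn p).
have Am := Vsel_max sX; have As := Vsel_arm sX.
have ak (hk_ : hk) : a <= k by have /andP[] := Vsel_k sX hk_.
move: eP eQ eP1 eQ1 aP aP1 aQ aQ1; rewrite /xs /ys !Aq !add0n.
move: s3 s4 s5 s6 s7 s8 s9 k1 k2 k3 k4 k5 {s1 s2}.
move: (moved X p a hk k i) (moved X p a hk k i.+1) => s t.
have [e0 ->] := le1_bool (valid_ext vX p i); have [e1 ->] := le1_bool (valid_ext vX p i.+1).
have [f0 ->] := le1_bool (valid_ext vX p.+1 i); have [f1 ->] := le1_bool (valid_ext vX p.+1 i.+1).
move=> s3 s4 s5 s6 s7 s8 s9 k1 k2 k3 k4 k5 eP eQ eP1 eQ1 aP aP1 aQ aQ1.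
set c0 := hk && (i == k) in k1 eQ aQ *; set c1 := hk && (i.+1 == k) in k2 k3 eQ1 aQ1 *.
have f1E : a <= i.+1 -> (hk -> i < k) -> f1 = c1 :> nat.
  move=> ai ik; case: (boolP c1) => [/k2[]|h]; first by case: (f1).
  apply: k5 => //; apply/negP => /andP[hk_ ki]; case/negP: h.
  by rewrite /c1 hk_ eqn_leq ki ik.
have f0E : a <= i -> (hk -> i <= k) -> f0 = c0 :> nat.
  move=> ai ik; case: (boolP c0) => [/k1[]|h]; first by case: (f0).
  apply: k4 => //; apply/negP => /andP[hk_ ki]; case/negP: h.
  by rewrite /c0 hk_ eqn_leq ki ik.
have c0F : (hk -> i < k) -> c0 = false.
  by move=> h; apply/negP => /andP[/h + /eqP e]; rewrite e ltnn.
have ltk : (hk -> i <= k) -> c0 = false -> hk -> i < k.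
  by move=> h + hk_; rewrite /c0 hk_ /= ltn_neqAle h // => ->.
have [eEp eEp1] : nE Y p i = e0 - s /\ nE Y p i.+1 = e1 - t by move: eP eP1; clear; lia.
have [eEq eEq1] : nE Y p.+1 i + c0 = f0 + (i == a) + s /\ nE Y p.+1 i.+1 = f1 + (i.+1 == a) + t - c1.
  by move: eQ eQ1; clear; lia.
rewrite aQ aQ1 eEp eEp1 eEq eEq1.
have [bs es] := le1_bool (leq_trans s8 (leq_b1 _)); have [bt et] := le1_bool (leq_trans s9 (leq_b1 _)).
rewrite {}es in s3 s4 s5 s6 s7 s8 *; rewrite {}et in s4 s6 s7 s9 *.
have c1F : (hk -> i < k) -> a <= i -> c1 -> f1 && ~~ f0.
  move=> ik ai h; have := f1E (leqW ai) ik; have := k3 h ai; rewrite h.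
  by case: (f0); case: (f1).
(* For [i < a] nothing of value [i] or [i+1] changes unless [a = i+1], because the moved leg entries
   exceed [a] and [k >= a]. *)
have [lt|gt|e] := ltngtP a i.
- have [h1 h2] := (Am _ lt, Am _ (leqW lt)).
  have na : (i == a) = false by move: lt; clear; lia.
  have na1 : (i.+1 == a) = false by move: lt; clear; lia.
  move: aP aP1; rewrite h1 h2 ?na na1 !addn0 => -> ->; rewrite !addn0.
  apply: block_lo; apply/and5P; split; last (apply/andP; split); apply/implyP => h.
  + by move: s8; rewrite h lt0b.
  + by move: s9; rewrite h lt0b.
  + by have [] := k1 h; rewrite lt0b.
  + apply: (c1F _ (ltnW lt) h) => hk_; case/andP: h => _ /eqP <-; exact: ltnSn.
  + have ik := s5 (ltac:(by rewrite h)); have := f0E (ltnW lt) ik.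
    case: (boolP c0) => [_|/negbTE c0f]; first by case: (f0).
    by have := f1E (leqW (ltnW lt)) (ltk ik c0f); case: (f1); case: (c1); case: (f0).
  + have ik := s6 (ltac:(by rewrite h)).
    have := f0E (ltnW lt) (fun h => ltnW (ik h)); rewrite (c0F ik).
    have := f1E (leqW (ltnW lt)) ik; have := s7 lt (ltac:(by rewrite h)).
    by case: (f0); case: (f1); case: (c1); case: (e0); case: (bs).
- have na : (i == a) = false by move: gt; clear; lia.
  have c0f : c0 = false by apply: c0F => hk_; apply: leq_trans gt (ak hk_).
  have bsf : bs = false by apply/negP => h; have := s3 (ltac:(by rewrite h)); move: gt; clear; lia.
  have btf : bt = false by apply/negP => h; have := s4 (ltac:(by rewrite h)); move: gt; clear; lia.
  rewrite bsf btf ?na !subn0 !addn0; move: aP; rewrite na addn0 => aP; rewrite aP.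
  have [na1|na1] := eqVneq i.+1 a.
    have := f1E (ltac:(by rewrite na1)) (fun h => leq_trans gt (ak h)).
    move: As aP1; rewrite -na1 ?eqxx ?addn1 => _ <- <-; rewrite subSnn.
    exact: block_hi (leq_b1 _).
  have c1f : c1 = false.
    by apply/negP => /andP[h /eqP ek]; have := ak h; rewrite -ek; move: gt na1; clear; lia.
  by move: aP1; rewrite ?(negPf na1) c1f addn0 => ->; rewrite /= !addn0 !subn0.
- have [h2 ik] := (Am _ (ltac:(by rewrite e) : a < i.+1), (fun h => ltac:(by rewrite -e; exact: ak)) : hk -> i <= k).
  have na1 : (i.+1 == a) = false by rewrite e; clear; lia.
  have bsf : bs = false by apply/negP => h; have := s3 (ltac:(by rewrite h)); rewrite e ltnn.
  have aile : a <= i by rewrite e.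
  move: aP aP1 As; rewrite h2 na1 e ?eqxx bsf /= !addn0 !subn0 ?addn1 => <- -> _.
  rewrite -e ?addn0 !add0n -(addn1 f0).
  apply: block_eq; apply/and4P; split; apply/implyP => h.
  + by move: s9; rewrite h lt0b.
  + by apply: (c1F _ aile h) => hk_; case/andP: h => _ /eqP <-; exact: ltnSn.
  + have c0f : c0 = false by have := f0E aile ik; case: (c0) h; case: (f0).
    by have := f1E (leqW aile) (ltk ik c0f); case: (f1); case: (c1).
  + have ik' := s6 (ltac:(by rewrite h)).
    have := f0E aile ik; rewrite (c0F ik').
    have := f1E (leqW aile) ik'.
    by case: (f0); case: (f1); case: (c1).
Qed.

Definition eqc X Y := forall d v, [/\ nH X d v = nH Y d v, nL X d v = nL Y d v & nA X d v = nA Y d v].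

(** Hides indicators and products behind variables. The compared systems share the same indicators,
    and the conclusions hold by linear arithmetic whatever the values of these are. *)
Ltac gen_terms := repeat match goal with
  | |- context [nat_of_bool ?b] => generalize (nat_of_bool b); intro
  | |- context [muln ?x ?y] => generalize (muln x y); intro
  end.

Lemma V_pick_far X Y p a hk k i N c : valid X -> valid Y -> V_sel X p a hk k -> V_rel X p a hk k Y ->
  p.+1 < N -> c != p -> c != p.+1 ->
  f_at i Y N c = f_at i X N c.
Proof.
move=> vX vY sX rX ltN np nq; have [h1 h2 h3] := V_block i vX vY sX rX.
rewrite /f_pick (block_plus h1 h2 h3) // (block_minus h1 h2 h3) //.
by have [-> ->] := h1 _ np nq.
Qed.

(** Whether the rightmost unpaired [-] lies in the pair [p], [p.+1] depends only on the reduced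
    joint word, which bumping keeps; its column within the pair may change. *)
Lemma V_pick_near X Y p a hk k i N c : valid X -> valid Y -> V_sel X p a hk k -> V_rel X p a hk k Y ->
  p.+1 < N -> (c == p) || (c == p.+1) -> f_at i X N c ->
  exists2 c2, (c2 == p) || (c2 == p.+1) & f_at i Y N c2.
Proof.
move=> vX vY sX rX ltN hc; have [h1 h2 h3] := V_block i vX vY sX rX.
have hp := block_plus h1 h2 h3 (c := p) ltac:(lia).
have hm := block_minus h1 h2 h3 ltN (c := p.+2) ltac:(lia).
move=> pk; suff : f_at i Y N p || f_at i Y N p.+1.
  by case/orP => [h|h]; [exists p | exists p.+1] => //; rewrite eqxx ?orbT.
have : f_at i X N p || f_at i X N p.+1.
  by case/orP: hc pk => /eqP -> ->; rewrite ?orbT.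
have eN : N - p.+1 = (N - p.+2).+1 by lia.
rewrite /f_pick eN !open_plusS !open_minusS hp hm ltN (ltnW ltN) /=.
move: (open_plus _ _ _) (open_minus _ _ _ _) h2 h3 => u w.
move: (xs i X p) (xs i X p.+1) (ys i X p) (ys i X p.+1) (xs i Y p) (xs i Y p.+1) (ys i Y p) (ys i Y p.+1).
by move=> {h1 hp hm rX}; clear; lia.
Qed.

Lemma V_rel_hlt X Y p a hk k d v : V_rel X p a hk k Y -> d != p.+1 -> hlt Y d v = hlt X d v.
Proof.
move=> rX nd; apply: hlt_eq => w; have [+ _ _] := rX d w.
by rewrite (negPf nd) !andbF !addn0.
Qed.

Lemma V_rel_hlt_next X Y p a hk k v : V_rel X p a hk k Y ->
  hlt Y p.+1 v + [&& hk, 0 < nH X p.+1 k & k < v] = hlt X p.+1 v + (hk ==> (0 < nH X p.+1 k)) && (a < v).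
Proof.
move=> rX; rewrite [in LHS]andbA; apply: hlt_move => w; have [+ _ _] := rX p.+1 w.
by rewrite eqxx -!andbA.
Qed.

Lemma V_rel_other X Y p a hk k d v : V_rel X p a hk k Y -> d != p -> d != p.+1 ->
  [/\ nH Y d v = nH X d v, nL Y d v = nL X d v & nA Y d v = nA X d v].
Proof.
move=> rX np nq; have := rX d v.
by rewrite (negPf np) (negPf nq) !andbF !mul0n !addn0.
Qed.

(** * Consequences of a slide *)

Lemma slides_none X i c : valid X -> slides X i c -> nE X c i.+1 + nA X c i.+1 = 0.
Proof.
move=> vX /and3P[/eqP tg Hi /eqP H0].
(* Without a hook entry [i+1], an [i+1] of column [c] would share the row of [i], to the left of the
   hook entry [i] of column [c.+1]. *)
apply: eq0_contra => /(valid_row vX).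
by rewrite !(hltS _ _ i.+1) hltS H0 -tg; lia.
Qed.

(** Column [c] contains no [i+1] and offers no [+], so the hook entry [i] of column [c.+1] must be
    paired inside its own column, by a single [i+1] of the extended legs. That this [i+1] is a leg
    entry is what allows (S) to remove a hook entry. *)
Lemma slide_facts X i N c : valid X -> nH X N i = 0 -> f_at i X N c ->
  slides X i c ->
  [/\ nE X c i.+1 = 0, nA X c i.+1 = 0, nH X c.+1 i = 1, nL X c.+1 i.+1 = 1 &
      nA X c.+1 i = 0].
Proof.
move=> vX HN /and3P[cN _ pk] sl; have no := slides_none vX sl.
have /and3P[/eqP tg Hi /eqP H0] := sl.
have lt : c.+1 < N.
  by rewrite ltn_neqAle cN andbT; apply/eqP => e; rewrite -e in HN; lia.
move: pk; have -> : N - c.+1 = (N - c.+2).+1 by lia.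
rewrite open_minusS /xs {3}/ys.
have := valid_ext vX c.+1 i; have := valid_ext vX c.+1 i.+1; rewrite /nE in no * => e1 e2 x0.
suff H1 : nH X c.+1 i.+1 = 0 by split; lia.
apply: eq0_contra => H1.
(* Suppose that [i+1] is a hook entry of column [c.+1], hence in the row above [i]. By the heights,
   column [c] has a hook entry in that row too; it is the least hook entry [h > i]. As [h] is not
   [i+1], it exceeds its right neighbour. *)
have [w hw] := valid_height vX c i.+2.
have [h /andP[ih Hh] hmin] : exists2 h, (i < h) && (0 < nH X c h) & forall u, i < u < h -> nH X c u = 0.
  have ex : exists h, (i < h) && (0 < nH X c h).
    have [/existsP[u /andP[iu Hu]]|/existsPn none] := boolP [exists u : 'I_w, (i < u) && (0 < nH X c u)].
      by exists u; rewrite iu.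
    have [le|lt'] := leqP i.+1 w.
      have e := @hlt_gap X c i.+1 w le; move: hw; rewrite e ?hltS; first by move: tg; rewrite hltS; lia.
      by move=> u /andP[iu uw]; have := none (Ordinal uw); rewrite /= iu /=; lia.
    by have := hlt_mono X c (ltnW lt'); move: hw tg; rewrite !hltS; lia.
  have [h hh hm] := ex_minnP ex; exists h => // u /andP[iu uh].
  by apply: eq0_contra => Hu; have := hm u; rewrite iu Hu; lia.
have hne : h != i.+1 by apply/eqP => e; move: Hh; rewrite e H0.
have := valid_row (c := c) (v := h) vX; rewrite /nE hltS (hlt_gap ih hmin) => /(_ ltac:(lia)).
have := valid_ext vX c h; have := @hlt_mono X c.+1 i.+2 h ltac:(lia); rewrite /nE.
by move: tg; rewrite !hltS; lia.
Qed.

(** * Commutation of [f_i] with one bumping *)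

Lemma commute_far X Y X' p a hk k i N c : valid X -> nH X N i = 0 -> valid Y -> V_sel X p a hk k ->
  V_rel X p a hk k Y -> p.+1 < N -> c != p -> c != p.+1 ->
  f_at i X N c -> f_rel i c X X' ->
  [/\ f_at i Y N c, V_sel X' p a hk k &
    forall Y' Y'', V_rel X' p a hk k Y' -> f_rel i c Y Y'' -> eqc Y' Y''].
Proof.
move=> vX HN vY sX rX ltN np nq pk fX.
have nq' : c.+1 != p.+1 by lia.
have eq_sl : slides Y i c = slides X i c.
  rewrite /slides /tight !(V_rel_hlt _ rX) //.
  have [-> _ _] := V_rel_other i.+1 rX np nq.
  have [+ _ _] := rX c.+1 i.
  by rewrite (negPf nq') !andbF !addn0 => ->.
have eA v : nA Y c v = nA X c v by have [] := V_rel_other v rX np nq.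
have eH v : nH Y c v = nH X c v by have [] := V_rel_other v rX np nq.
have eL v : nL Y c v = nL X c v by have [] := V_rel_other v rX np nq.
have ec : (c == p) = false by lia.
have ecq : (p.+1 == c) = false by lia.
have ecq1 : (p.+1 == c.+1) = false by lia.
have ecp : (p == c) = false by lia.
have [eHq eLq] : (forall v, nH X' p.+1 v = nH X p.+1 v) /\ (forall v, nL X' p.+1 v = nL X p.+1 v).
  by split=> v; case: fX => [_ _|_ _|_ _ _] /(_ p.+1 v);
    rewrite ?ecq ?ecq1 ?andbF /= ?addn0; case.
have eEq v : nE X' p.+1 v = nE X p.+1 v by rewrite /nE eHq eLq.
have eAp v : nA X' p v = nA X p v.
  by case: fX => [_ _|_ _|_ _ _] /(_ p v) []; rewrite ?ecp ?andbF /= ?addn0.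
have sX' : V_sel X' p a hk k.
  case: sX => sr sa sm sk smin; split.
  - move=> d v lt; have := sr d v lt.
    case: fX => [_ _|_ A0|_ _ _] /(_ d v) [_ _]; [by move=> ->| |by move=> ->].
    case: (d =P c) => [e|_] /=; last by rewrite !addn0 => ->.
    by move: A0; rewrite sr // -e.
  - by rewrite eAp.
  - by move=> v lt; rewrite eAp sm.
  - by move=> /sk; rewrite eEq.
  - by move=> v le h; rewrite eEq smin.
have emv v : moved X' p a hk k v = moved X p a hk k v.
  rewrite /moved eHq /tight.
  have -> w : hlt X' p.+1 w = hlt X p.+1 w by exact: hlt_eq.
  (* The only overlap: for [p = c.+1] a slide alters the hook entry [i] and the leg entry [i+1] of
     column [p]. There is no arm entry [i], so [a != i], and the leg entry [i+1] was not a moved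
     one, because for [a < i] the hook entry [i] separates it from [a]. *)
  have [ecp1|ecp1] := eqVneq p c.+1; last first.
    have eHp w : nH X' p w = nH X p w.
      case: fX => [_ _|_ _|_ _ _] /(_ p w) []; rewrite ?(negPf ecp1) ?ecp ?andbF /= ?addn0 //.
    rewrite !(hlt_eq eHp).
    suff -> : nL X' p v = nL X p v by [].
    by case: fX => [_ _|_ _|_ _ _] /(_ p v) []; rewrite ?(negPf ecp1) ?ecp ?andbF /= ?addn0.
  case: fX => [sl L1|_ _|_ _ _] fX.
  - have [_ _ + + +] := slide_facts vX HN pk sl; rewrite -ecp1 => Hi Li Ai.
    have ea : a != i by apply/eqP => e; have := Vsel_arm sX; rewrite e Ai.
    have hp : forall w, hlt X' p w + (i < w) = hlt X p w + (i.+1 < w).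
      have hm : forall w, nH X' p w + true && (w == i) = nH X p w + true && (w == i.+1).
        by move=> w; have [+ _ _] := fX p w; rewrite ecp1 eqxx.
      by move=> w; have := hlt_move hm w.
    have -> : hlt X' p a.+1 = hlt X p a.+1 by have := hp a.+1; lia.
    have := hp v.+1; have [_ + _] := fX p v; rewrite ecp1 eqxx -ecp1 ecp addn0 /=.
    have [->|n1] := eqVneq v i.
      have [_] := valid_unique_hook vX (c := p) (v := i) ltac:(lia).
      have -> : (i == i.+1) = false by lia.
      by move=> -> ; rewrite addn0 => -> _; rewrite !if_same.
    have [->|n2] := eqVneq v i.+1.
      rewrite Li => e _; have -> : nL X' p i.+1 = 0 by lia.
      rewrite if_same; case: ifP => // /and4P[_ _ ai /eqP]; rewrite !hltS.
      have /(hlt_mono X p) : a < i by lia.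
      by rewrite hltS; lia.
    by rewrite addn0 => -> e; have -> : hlt X' p v.+1 = hlt X p v.+1 by lia.
  - have eHp w : nH X' p w = nH X p w by have [] := fX p w.
    rewrite !(hlt_eq eHp).
    by have [_ -> _] := fX p v.
  - have eHp w : nH X' p w = nH X p w by have [] := fX p w; rewrite ecp !andbF !addn0.
    rewrite !(hlt_eq eHp).
    by have [_ + _] := fX p v; rewrite ecp !andbF !addn0 => ->.
split=> //; first by rewrite (V_pick_far i vX vY sX rX).
move=> Y' Y'' rX' fY d v.
have := rX' d v; rewrite emv eHq; have := rX d v.
case: fX => [sl L1|sl A1|sl A0 E1] /(_ d v);
case: fY => [sl' L1'|sl' A1'|sl' A0' E1'] /(_ d v);
  try (by move: sl sl'; rewrite eq_sl; case: (slides X i c)); try (by move: A1 A0'; rewrite eA => + e; rewrite e);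
  try (by move: A1' A0; rewrite eA => + e; rewrite e).
- gen_terms; case=> ? ? ? [? ? ?] [? ? ?] [? ? ?]; split; lia.
- gen_terms; case=> ? ? ? [? ? ?] [? ? ?] [? ? ?]; split; lia.
- rewrite eH eL; gen_terms; case=> ? ? ? [? ? ?] [? ? ?] [? ? ?]; split; lia.
Qed.

Lemma f_pick_near X p i N c : p.+1 < N -> (c == p) || (c == p.+1) -> f_at i X N c ->
  let u := open_plus (xs i X) (ys i X) p in
  let w := open_minus (xs i X) (ys i X) (N - p.+2) p.+2 in
  if c == p then u < xs i X p /\ xs i X p.+1 + (w - ys i X p.+1) <= ys i X p
  else ys i X p + (u - xs i X p) < xs i X p.+1 /\ w <= ys i X p.+1.
Proof.
move=> ltN hc pk /=; move: pk; rewrite /f_pick.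
have eN : N - p.+1 = (N - p.+2).+1 by lia.
case: eqP => [->|ne] /and3P[_]; first by rewrite eN open_minusS.
have -> : c = p.+1 by lia.
by rewrite open_plusS.
Qed.

Lemma V_stats X Y p a hk k i : V_sel X p a hk k -> V_rel X p a hk k Y ->
  [/\ xs i X p.+1 = nE X p.+1 i - nE X p.+1 i.+1, ys i X p.+1 = nE X p.+1 i.+1 - nE X p.+1 i,
      xs i Y p.+1 = nE Y p.+1 i + hk && (i == k) - nE Y p.+1 i.+1 &
      ys i Y p.+1 = hk && (i.+1 == k) + (nE Y p.+1 i.+1 - (nE Y p.+1 i + hk && (i == k)))].
Proof.
move=> sX rX; have A0 v := Vsel_right sX v (ltnSn p).
have [_ [_ _ e1]] := V_relE i rX; have [_ [_ _ e2]] := V_relE i.+1 rX.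
by rewrite /xs /ys e1 e2 !A0 !addn0.
Qed.

Lemma V_rel_hlt_same X Y p a hk k v : V_rel X p a hk k Y -> hlt Y p v = hlt X p v.
Proof. by move=> rX; apply: (V_rel_hlt _ rX); lia. Qed.

Lemma slides_stable X Y p a hk k i : V_rel X p a hk k Y -> i < a -> (hk -> i < k) ->
  slides Y i p = slides X i p.
Proof.
move=> rX lt ltk; rewrite /slides /tight (V_rel_hlt_same _ rX).
have [[-> _ _] _] := V_relE i.+1 rX.
have := V_rel_hlt_next i rX; have [_ [+ _ _]] := V_relE i rX.
have -> : (i == a) = false by lia.
have -> : (a < i) = false by lia.
rewrite !andbF !addn0; case: hk ltk {rX} => [/(_ isT) ltk|_]; last by rewrite !addn0 => -> ->.
have -> : (i == k) = false by lia.
have -> : (k < i) = false by lia.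
by rewrite !andbF !addn0 => -> ->.
Qed.

(* [f_i] acts on the bumped counts [Y] in some column, bumping acts on [X'] from the same column [p], and both results agree. *)
Definition commuting N i Y X' p hk :=
  exists c2 a' k', [/\ f_at i Y N c2, V_sel X' p a' hk k' &
    forall Y' Y'', V_rel X' p a' hk k' Y' -> f_rel i c2 Y Y'' -> eqc Y' Y''].

(** The changed arm entry becomes [i+1 <= a], so [a] remains the largest arm entry of column [p],
    and both sides bump the same [a] and displace the same [k]. *)
Lemma commute_arm_above X Y X' p a hk k i N : valid X -> valid Y -> valid X' -> V_sel X p a hk k ->
  V_rel X p a hk k Y -> p.+1 < N -> f_at i X N p ->
  ~~ slides X i p -> 0 < nA X p i ->
  arm_shift p i i.+1 X X' ->
  i < a ->
  commuting N i Y X' p hk.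
Proof.
move=> vX vY vX' sX rX ltN pk sl A1 fX ia.
have [] := V_pick_near vX vY sX rX ltN _ pk; first by rewrite eqxx.
move=> c2 hc pk2.
have ltk : hk -> i < k by move=> /(Vsel_k sX)/andP[_]; lia.
have := f_pick_near ltN (c := p) _ pk; rewrite eqxx => /(_ isT) /= [u1 w1].
have pt := f_pick_near ltN hc pk2.
have ec2 : c2 = p.
  apply/eqP; move: pt; case/orP: hc => // /eqP ->.
  have -> : (p.+1 == p) = false by lia.
  have [h1 h2 h3] := V_block i vX vY sX rX.
  rewrite (block_plus h1 h2 h3); last by lia.
  have := block_minus h1 h2 h3 ltN (c := p.+2) ltac:(lia).
  move=> -> {h1 h2 h3} /= [u2 w2].
  have [e1 e2 e3 e4] := V_stats i sX rX; move: u1 w1 u2 w2; rewrite e1 e2 e3 e4 {e1 e2 e3 e4}.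
  rewrite /xs /ys.
  have [[_ _ +] [_ _ +]] := V_relE i rX; have [[_ _ +] [_ _ +]] := V_relE i.+1 rX.
  have := V_relE_ext i rX; have := V_relE_ext i.+1 rX.
  have := valid_ext vX p.+1 i.+1; have := valid_ext vX p.+1 i.
  have := valid_ext vY p.+1 i.+1; have := valid_ext vY p.+1 i.
  have -> : moved X p a hk k i = 0 by rewrite /moved; case: ifP => // /and4P[]; lia.
  have -> : moved X p a hk k i.+1 = 0 by rewrite /moved; case: ifP => // /and4P[]; lia.
  have -> : hk && (i == k) = false by case: hk ltk {sX rX pk2 A1} => //= /(_ isT); lia.
  move: (open_plus _ _ _) (open_minus _ _ _ _); move: vX => _.
  have -> : (i == a) = false by lia.
  have : hk && (i.+1 == k) -> 0 < nE X p.+1 i.+1 /\ i.+1 == a.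
    by case/andP => hk_ /eqP e; have := Vsel_k sX hk_; rewrite -e; lia.
  clear; case: (i.+1 == a); case: (hk && (i.+1 == k)); lia.
rewrite {}ec2 in pk2 pt *.
exists p, a, k; split=> //.
  case: sX => s1 s2 s3 s4 s5; split=> //.
  - move=> d v lt; have [_ _] := fX d v; have -> : (d == p) = false by lia.
    by rewrite !addn0 s1.
  - by have [_ _] := fX p a; rewrite eqxx /=; lia.
  - move=> v lt; have [_ _] := fX p v; rewrite eqxx /= (s3 _ lt).
    have -> : (v == i.+1) = false by lia.
    by lia.
  - by move=> /s4; rewrite /nE; have [-> -> _] := fX p.+1 k.
  - by move=> v le h; have := s5 v le h; rewrite /nE; have [-> -> _] := fX p.+1 v.
have eH d v : nH X' d v = nH X d v by have [] := fX d v.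
have eL d v : nL X' d v = nL X d v by have [] := fX d v.
have em v : moved X' p a hk k v = moved X p a hk k v.
  by rewrite /moved /tight eH eL !(hlt_eq (eH _)).
move=> Y' Y'' rX' fY d v.
have := rX' d v; rewrite em !eH; have := rX d v; have := fX d v.
have [[_ _ eA] _] := V_relE i rX.
case: fY => [sl'|_ _ /(_ d v)|_ A0].
- by move: sl'; rewrite (slides_stable rX ia ltk) (negPf sl).
- gen_terms; case=> ? ? ? [? ? ?] [? ? ?] [? ? ?]; split; lia.
- by move: eA; rewrite A0; lia.
Qed.

(* [f_i] acts in column [c], [p] or [p.+1]: [u] and [w] are the numbers of unpaired [+] and [-] coming from the columns before [p] and after [p.+1]. *)
Definition near_pick (x y : nat -> nat) p u w c :=
  if c == p then u < x p /\ x p.+1 + (w - y p.+1) <= y p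
  else y p + (u - x p) < x p.+1 /\ w <= y p.+1.

Lemma V_near_pick X Y p a hk k i N c : valid X -> valid Y -> V_sel X p a hk k -> V_rel X p a hk k Y ->
  p.+1 < N -> (c == p) || (c == p.+1) -> f_at i X N c ->
  exists c2 u w, [/\ (c2 == p) || (c2 == p.+1), f_at i Y N c2,
    near_pick (xs i X) (ys i X) p u w c & near_pick (xs i Y) (ys i Y) p u w c2].
Proof.
move=> vX vY sX rX ltN hc pk; have [h1 h2 h3] := V_block i vX vY sX rX.
have [c2 hc2 pk2] := V_pick_near vX vY sX rX ltN hc pk.
exists c2; exists (open_plus (xs i X) (ys i X) p).
exists (open_minus (xs i X) (ys i X) (N - p.+2) p.+2); split=> //; first exact: f_pick_near.
rewrite -(block_plus h1 h2 h3); last by lia.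
rewrite -(block_minus h1 h2 h3 ltN); last by lia.
exact: f_pick_near.
Qed.

(** A moved leg entry would exceed [a] and be at most [k = a]. *)
Lemma moved_self X p a v : valid X -> V_sel X p a true a -> moved X p a true a v = 0.
Proof.
move=> vX sX; apply: eq0_contra => h.
by have := moved_le vX sX isT h; have [_ _ + _ _] := moved_gt0 h; lia.
Qed.

Lemma not_slides X i c : hlt X c.+1 i.+1 < hlt X c i.+1 -> ~~ slides X i c.
Proof. by move=> h; apply/negP => /and3P[/eqP e H _]; move: h; rewrite -e hltS; lia. Qed.

(** The missing case of tightness: after bumping, no [v] with [a <= v < k] slides out of column
    [p.+1]. If [k] exists, it is an arm entry of [Y]; the row condition at [k] gives the inequality,
    since no hook entry of [X] lies strictly between [v] and [k]. If [k] does not exist, bumping has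
    put a new cell on column [p.+1], which already was at least as high as the next column. *)
Lemma V_overhang X Y p a hk k v : valid X -> valid Y -> V_sel X p a hk k -> V_rel X p a hk k Y ->
  a <= v -> (hk -> v < k) -> hlt Y p.+2 v.+1 < hlt Y p.+1 v.+1.
Proof.
move=> vX vY sX rX av ltk; rewrite (V_rel_hlt (d := p.+2) _ rX); last by lia.
have gap w : v < w -> (hk -> w <= k) -> hlt X p.+1 w = hlt X p.+1 v.+1.
  move=> lt hw; apply: hlt_gap => // u /andP[vu uw]; have := Vsel_min sX (v := u) ltac:(lia).
  by rewrite /nE => h; have := h (fun hk_ => leq_trans uw (hw hk_)); lia.
have := V_rel_hlt_next v.+1 rX; case: hk sX rX ltk gap => /= sX rX ltk gap; last first.
  have [w hw] := valid_height vX p.+1 v.+1.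
  have [le|lt] := leqP w v.+1; first by have := hlt_mono X p.+1 le; lia.
  by have := gap w (ltnW lt) ltac:(by []); lia.
have {}ltk := ltk isT; have /andP[_ ak] := Vsel_k sX isT.
have := valid_row vY (c := p.+1) (v := k); have [_ [_ _ ->]] := V_relE k rX.
rewrite eqxx addn1 addnS => /(_ isT); have := V_rel_hlt_next k.+1 rX.
rewrite (V_rel_hlt (d := p.+2) _ rX); last by lia.
have := hlt_mono X p.+2 ltk; rewrite (hltS X p.+1 k) (gap _ ltk) //.
have -> : k < v.+1 = false by lia.
rewrite !ltnS leqnn ak av !andbT andbF.
by have := valid_ext vX p.+1 k; rewrite /nE; case: posnP => /=; lia.
Qed.

(** With [a = k = i], bumping merely carries an arm entry [i] to column [p.+1]. Column [p] offers no
    [+], so the [i] in the extended legs of column [p.+1] is paired by an [i+1] there. Hence after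
    [f_i] the bumped and the displaced entry are both [i+1], and on [Y] the carried arm entry is the
    one to change. *)
Lemma commute_arm_hit X Y X' p i N : valid X -> valid Y -> valid X' -> V_sel X p i true i ->
  V_rel X p i true i Y -> p.+1 < N -> f_at i X N p ->
  arm_shift p i i.+1 X X' ->
  commuting N i Y X' p true.
Proof.
move=> vX vY vX' sX rX ltN pk fX.
have [c2 [u [w [hc2 pk2]]]] := V_near_pick vX vY sX rX ltN (c := p) ltac:(lia) pk.
have m0 v := moved_self v vX sX.
have [eP eQ] := V_relE_ext i rX; have [eP1 eQ1] := V_relE_ext i.+1 rX.
have [[_ _ aP] [_ _ aQ]] := V_relE i rX; have [[_ _ aP1] [_ _ aQ1]] := V_relE i.+1 rX.
have x1 := valid_ext vX p.+1 i; have x2 := valid_ext vX p.+1 i.+1.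
have /andP[x3 _] := Vsel_k sX isT.
have ne : (i.+1 == i) = false by lia.
have nq : (p.+1 == p) = false by lia.
have Ap0 := Vsel_max sX (ltnSn i).
have As := Vsel_arm sX.
have pts : near_pick (xs i X) (ys i X) p u w p -> near_pick (xs i Y) (ys i Y) p u w c2 ->
   nE X p.+1 i.+1 = 1 /\ c2 = p.+1.
  rewrite /near_pick eqxx.
  have [-> -> -> ->] := V_stats i sX rX; rewrite /xs /ys.
  move: eP eQ eP1 eQ1 aP aQ aP1 aQ1 x1 x2 x3 Ap0; rewrite !m0 !eqxx /= ne.
  case/orP: hc2 => /eqP ->; [rewrite eqxx|rewrite nq].
    by clear; lia.
  by clear; lia.
move=> pX pY; have [E1 ec2] := pts pX pY; rewrite {}ec2 {pts hc2} in pk2 *.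
have sX' : V_sel X' p i.+1 true i.+1.
  case: sX As => s1 _ s3 s4 s5 As; split.
  - move=> d v lt; have [_ _] := fX d v; have -> : (d == p) = false by lia.
    by rewrite !addn0 s1.
  - by have [_ _] := fX p i.+1; rewrite !eqxx ne; lia.
  - move=> v lt; have [_ _] := fX p v; rewrite eqxx /= (s3 v (ltnW lt)).
    have -> : (v == i.+1) = false by lia.
    by lia.
  - by move=> _; rewrite /nE; have [-> -> _] := fX p.+1 i.+1; rewrite -/(nE X p.+1 i.+1) E1 /=.
  - by move=> v le /(_ isT); lia.
exists p.+1, i.+1, i.+1; split=> // Y' Y'' rX' fY d v.
have m0' := moved_self v vX' sX'.
case: fY => [sl'|_ _ /(_ d v)|_ A0].
- by have := slides_none vY sl'; move: eQ1; rewrite m0 ne /=; lia.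
- have := rX' d v; have := rX d v; have := fX d v; rewrite m0 m0' muln0 /=.
  have [-> _ _] := fX p.+1 i.+1.
  by gen_terms; case=> ? ? ? [? ? ?] [? ? ?] [? ? ?]; split; lia.
- by move: aQ; rewrite A0 eqxx; lia.
Qed.

(** Raising the bumped entry from [i] to [i+1] exempts exactly the leg entry [i+1] from moving. *)
Lemma moved_arm_succ X p i hk k v : valid X -> V_sel X p i hk k -> (hk -> i < k) ->
  moved X p i.+1 hk k v + (v == i.+1) * moved X p i hk k i.+1 = moved X p i hk k v.
Proof.
move=> vX sX ltk; have Hi : nE X p.+1 i = 0 by apply: (Vsel_min sX).
have tq : tight X p i.+1 = ((hlt X p.+1 i).+1 == hlt X p i.+2).
  have H0 : nH X p.+1 i = 0 by move: Hi; rewrite /nE; lia.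
  by rewrite /tight (hltS X p.+1 i) H0 addn0.
have vr := valid_row vX (c := p) (v := i); have := Vsel_arm sX.
case: (ltngtP v i.+1) => [lt|gt|->].
- by move=> _; rewrite addn0 /moved; do 2!(case: ifP => [/and4P[]|_] //; try lia).
- move=> Ai; have {}vr := vr ltac:(lia); rewrite addn0 /moved tq /tight.
  (* If [i+1] is a hook entry of column [p], no larger leg entry moves on either side: for [i+1] the
     column is not tight, and for [i] the larger entries lie in higher rows. *)
  have [H0|H1] := posnP (nH X p i.+1); first by rewrite (hltS X p i.+1) H0 addn0 gt (ltnW gt).
  have := hlt_mono X p gt; rewrite (hltS X p i.+1) => h.
  have -> : (hlt X p v.+1 == hlt X p i.+1) = false.
    by have := hlt_mono X p (leqnSn v); lia.
  have -> : ((hlt X p.+1 i).+1 == hlt X p i.+1 + nH X p i.+1) = false by lia.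
  by rewrite !andbF.
- by move=> _; rewrite mul1n {1}/moved ltnn !andbF.
Qed.

(** The source of (S). If a leg entry [i+1] moves along with [a = i], then in [Y] the inserted [i]
    is a hook entry with [i+1] in its leg, right of an [i] of column [p]; bumping [i+1] in [X']
    leaves this leg entry in column [p], and the slide in [Y] returns it there. If no [i+1] moves,
    [f_i] simply changes the inserted [i] in column [p.+1]. The number [s] distinguishes the two
    cases. *)
Lemma commute_arm_miss X Y X' p hk k i N : valid X -> valid Y -> valid X' -> V_sel X p i hk k ->
  V_rel X p i hk k Y -> p.+1 < N -> f_at i X N p ->
  arm_shift p i i.+1 X X' ->
  (hk -> i < k) ->
  commuting N i Y X' p hk.
Proof.
move=> vX vY vX' sX rX ltN pk fX ltk.
have [c2 [u [w [hc2 pk2]]]] := V_near_pick vX vY sX rX ltN (c := p) ltac:(lia) pk.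
have Hi : nE X p.+1 i = 0 by apply: (Vsel_min sX).
have [eP eQ] := V_relE_ext i rX; have [eP1 eQ1] := V_relE_ext i.+1 rX.
have [[_ _ aP] [_ _ aQ]] := V_relE i rX; have [[_ _ aP1] [_ _ aQ1]] := V_relE i.+1 rX.
have ne : (i.+1 == i) = false by lia.
have nq : (p.+1 == p) = false by lia.
have Ap0 := Vsel_max sX (ltnSn i).
have As := Vsel_arm sX.
have m0 : moved X p i hk k i = 0 by rewrite /moved ltnn !andbF.
have ki : hk && (i == k) = false by move: ltk; case: (hk) => //= /(_ isT); lia.
have ki1 : hk && (i.+1 == k) = (0 < nE X p.+1 i.+1).
  have [/andP[hk_ /eqP ek]|h] := boolP (hk && _).
    by have /andP[+ _] := Vsel_k sX hk_; rewrite -ek.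
  by have := Vsel_min sX (v := i.+1) (leqnSn i); move: h ltk; case: (hk) => /=; lia.
have x2 := valid_ext vX p.+1 i.+1; have x3 := valid_ext vX p i.+1.
set s := moved X p i hk k i.+1.
have pts : near_pick (xs i X) (ys i X) p u w p -> near_pick (xs i Y) (ys i Y) p u w c2 ->
   s = 0 /\ c2 = p.+1 \/ s = 1 /\ c2 = p.
  rewrite /near_pick eqxx.
  have [-> -> -> ->] := V_stats i sX rX; rewrite /xs /ys.
  move: eP eQ eP1 eQ1 aP aQ aP1 aQ1 x2 x3 Ap0; rewrite ki ki1 m0 -/s Hi eqxx ne.
  have : s <= nL X p i.+1 by rewrite /s /moved; case: ifP.
  have : nL X p i.+1 <= nE X p i.+1 by rewrite /nE; lia.
  case/orP: hc2 => /eqP ->; [rewrite eqxx|rewrite nq].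
    by clearbody s; clear; case: (nE X p.+1 i.+1) => [|[|]] //=; lia.
  by clearbody s; clear; case: (nE X p.+1 i.+1) => [|[|]] //=; lia.
move=> pX pY; have := pts pX pY; move=> {pts pX pY} pts.
have sX' : V_sel X' p i.+1 hk k.
  case: sX As => s1 _ s3 s4 s5 As; split.
  - move=> d v lt; have [_ _] := fX d v; have -> : (d == p) = false by lia.
    by rewrite !addn0 s1.
  - by have [_ _] := fX p i.+1; rewrite !eqxx ne; lia.
  - move=> v lt; have [_ _] := fX p v; rewrite eqxx /= (s3 v (ltnW lt)).
    have -> : (v == i.+1) = false by lia.
    by lia.
  - by move=> h; rewrite ltk // /nE; have [-> -> _] := fX p.+1 k; have /andP[] := s4 h; rewrite andbT.
  - by move=> v le h; rewrite /nE; have [-> -> _] := fX p.+1 v; apply: s5 => //; apply: ltnW.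
exists c2, i.+1, k; split=> // Y' Y'' rX' fY d v.
have eH d' v' : nH X' d' v' = nH X d' v' by have [] := fX d' v'.
have eh d' v' : hlt X' d' v' = hlt X d' v' by apply: hlt_eq.
have em v' : moved X' p i.+1 hk k v' = moved X p i.+1 hk k v'.
  by rewrite /moved /tight eH !eh; have [_ -> _] := fX p v'.
have := rX' d v; rewrite em eH; have := rX d v; have := fX d v.
rewrite -(moved_arm_succ v vX sX ltk) -/s.
have [_ [hH hL _]] := V_relE i rX; move: hH hL; rewrite m0 eqxx andbT !addn0.
rewrite [[&& hk, 0 < nH X p.+1 k & _]]andbCA [[&& hk, nH X p.+1 k == 0 & _]]andbCA ki !andbF !addn0.
have [-> ->] : nH X p.+1 i = 0 /\ nL X p.+1 i = 0 by move: Hi; rewrite /nE; lia.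
case: pts => -[es ec2]; rewrite {}ec2 in fY pk2 *; rewrite es ?muln0 ?muln1 ?addn0 ?add0n => hH hL.
  case: fY => [sl'|_ A1|_ _ _ /(_ d v)].
  - by move/negP: (not_slides (V_overhang vX vY sX rX (leqnn i) ltk)).
  - by exfalso; have := Vsel_right sX i (ltnSn p); move: A1; rewrite aQ ki; clear; lia.
  - rewrite hH hL !lt0b -!andbA !andTb.
    by gen_terms; case=> ? ? ? [? ? ?] [? ? ?] [? ? ?]; split; lia.
have [b1 tg _ _ [Li _]] := moved_gt0 (v := i.+1) (ltac:(by rewrite -/s es) : 0 < moved X p i hk k i.+1).
have sl : slides Y i p.
  rewrite /slides hH b1 /=; have [[-> _ _] _] := V_relE i.+1 rX.
  have := valid_ext vX p i.+1; rewrite /nE => ?; apply/andP; split; last by lia.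
  move: tg; rewrite /tight (V_rel_hlt_same _ rX) => /eqP <-.
  have := V_rel_hlt_next i rX; rewrite ltnn !andbF addn0.
  have -> : [&& hk, 0 < nH X p.+1 k & k < i] = false by move: ltk; case: (hk) => //= /(_ isT); lia.
  by rewrite addn0 => ->.
case: fY => [_ _ /(_ d v)|/negP//|/negP//].
have -> : hk ==> (0 < nH X p.+1 k) = true by [].
have b2 b : [&& hk, nH X p.+1 k == 0 & b] = false by move: b1; case: (hk) => //=; lia.
rewrite !b2 !mulnDr !mulnb !andTb.
by gen_terms; case=> ? ? ? [? ? ?] [? ? ?] [? ? ?]; split; lia.
Qed.

Lemma slides_stable_low X Y p a k i : V_rel X p a true k Y -> a < i -> k < i ->
  slides Y i p = slides X i p.
Proof.
move=> rX lt ltk; rewrite /slides /tight (V_rel_hlt_same _ rX).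
have [[-> _ _] _] := V_relE i.+1 rX.
have := V_rel_hlt_next i rX; have [_ [+ _ _]] := V_relE i rX.
have -> : (i == a) = false by lia.
have -> : (i == k) = false by lia.
by rewrite lt ltk !andbF !andbT !addn0 /= => -> /addIn ->.
Qed.

(** With no [i+1] in the extended legs of column [p] and [a != i], no hook entry and no bumped value
    separates [i] from [i+1], so the new leg entry [i+1] moves exactly when [i] did. *)
Lemma moved_ext X X' p a hk k i v : valid X -> a != i -> nE X p i.+1 = 0 ->
  ext_shift p i i.+1 X X' ->
  moved X' p a hk k v + (v == i) * moved X p a hk k i =
  moved X p a hk k v + (v == i.+1) * moved X p a hk k i.
Proof.
move=> vX ai Ei1 fX; have nq : (p.+1 == p) = false by lia.
have ex0 := valid_ext vX p i; rewrite /nE in ex0 Ei1.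
have eq w : hlt X' p.+1 w = hlt X p.+1 w.
  by apply: hlt_eq => u; have [+ _ _] := fX p.+1 u; rewrite nq !andbF !addn0.
have ep w : hlt X' p w + (0 < nH X p i) && (i < w) = hlt X p w + (0 < nH X p i) && (i.+1 < w).
  by apply: hlt_move => u; have [+ _ _] := fX p u; rewrite eqxx.
have ea : hlt X' p a.+1 = hlt X p a.+1.
  by have := ep a.+1; case: (0 < nH X p i) => /=; lia.
rewrite /moved /tight eq ea; have := fX p.+1 k; rewrite nq !andbF !addn0 => -[-> _ _].
have ni : (i == i.+1) = false by lia.
have [->|n1] := eqVneq v i.
  have -> : nL X' p i = 0.
    by have [_ + _] := fX p i; rewrite !eqxx ni !andbF !andbT; lia.
  by rewrite ni if_same mul1n addn0.
have [->|n2] := eqVneq v i.+1.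
  have [L1 L0] : nL X p i.+1 = 0 /\ nH X p i.+1 = 0 by lia.
  have ni' : (i.+1 == i) = false by lia.
  have := fX p i.+1; rewrite L1 ni' !eqxx !andbF !andbT !addn0 => -[_ -> _].
  rewrite if_same ?eqxx /= ?mul0n ?mul1n ?addn0 ?add0n.
  have [->|L2] := posnP (nL X p i); first by rewrite !if_same.
  have -> : nL X p i = 1 by lia.
  have Hi : nH X p i = 0 by lia.
  have := ep i.+2; rewrite Hi !addn0 => ->; rewrite (hltS X p i.+1) L0 addn0 /=.
  by have -> : (a < i.+1) = (a < i) by lia.
rewrite ?(negPf n1) ?(negPf n2) ?mul0n ?addn0; have := fX p v; rewrite (negPf n1) (negPf n2) !andbF !addn0 => -[_ -> _].
have -> : hlt X' p v.+1 = hlt X p v.+1.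
  by have := ep v.+1; case: (0 < nH X p i) => /=; lia.
by [].
Qed.

(** If [i] does not move, [f_i] changes it in column [p] on both sides. If it moves, it is a leg
    entry of column [p.+1] in [Y] and is changed there. *)
Lemma commute_ext_left X Y X' p a hk k i N : valid X -> valid Y -> V_sel X p a hk k ->
  V_rel X p a hk k Y -> p.+1 < N -> f_at i X N p ->
  ~~ slides X i p -> nA X p i = 0 -> 0 < nE X p i ->
  ext_shift p i i.+1 X X' ->
  commuting N i Y X' p hk.
Proof.
move=> vX vY sX rX ltN pk sl A0 E0 fX.
have [c2 [u [w [hc2 pk2]]]] := V_near_pick vX vY sX rX ltN (c := p) ltac:(lia) pk.
have nai : (i == a) = false by apply/eqP => e; have := Vsel_arm sX; rewrite -e A0.
have [eP eQ] := V_relE_ext i rX; have [eP1 eQ1] := V_relE_ext i.+1 rX.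
have [[_ _ aP] [_ _ aQ]] := V_relE i rX; have [[_ _ aP1] [_ _ aQ1]] := V_relE i.+1 rX.
have nq : (p.+1 == p) = false by lia.
have [k1 k2 k3 k4 k5] := V_sel_k i sX.
have x0 := valid_ext vX p i.+1; have x1 := valid_ext vX p i.
have x2 := valid_ext vX p.+1 i; have x3 := valid_ext vX p.+1 i.+1.
have m1 : a < i -> nA X p i.+1 = 0 by move=> lt; apply: (Vsel_max sX); lia.
have [[s1 s2 s3 s4] [s5 s6 _ _ _]] := moved_facts i vX sX.
have s0 : moved X p a hk k i <= nE X p i by apply: leq_trans s1 _; rewrite /nE; lia.
have s9 : moved X p a hk k i.+1 <= nE X p i.+1 by apply: leq_trans s2 _; rewrite /nE; lia.
move=> pX pY.
have ex1 : nE X p i.+1 = 0 by move: pX x0 x1; rewrite /near_pick eqxx /xs A0; clear; lia.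
(* A moved [i] with [k = i] would be a leg entry with hook entry [i] to its right, and [f_i] would
   slide in [X]. *)
have nsk : 0 < moved X p a hk k i -> hk && (i == k) = false.
  move=> /moved_gt0[b1 /eqP tg lt hp [Li _]]; apply/negP => /andP[hk_ /eqP ek].
  case/negP: sl; move: b1; rewrite hk_ -ek /slides /tight => /= ->; rewrite hp -tg.
  rewrite (@hlt_gap X p.+1 a i (ltnW lt)) ?eqxx; first by move: ex1; rewrite /nE; clear; lia.
  move=> v /andP[av vi]; have := Vsel_min sX av; rewrite -ek /nE => /(_ (fun _ => vi)); clear; lia.
have pts : (moved X p a hk k i = 0 /\ c2 = p \/
   [/\ moved X p a hk k i = 1, c2 = p.+1, a < i & hk -> i < k]).
  have ltk : 0 < moved X p a hk k i -> hk -> i < k.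
    by move=> s hk_; have := s5 s hk_; have := nsk s; rewrite hk_ /=; clear; lia.
  have key : moved X p a hk k i = 0 /\ c2 = p \/ moved X p a hk k i = 1 /\ c2 = p.+1.
    have sj : moved X p a hk k i.+1 = 0 by apply/eqP; rewrite -leqn0 -ex1.
    move: pX pY; rewrite /near_pick eqxx => -[_ /(leq_trans (leq_addr _ _))].
    have [-> _ -> _] := V_stats i sX rX; rewrite /xs /ys => xq.
    move: s0 eP eQ eP1 eQ1; rewrite nai sj ex1; move: (moved _ _ _ _ _ _) => s s0 eP eQ eP1 eQ1.
    have s1' : s <= 1 by apply: leq_trans s0 x1.
    case/orP: hc2 => /eqP ->; [rewrite eqxx|rewrite nq] => -[y1 _]; [left|right]; split=> //.
      by move: eP aP x1 s1' y1; rewrite A0; clear; lia.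
    have n1 : i.+1 == a -> 0 < nA X p i.+1 by move/eqP->; apply: Vsel_arm sX.
    move: y1 xq aP1 eQ eQ1 eP1 s1' k2 k3 x2 x3 m1 n1; rewrite ex1.
    have : i.+1 < a \/ i.+1 == a \/ a < i by move/eqP: nai; clear; lia.
    move: (hk && (i == k)) (hk && (i.+1 == k)) (i.+1 == a) => b0 b1 b2; clear.
    by case: b0; case: b1; case: b2; lia.
  by case: key => [h|[h1 h2]]; [left|right; split=> //; [apply: s3|apply: ltk]; rewrite h1].
exists c2, a, k.
have sX' : V_sel X' p a hk k.
  case: sX => r1 r2 r3 r4 r5; split.
  - by move=> d v lt; have [_ _ ->] := fX d v; apply: r1.
  - by have [_ _ ->] := fX p a.
  - by move=> v lt; have [_ _ ->] := fX p v; apply: r3.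
  - move=> /r4; rewrite /nE; have := fX p.+1 k; rewrite nq !andbF !addn0.
    by case=> -> -> _.
  - move=> v le h; have := r5 v le h; rewrite /nE; have := fX p.+1 v; rewrite nq !andbF !addn0.
    by case=> -> -> _.
split=> // Y' Y'' rX' fY d v.
have nai' : a != i by rewrite eq_sym nai.
have em := moved_ext hk k v vX nai' ex1 fX.
have := rX' d v; have := fX p.+1 k; rewrite nq !andbF !addn0 => -[-> _ _].
have := rX d v; have := fX d v.
have [[hP lP _] [hQ lQ _]] := V_relE i rX.
case: pts => [[es ec2]|[es ec2 ai ltk]]; rewrite {}ec2 in fY pk2 *; move: em; rewrite es ?muln0 ?muln1 ?addn0 => em.
  have sl' : slides Y i p = false.
    have [lt|gt|e] := ltngtP i a; last by rewrite e eqxx in nai.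
      rewrite (slides_stable rX lt) ?(negPf sl) // => hk_.
      by have /andP[_] := Vsel_k sX hk_; apply: leq_trans.
    have [/andP[hk_ ki]|kge] := boolP (hk && (k < i)).
      by move: rX; rewrite hk_ => rX; rewrite (slides_stable_low rX gt ki) (negPf sl).
    suff h0 : nH Y p.+1 i = 0 by rewrite /slides h0 andbF.
    move: hQ; rewrite nai !andbF addn0.
    have [/andP[hk_ /eqP ek]|nek] := boolP (hk && (i == k)).
      by move: x2; rewrite hk_ -ek eqxx /nE andbT /=; clear; lia.
    have := k4 (ltnW gt); move: kge nek; rewrite /nE; case: (hk) => /=.
      by rewrite -leqNgt => h1 h2 /(_ ltac:(move: h1 h2; clear; lia)); clear; lia.
    by move=> _ _ /(_ erefl); clear; lia.
  case: fY => [|_ A1|_ _ _ /(_ d v)]; first by rewrite sl'.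
    by move: A1 aP; rewrite nai A0; clear; lia.
  rewrite em; move: hP lP; rewrite es addn0 => -> ->.
  by clear; gen_terms; case=> ? ? ? [? ? ?] [? ? ?] [? ? ?]; split; lia.
have ki : hk && (i == k) = false by apply: nsk; rewrite es.
have ki2 b : [&& hk, b & i == k] = false by rewrite andbCA ki andbF.
have Eq0 : nE X p.+1 i = 0 by apply: (Vsel_min sX (ltnW ai)).
have [h0 l0] : nH X p.+1 i = 0 /\ nL X p.+1 i = 0 by move: Eq0; rewrite /nE; clear; lia.
move: hQ lQ; rewrite !ki2 nai !andbF h0 l0 es !addn0 add0n => hQ lQ.
case: fY => [sl'|_ A1|_ _ _ /(_ d v)].
- by move/negP: (not_slides (V_overhang vX vY sX rX (ltnW ai) ltk)).
- by move: A1 aQ; rewrite ki (Vsel_right sX i (ltnSn p)); clear; lia.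
have [_ _ _ _ [L1 L2]] := moved_gt0 (v := i) (ltac:(by rewrite es) : 0 < moved X p a hk k i).
have L3 : nL X p i = 1 by rewrite -L2.
have H3 : nH X p i = 0 by move: x1; rewrite /nE L3; clear; lia.
rewrite hQ lQ L3 H3 /= !addn0.
have e1 : (d == p) * moved X' p a hk k v + (d == p) && (v == i) =
          (d == p) * moved X p a hk k v + (d == p) && (v == i.+1).
  by rewrite -!mulnb -!mulnDr em.
have e2 : (d == p.+1) * moved X' p a hk k v + (d == p.+1) && (v == i) =
          (d == p.+1) * moved X p a hk k v + (d == p.+1) && (v == i.+1).
  by rewrite -!mulnb -!mulnDr em.
move: e1 e2; clear.
by gen_terms => + + [? ? ?] [? ? ?] [? ? ?] [? ? ?]; split; lia.
Qed.

(** Column [p.+1] of [X] has no arm entries, so an unpaired [-] there is a single [i] of the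
    extended legs without an [i+1], and column [p] lets no [+] through. Then an [i] coming from
    column [p] would have to satisfy [a <= i], which makes [k = i] the displaced entry. *)
Lemma V_near_right X Y p a hk k i N : valid X -> valid Y -> V_sel X p a hk k -> V_rel X p a hk k Y ->
  p.+1 < N -> f_at i X N p.+1 ->
  [/\ f_at i Y N p.+1, nE X p.+1 i = 1, nE X p.+1 i.+1 = 0, (i.+1 == a) = false &
  [/\ a <= i -> hk /\ k <= i, hk && (i.+1 == k) = false,
     hk && (i == k) = false -> (i == a) = false /\ moved X p a hk k i = 0 &
     slides Y i p.+1 = slides X i p.+1]].
Proof.
move=> vX vY sX rX ltN pk.
have [c2 [u [w [hc2 pk2]]]] := V_near_pick vX vY sX rX ltN (c := p.+1) ltac:(lia) pk.
have nq : (p.+1 == p) = false by lia.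
move=> pX pY.
have [eP eQ] := V_relE_ext i rX; have [eP1 eQ1] := V_relE_ext i.+1 rX.
have [[_ _ aP] _] := V_relE i rX; have [[_ _ aP1] _] := V_relE i.+1 rX.
have [k1 k2 k3 k4 k5] := V_sel_k i sX.
have x2 := valid_ext vX p.+1 i; have x3 := valid_ext vX p.+1 i.+1.
have [[s1 s2 s3 s4] [s5 s6 _ _ _]] := moved_facts i vX sX.
have [n0 yp] : [/\ nE X p.+1 i = 1, nE X p.+1 i.+1 = 0 & nA X p i.+1 = 0] /\ nE X p i.+1 <= nE X p i + nA X p i.
  move: pX x2 x3; rewrite /near_pick nq; have [-> _ _ _] := V_stats i sX rX.
  by rewrite /ys /xs; clear => h1 h2 h3; split; [split|]; lia.
have [Ei Ei1 Ai1] := n0.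
have na : (i.+1 == a) = false by apply/eqP => e; have := Vsel_arm sX; rewrite -e Ai1.
have ak : a <= i -> hk /\ k <= i.
  move=> ai; have [/andP[]//|h] := boolP (hk && (k <= i)).
  by have := k4 ai (negbTE h); rewrite Ei.
have ki1 : hk && (i.+1 == k) = false.
  by apply/negP => /k2[]; rewrite Ei1.
have sj : moved X p a hk k i.+1 = 0.
  apply: eq0_contra => h; have [hk_ ki] := ak (s4 h).
  by have := s6 h hk_; rewrite ltnNge ki.
have ki0 : hk && (i == k) = false -> (i == a) = false /\ moved X p a hk k i = 0.
  move=> h; split.
    apply/negP => /eqP e; have [hk_ ki] := ak ltac:(by rewrite e).
    by have /andP[_] := Vsel_k sX hk_; rewrite -e => ik; move: h; rewrite hk_ eqn_leq ki ik.
  apply: eq0_contra => s; have [hk_ ki] := ak (ltnW (s3 s)).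
  by have := s5 s hk_ => ik; move: h; rewrite hk_ eqn_leq ki ik.
split=> //; last first.
  split=> //; rewrite /slides /tight (V_rel_hlt (d := p.+2) _ rX); last by lia.
  have := V_rel_hlt_next i.+1 rX; have [_ [+ _ _]] := V_relE i.+1 rX.
  rewrite na !andbF andbCA ki1 andbF !addn0 => ->.
  have [+ _ _] := rX p.+2 i; have -> : (p.+2 == p.+1) = false by lia.
  rewrite !andbF !addn0 => ->.
  have [ai|ia] := leqP a i.
    have [hk_ ki] := ak ai; rewrite hk_ !ltnS ai ki /= !andbT.
    by move=> /addIn ->.
  have -> : (a < i.+1) = false by move: ia; clear; lia.
  have -> : [&& hk, 0 < nH X p.+1 k & k < i.+1] = false.
    by apply/negP => /and3P[/(Vsel_k sX)/andP[_ h1] _ h2]; move: ia h1 h2; clear; lia.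
  by rewrite andbF !addn0 => ->.
suff <- : c2 = p.+1 by [].
case/orP: hc2 => /eqP e //; move: pY; rewrite e /near_pick eqxx.
move=> -[+ /(leq_trans (leq_addr _ _))].
have [_ _ -> _] := V_stats i sX rX; rewrite /xs /ys.
move: eP eQ eP1 eQ1 aP aP1 yp; rewrite sj Ei Ei1 Ai1 na ki1.
by clear; lia.
Qed.

Lemma V_sel_shift X X' p a hk k i : V_sel X p a hk k -> nE X p.+1 i = 1 -> (i.+1 == a) = false ->
  hk && (i.+1 == k) = false -> (forall d v, nA X' d v = nA X d v) ->
  (forall v, v != i -> v != i.+1 -> nE X' p.+1 v = nE X p.+1 v) ->
  nE X' p.+1 i = 0 -> 0 < nE X' p.+1 i.+1 ->
  V_sel X' p a hk (if hk && (i == k) then i.+1 else k).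
Proof.
move=> sX Ei na ki1 eAA eEE Ei' Ei1'; have [_ _ _ k4 _] := V_sel_k i sX.
have ak : a <= i -> hk /\ k <= i.
  move=> ai; have [/andP[]//|h] := boolP (hk && (k <= i)).
  by have := k4 ai (negbTE h); rewrite Ei.
set k' := if _ then _ else _.
case: (sX) => r1 r2 r3 r4 r5; split.
- by move=> d v lt; rewrite eAA r1.
- by rewrite eAA.
- by move=> v lt; rewrite eAA r3.
- move=> hk_; have /andP[h1 h2] := r4 hk_; rewrite /k'.
  case: ifP => [/andP[_ /eqP e]|ki0]; first by rewrite Ei1' e ltnW.
  by rewrite h2 andbT eEE //; apply/negP => /eqP e; move: ki0 ki1; rewrite hk_ e eqxx.
- move=> v av h; have kle : k <= i -> k' <= i.+1 by rewrite /k'; case: ifP => // _; apply: leqW.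
  have [->//|n1] := eqVneq v i.
  have [e|n2] := eqVneq v i.+1.
    have [hk_ ki] := ak ltac:(by move: av na; rewrite e; clear; lia).
    by have := h hk_; rewrite e ltnNge kle.
  rewrite eEE //; apply: r5 => // hk_; have := h hk_; rewrite /k'; case: ifP => // /andP[_ /eqP <-].
  by move: n1; clear; lia.
Qed.

(** If [k = i], then [i] is an arm entry in [Y], where [F_arm] applies, while the displaced entry of
    [X'] is [k' = i+1]. Otherwise the extended leg entry [i] survives bumping and [k' = k]. *)
Lemma commute_ext_right X Y X' p a hk k i N : valid X -> valid Y -> V_sel X p a hk k ->
  V_rel X p a hk k Y -> p.+1 < N -> f_at i X N p.+1 ->
  ~~ slides X i p.+1 ->
  ext_shift p.+1 i i.+1 X X' ->
  commuting N i Y X' p hk.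
Proof.
move=> vX vY sX rX ltN pk sl fX.
have [pk2 Ei Ei1 na [ak ki1 ki0 sl2]] := V_near_right vX vY sX rX ltN pk.
have nq : (p == p.+1) = false by lia.
have [[eLp eHp] eAA] : ((forall v, nL X' p v = nL X p v) /\ (forall v, nH X' p v = nH X p v)) /\
    forall d v, nA X' d v = nA X d v.
  split; [split=> v; have := fX p v|by move=> d v; case: (fX d v)];
  by rewrite nq !andbF !addn0 => -[].
have ehp v : hlt X' p v = hlt X p v by apply: hlt_eq.
have ehq : hlt X' p.+1 a = hlt X p.+1 a.
  have : hlt X' p.+1 a + (0 < nH X p.+1 i) && (i < a) = hlt X p.+1 a + (0 < nH X p.+1 i) && (i.+1 < a).
    by apply: hlt_move => u; have [+ _ _] := fX p.+1 u; rewrite eqxx.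
  have -> : (i.+1 < a) = (i < a) by move: na; clear; lia.
  by move/addIn.
pose k' := if hk && (i == k) then i.+1 else k.
have HL : nL X p.+1 i = 1 - nH X p.+1 i by move: Ei; rewrite /nE; clear; lia.
have HL1 : nH X p.+1 i.+1 = 0 /\ nL X p.+1 i.+1 = 0 by move: Ei1; rewrite /nE; clear; lia.
have ni : (i == i.+1) = false by clear; lia.
have ni' : (i.+1 == i) = false by clear; lia.
have fl : hk -> nH X' p.+1 k' = nH X p.+1 k /\ nL X' p.+1 k' = nL X p.+1 k.
  rewrite /k' => hk_; move: ki1; rewrite hk_ /=; have [<-|ik] := eqVneq i k => ki1.
    have [+ + _] := fX p.+1 i.+1; rewrite !eqxx ni' !andbT !andbF !addn0 HL1.1 HL1.2 => -> ->.
    by move: Ei; rewrite /nE; clear; lia.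
  by have [+ + _] := fX p.+1 k; rewrite eqxx ![k == _]eq_sym ki1 (negPf ik) !andbF !addn0.
have fl1 : (hk ==> (0 < nH X' p.+1 k')) = (hk ==> (0 < nH X p.+1 k)).
  by case: (hk) fl => //= /(_ isT)[-> _].
have em v : moved X' p a hk k' v = moved X p a hk k v.
  by rewrite /moved /tight fl1 eLp !ehp ehq.
have sX' : V_sel X' p a hk k'.
  apply: (V_sel_shift sX) => //.
  - move=> v n1 n2; have := fX p.+1 v; rewrite (negPf n1) (negPf n2) !andbF !addn0 /nE.
    by case=> -> -> _.
  - have := fX p.+1 i; rewrite !eqxx ni !andbF !andbT /nE => -[+ + _].
    by move: Ei; rewrite /nE; clear; lia.
  - have := fX p.+1 i.+1; rewrite !eqxx ni' !andbF !andbT /nE => -[+ + _].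
    by move: Ei; rewrite /nE; clear; lia.
exists p.+1, a, k'; split=> // Y' Y'' rX' fY d v.
have := rX' d v; rewrite em fl1.
have -> b : [&& hk, 0 < nH X' p.+1 k' & b] = [&& hk, 0 < nH X p.+1 k & b].
  by case: (hk) fl => //= /(_ isT)[-> _].
have f2 b : [&& hk, nH X' p.+1 k' == 0 & b] = [&& hk, nH X p.+1 k == 0 & b].
  by case: (hk) fl => //= /(_ isT)[-> _].
rewrite !f2; have := rX d v; have := fX d v.
have [_ [hQ lQ aQ]] := V_relE i rX.
have [/andP[hk_ /eqP ek]|nk] := boolP (hk && (i == k)).
  case: fY => [|_ _ /(_ d v)|_ A1]; first by rewrite sl2 (negPf sl).
    rewrite /k' hk_ -ek eqxx /=.
    have -> : (nH X p.+1 i == 0) = (0 < nL X p.+1 i) by rewrite HL; move: HL Ei; rewrite /nE; clear; lia.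
    by clear; gen_terms; case=> ? ? ? [? ? ?] [? ? ?] [? ? ?]; split; lia.
  by move: A1 aQ; rewrite hk_ -ek eqxx; clear; lia.
have [nia s0] := ki0 (negbTE nk); rewrite /k' (negbTE nk).
case: fY => [|_ A1|_ _ _ /(_ d v)]; first by rewrite sl2 (negPf sl).
  by move: A1 aQ; rewrite (negbTE nk) (Vsel_right sX i (ltnSn p)); clear; lia.
move: hQ lQ; rewrite nia s0 ![[&& hk, _ & i == k]]andbCA (negbTE nk) !andbF !addn0 => -> ->.
by clear; gen_terms; case=> ? ? ? [? ? ?] [? ? ?] [? ? ?]; split; lia.
Qed.

(** The slide adds a leg entry [i+1] to column [p.+1]. It cannot become the displaced entry: if it
    is [>= a], then already [k <= i]. *)
Lemma commute_slide_right X Y X' p a hk k i N : valid X -> valid Y -> V_sel X p a hk k ->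
  V_rel X p a hk k Y -> p.+1 < N -> f_at i X N p.+1 ->
  slides X i p.+1 ->
  leg_slide p.+2 i i.+1 p.+2 p.+1 i.+1 X X' ->
  commuting N i Y X' p hk.
Proof.
move=> vX vY sX rX ltN pk sl fX.
have [pk2 Ei Ei1 na [ak ki1 ki0 sl2]] := V_near_right vX vY sX rX ltN pk.
have nq : (p == p.+2) = false by lia.
have nq1 : (p == p.+1) = false by lia.
have nq2 : (p.+1 == p.+2) = false by lia.
have eAA d v : nA X' d v = nA X d v by case: (fX d v).
have eHp v : nH X' p v = nH X p v by case: (fX p v); rewrite nq !addn0.
have eHq v : nH X' p.+1 v = nH X p.+1 v by case: (fX p.+1 v); rewrite nq2 !addn0.
have eLp v : nL X' p v = nL X p v by case: (fX p v); rewrite nq nq1 !addn0.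
have em v : moved X' p a hk k v = moved X p a hk k v.
  by rewrite /moved /tight eHq !(hlt_eq eHp) (hlt_eq eHq) eLp.
have sX' : V_sel X' p a hk k.
  case: (sX) => r1 r2 r3 r4 r5; split.
  - by move=> d v lt; rewrite eAA r1.
  - by rewrite eAA.
  - by move=> v lt; rewrite eAA r3.
  - move=> /r4; rewrite /nE eHq; have [_ + _] := fX p.+1 k; rewrite nq2; clear; lia.
  - move=> v av h; have := r5 v av h; rewrite /nE eHq; have [_ + _] := fX p.+1 v.
    rewrite nq2 eqxx addn0 /=; have [e|n2] := eqVneq v i.+1; last by rewrite addn0 => ->.
    have [hk_ ki] := ak ltac:(by move: av na; rewrite e; clear; lia).
    by have := h hk_; move: e ki; clear; lia.
exists p.+1, a, k; split=> // Y' Y'' rX' fY d v.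
case: fY => [_ _ /(_ d v)|/negP|/negP]; try by rewrite sl2 sl.
have := rX' d v; rewrite em eHq; have := rX d v; have := fX d v.
by clear; gen_terms; case=> ? ? ? [? ? ?] [? ? ?] [? ? ?]; split; lia.
Qed.

(** If [k = i], bumping displaces the very hook entry that the slide would use. Then [f_i] changes
    the arm entry [i] of column [p.+1] in [Y], and the leg entry [i+1] which the slide puts into
    column [p] is taken back by the bumping of [X']. Otherwise both sides slide. *)
Lemma commute_slide_left X Y X' p a hk k i N : valid X -> nH X N i = 0 -> valid Y ->
  V_sel X p a hk k -> V_rel X p a hk k Y -> p.+1 < N -> f_at i X N p ->
  slides X i p ->
  leg_slide p.+1 i i.+1 p.+1 p i.+1 X X' ->
  commuting N i Y X' p hk.
Proof.
move=> vX HN vY sX rX ltN pk sl fX.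
have [Ep1 Ap1 Hi Li1 Aqi] := slide_facts vX HN pk sl.
have [c2 [u [w [hc2 pk2]]]] := V_near_pick vX vY sX rX ltN (c := p) ltac:(lia) pk.
move=> pX pY.
have nq : (p == p.+1) = false by lia.
have nq' : (p.+1 == p) = false by lia.
have ni : (i == i.+1) = false by clear; lia.
have ni' : (i.+1 == i) = false by clear; lia.
have na : (i.+1 == a) = false by apply/eqP => e; have := Vsel_arm sX; rewrite -e Ap1.
have [k1 k2 k3 k4 k5] := V_sel_k i sX.
have x2 := valid_ext vX p.+1 i; have x3 := valid_ext vX p.+1 i.+1.
have Ei : nE X p.+1 i = 1 by move: x2; rewrite /nE Hi; clear; lia.
have Ei1 : nE X p.+1 i.+1 = 1 by move: x3; rewrite /nE Li1; clear; lia.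
have Li : nL X p.+1 i = 0 by move: x2; rewrite /nE Hi; clear; lia.
have Hi1 : nH X p.+1 i.+1 = 0 by move: x3; rewrite /nE Li1; clear; lia.
have Lp1 : nL X p i.+1 = 0 by move: Ep1; rewrite /nE; clear; lia.
have Hp1 : nH X p i.+1 = 0 by move: Ep1; rewrite /nE; clear; lia.
have ak : a <= i -> hk /\ k <= i.
  move=> ai; have [/andP[]//|h] := boolP (hk && (k <= i)).
  by have := k4 ai (negbTE h); rewrite Ei.
have ki1 : hk && (i.+1 == k) = false.
  apply/negP => h; have [_ ai] := k2 h.
  by have := k3 h ltac:(move: ai na; clear; lia); rewrite Ei.
have eAA d v : nA X' d v = nA X d v by case: (fX d v).
have ehp v : hlt X' p v = hlt X p v.
  by apply: hlt_eq => u'; have [+ _ _] := fX p u'; rewrite nq !addn0.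
have ehq : hlt X' p.+1 a = hlt X p.+1 a.
  have : hlt X' p.+1 a + true && (i < a) = hlt X p.+1 a + true && (i.+1 < a).
    by apply: hlt_move => u'; have [+ _ _] := fX p.+1 u'; rewrite eqxx.
  have -> : (i.+1 < a) = (i < a) by move: na; clear; lia.
  by move/addIn.
pose k' := if hk && (i == k) then i.+1 else k.
have fl : hk -> nH X' p.+1 k' = nH X p.+1 k.
  rewrite /k' => hk_; move: ki1; rewrite hk_ /=; have [<-|ik] := eqVneq i k => ki1'.
    by have [+ _ _] := fX p.+1 i.+1; rewrite !eqxx ni' !addn0 Hi1 Hi.
  by have [+ _ _] := fX p.+1 k; rewrite eqxx ![k == _]eq_sym ki1' (negPf ik) !addn0.
have sX' : V_sel X' p a hk k'.
  apply: (V_sel_shift sX) => //.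
  - move=> v n1 n2; have := fX p.+1 v; rewrite (negPf n1) (negPf n2) !andbF !addn0 /nE.
    by case=> -> -> _.
  - have := fX p.+1 i; rewrite !eqxx ni nq' /nE => -[+ + _].
    by rewrite Li Hi; clear; lia.
  - by have := fX p.+1 i.+1; rewrite !eqxx ni' nq' /nE => -[+ + _]; clear; lia.
have tgi : (hlt X p.+1 i).+1 = hlt X p i.+1 by have /and3P[/eqP] := sl.
have T0 : hk && (i == k) -> [/\ a <= i, tight X p a & hlt X p i.+1 = hlt X p a.+1].
  move=> h; have [_ ai] := k1 h; have /andP[hk_ /eqP ek] := h.
  have hg : hlt X p.+1 i = hlt X p.+1 a.
    apply: hlt_gap => // v /andP[av vi]; have := Vsel_min sX av; rewrite -ek /nE => /(_ (fun _ => vi)).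
    by clear; lia.
  have := hlt_mono X p (ltac:(by []) : a.+1 <= i.+1).
  have := valid_row vX (c := p) (v := a); rewrite addn_gt0 (Vsel_arm sX) orbT => /(_ isT).
  by rewrite /tight; move: tgi hg ai; clear => ? ? ? ? ?; split=> //; lia.
have T1 : hk && (i == k) = false -> a <= i -> (hk ==> (0 < nH X p.+1 k)) && tight X p a ->
    hlt X p i.+1 <> hlt X p a.+1.
  move=> h ai; have [hk_ ki] := ak ai; have lt : k < i by move: h; rewrite hk_; move: ki; clear; lia.
  rewrite hk_ /tight /= => /andP[Hk /eqP <-].
  have /andP[_ ak'] := Vsel_k sX hk_; have := hlt_mono X p.+1 lt; have := hlt_mono X p.+1 ak'.
  by move: tgi Hk; rewrite (hltS X p.+1 k); clear; lia.
(* The slide adds [i+1] to the moved leg entries exactly when [k = i]; [T0] and [T1] decide whether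
   it shares the row of [a]. *)
have em v : moved X' p a hk k' v = moved X p a hk k v + (hk && (i == k)) && (v == i.+1).
  have fl1 : (hk ==> (0 < nH X' p.+1 k')) = (hk ==> (0 < nH X p.+1 k)).
    by case: (hk) fl => //= /(_ isT) ->.
  have t1 : tight X' p a = tight X p a by rewrite /tight ehp ehq.
  have [_ + _] := fX p v; rewrite nq eqxx addn0 /= => eL.
  rewrite /moved fl1 t1 !ehp; have [ev|n2] := eqVneq v i.+1; last first.
    by rewrite andbF addn0; move: eL; rewrite (negPf n2) addn0 => ->.
  move: eL; rewrite ev eqxx Lp1 if_same !andbT !add0n => ->.
  rewrite (hltS X p i.+1) Hp1 addn0 ltnS.
  case: (boolP (hk && (i == k))) => [h|/negbTE h].
    have [ai T e] := T0 h; rewrite ai T e eqxx andbT.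
    by have /andP[-> /eqP <-] := h; rewrite Hi.
  case: ifP => // /and4P[f t ai /eqP e]; exfalso; apply: (T1 h ai _ e).
  by rewrite f.
have [eP eQ] := V_relE_ext i rX; have [eP1 eQ1] := V_relE_ext i.+1 rX.
have [[_ _ aP] [_ _ aQ]] := V_relE i rX; have [[_ _ aP1] [_ _ aQ1]] := V_relE i.+1 rX.
have [[s1 s2 s3 s4] [s5 s6 _ _ _]] := moved_facts i vX sX.
have sj : moved X p a hk k i.+1 = 0 by apply/eqP; rewrite -leqn0 -Lp1.
have pts : c2 = if hk && (i == k) then p.+1 else p.
  move: (pX) pY; rewrite /near_pick eqxx.
  have [_ _ -> _] := V_stats i sX rX; rewrite /xs /ys Ep1 Ap1.
  move: eP eQ eP1 eQ1 aP aP1; rewrite sj Ei Ei1 na ki1 Ep1 Ap1.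
  case: (boolP (hk && (i == k))) => [h|/negbTE h].
    have [ai T e] := T0 h; have key : (i == a) + moved X p a hk k i >= 1.
      have [//|n] := eqVneq i a.
      have lt : a < i by move: ai n; clear; lia.
      have As0 := Vsel_max sX lt.
      have Hpi : nH X p i = 0 by move: e; rewrite hltS; have := hlt_mono X p lt; clear; lia.
      have Epi : 0 < nE X p i by move: pX; rewrite /near_pick eqxx /xs Ep1 As0 => -[+ _]; clear; lia.
      rewrite /moved T lt e eqxx; have /andP[-> /eqP <-] := h; rewrite Hi /=.
      by move: Epi; rewrite /nE Hpi.
    move: key; move: (moved _ _ _ _ _ _) (i == a) => s b.
    by case/orP: hc2 => /eqP -> //; rewrite eqxx; clear; lia.
  have nia : (i == a) = false.
    apply/negP => /eqP e; have [hk_ ki] := ak ltac:(by rewrite e).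
    by have /andP[_] := Vsel_k sX hk_; rewrite -e => ik; move: h; rewrite hk_ eqn_leq ki ik.
  have s0 : moved X p a hk k i = 0.
    apply: eq0_contra => s; have [hk_ ki] := ak (ltnW (s3 s)).
    by have := s5 s hk_ => ik; move: h; rewrite hk_ eqn_leq ki ik.
  rewrite nia s0; case/orP: hc2 => /eqP -> //; rewrite nq'; clear; lia.
exists c2, a, k'; split=> // Y' Y'' rX' fY d v.
have fl1 : (hk ==> (0 < nH X' p.+1 k')) = (hk ==> (0 < nH X p.+1 k)).
  by case: (hk) fl => //= /(_ isT) ->.
have := rX' d v; rewrite em fl1.
have -> b : [&& hk, 0 < nH X' p.+1 k' & b] = [&& hk, 0 < nH X p.+1 k & b].
  by case: (hk) fl => //= /(_ isT) ->.
have f2 b : [&& hk, nH X' p.+1 k' == 0 & b] = [&& hk, nH X p.+1 k == 0 & b].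
  by case: (hk) fl => //= /(_ isT) ->.
rewrite !f2; have := rX d v; have := fX d v; move: fY; rewrite {}pts /k'.
case: (boolP (hk && (i == k))) => [h|/negbTE h] fY.
  have /andP[hk_ /eqP ek] := h.
  case: fY => [sl'|_ _ /(_ d v)|_ A1].
  - by have := slides_none vY sl'; move: eQ1; rewrite sj Ei1 na ki1; clear; lia.
  - rewrite hk_ -ek Hi /= !mulnDr !mulnb.
    by clear; gen_terms; case=> ? ? ? [? ? ?] [? ? ?] [? ? ?]; split; lia.
  - by move: A1 aQ; rewrite h; clear; lia.
have sl2 : slides Y i p.
  have [lt|gt|e] := ltngtP i a.
  - rewrite (slides_stable rX lt) // => hk_.
    by have /andP[_] := Vsel_k sX hk_; apply: leq_trans.
  - have [hk_ ki] := ak (ltnW gt); move: h rX; rewrite hk_ => h rX.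
    by rewrite (slides_stable_low rX gt) //; move: h ki; clear; lia.
  - have [hk_ ki] := ak ltac:(by rewrite e).
    by have /andP[_] := Vsel_k sX hk_; rewrite -e => ik; move: h; rewrite hk_ eqn_leq ki ik.
case: fY => [_ _ /(_ d v)|/negP//|/negP//].
rewrite /= addn0; clear; gen_terms; case=> ? ? ? [? ? ?] [? ? ?] [? ? ?]; split; lia.
Qed.

Lemma V_f_commute X Y X' p a hk k i N c : valid X -> (forall v, nH X N v = 0) -> valid Y -> valid X' ->
  V_sel X p a hk k -> V_rel X p a hk k Y -> p.+1 < N ->
  f_at i X N c -> f_rel i c X X' ->
  commuting N i Y X' p hk.
Proof.
move=> vX HN vY vX' sX rX ltN pk fX.
have [ec|np] := eqVneq c p.
  rewrite {}ec in pk fX *; case: fX => [sl Li fX|sl A1 fX|sl A0 E0 fX].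
  - exact: (commute_slide_left vX (HN i) vY sX rX ltN pk).
  - have [lt|gt|e] := ltngtP i a.
    + exact: (commute_arm_above vX vY vX' sX rX ltN pk).
    + by move: A1; rewrite (Vsel_max sX gt).
    + rewrite -{}e in sX rX; have [/andP[hk_ /eqP ek]|nk] := boolP (hk && (k == i)).
        move: sX rX; rewrite hk_ ek => sX rX.
        exact: (commute_arm_hit vX vY vX' sX rX ltN pk).
      apply: (commute_arm_miss vX vY vX' sX rX ltN pk fX) => hk_.
      by have /andP[_] := Vsel_k sX hk_; move: nk; rewrite hk_; clear; lia.
  - exact: (commute_ext_left vX vY sX rX ltN pk).
have [ec|nq] := eqVneq c p.+1.
  rewrite {}ec in pk fX *; case: fX => [sl Li fX|sl A1 fX|sl A0 E0 fX].
  - exact: (commute_slide_right vX vY sX rX ltN pk).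
  - by move: A1; rewrite (Vsel_right sX i (ltnSn p)).
  - exact: (commute_ext_right vX vY sX rX ltN pk).
have [pk2 sX' fin] := commute_far vX (HN i) vY sX rX ltN np nq pk fX.
by exists c, a, k.
Qed.

(** * [e_i] inverts [f_i] *)

(** The case (S) of [e_i]. The last condition excludes (M): once the acting cell has hook entry
    [i+1], any [i] of the column lies in the cell directly below it. *)
Definition e_slides X i c :=
  [&& 0 < c, 0 < nL X c.-1 i.+1, 0 < nH X c i.+1, tight X c.-1 i.+1 & nE X c i + nA X c i == 0].

(** An [i+1] of the extended legs is read before all [i] of its column, so it stays unpaired only if
    the column contains no [i]; this separates [E_ext] from [E_arm]. As for [f_i], the arm case
    includes (M). *)
Inductive e_rel i c X X' : Prop :=
| E_slide of e_slides X i c &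
  leg_slide c i.+1 i c.-1 c i.+1 X X'
| E_ext of ~~ e_slides X i c & nE X c i + nA X c i = 0 & 0 < nE X c i.+1 &
  ext_shift c i.+1 i X X'
| E_arm of ~~ e_slides X i c & (0 < nE X c i + nA X c i) || (nE X c i.+1 == 0) & 0 < nA X c i.+1 &
  arm_shift c i.+1 i X X'.

Lemma open_plus_ext x y x' y' c : (forall d, d < c -> x' d = x d /\ y' d = y d) ->
  open_plus x' y' c = open_plus x y c.
Proof.
elim: c => //= c IH h; rewrite IH => [|d dc]; last exact: h (leqW dc).
by have [-> ->] := h c (ltnSn c).
Qed.

Lemma open_minus_ext x y x' y' n c : (forall d, c <= d -> x' d = x d /\ y' d = y d) ->
  open_minus x' y' n c = open_minus x y n c.
Proof.
elim: n c => //= n IH c h; rewrite IH => [|d dc]; last exact: h (ltnW dc).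
by have [-> ->] := h c (leqnn c).
Qed.

Lemma stats_ext X X' i d : (forall v, nH X' d v = nH X d v) -> (forall v, nL X' d v = nL X d v) ->
  (forall v, nA X' d v = nA X d v) -> xs i X' d = xs i X d /\ ys i X' d = ys i X d.
Proof. by move=> h l a; rewrite /xs /ys /nE !h !l !a. Qed.

Lemma f_arm_stats X X' i c : arm_shift c i i.+1 X X' ->
  [/\ forall d, d != c -> xs i X' d = xs i X d /\ ys i X' d = ys i X d,
      forall d v, nE X' d v = nE X d v, (nA X' c i).+1 = nA X c i & nA X' c i.+1 = (nA X c i.+1).+1].
Proof.
move=> fX; split.
- move=> d n; apply: stats_ext => v; have [? ? +] := fX d v; rewrite ?(negPf n) ?addn0 //.
- by move=> d v; rewrite /nE; have [-> -> _] := fX d v.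
- have [_ _] := fX c i; rewrite !eqxx; have -> : (i == i.+1) = false by lia.
  by rewrite /=; lia.
- have [_ _] := fX c i.+1; rewrite !eqxx; have -> : (i.+1 == i) = false by lia.
  by rewrite /=; lia.
Qed.

Lemma f_ext_stats X X' i c : nE X c i.+1 = 0 -> nE X c i = 1 -> ext_shift c i i.+1 X X' ->
  [/\ forall d, d != c -> xs i X' d = xs i X d /\ ys i X' d = ys i X d,
      [/\ nH X' c i.+1 = nH X c i, nL X' c i.+1 = nL X c i, nH X' c i = 0 & nL X' c i = 0] &
      forall v, nA X' c v = nA X c v].
Proof.
move=> e1 e0 fX; split.
- move=> d n; apply: stats_ext => v; have [+ + +] := fX d v; rewrite ?(negPf n) ?andbF ?addn0 //.
- have := fX c i; have := fX c i.+1; rewrite !eqxx; have -> : (i == i.+1) = false by lia.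
  have -> : (i.+1 == i) = false by lia.
  rewrite !andbF !andbT; move: e0 e1; rewrite /nE; clear=> ? ? [? ? _] [? ? _]; split; lia.
- by move=> v; have [_ _ ->] := fX c v.
Qed.

Lemma f_slide_stats X X' i c : nH X c.+1 i = 1 -> nL X c.+1 i.+1 = 1 -> nE X c i.+1 = 0 ->
  nE X c.+1 i <= 1 -> nE X c.+1 i.+1 <= 1 -> leg_slide c.+1 i i.+1 c.+1 c i.+1 X X' ->
  [/\ forall d, d != c -> d != c.+1 -> xs i X' d = xs i X d /\ ys i X' d = ys i X d,
      [/\ nH X' c i.+1 = 0, nL X' c i.+1 = 1 & nE X' c i = nE X c i],
      [/\ nE X' c.+1 i = 0, nH X' c.+1 i.+1 = 1 & nL X' c.+1 i.+1 = 0] &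
      forall d v, nA X' d v = nA X d v].
Proof.
move=> h1 l1 e1 b0 b1 fX; have ni : (i == i.+1) = false by lia.
have ni' : (i.+1 == i) = false by lia.
have nc : (c == c.+1) = false by lia.
have nc' : (c.+1 == c) = false by lia.
split.
- move=> d n n'; apply: stats_ext => v; have [+ + +] := fX d v; by rewrite ?(negPf n) ?(negPf n') ?andbF ?addn0.
- have := fX c i; have := fX c i.+1; rewrite !eqxx ni nc /= !addn0.
  by move: e1; rewrite /nE; clear=> ? [? ? _] [? ? _]; split; lia.
- have := fX c.+1 i; have := fX c.+1 i.+1; rewrite !eqxx ni ni' nc' /= !addn0.
  by move: h1 l1 b0 b1; rewrite /nE; clear=> ? ? ? ? [? ? _] [? ? _]; split; lia.
- by move=> d v; have [_ _ ->] := fX d v.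
Qed.

(** A slide in column [c] turns an unpaired [-] of column [c] into a [+] of column [c.+1]: there the
    new hook entry [i+1] has lost its partner [i]. So [e_i] acts in column [c.+1] and slides back;
    in the other cases the column is the same. *)
Lemma f_e_inverse X X' i N c : valid X -> valid X' -> (forall v, nH X N v = 0) ->
  f_at i X N c -> f_rel i c X X' ->
  exists2 d, e_at i X' N d & forall X'', e_rel i d X' X'' -> eqc X X''.
Proof.
move=> vX vX' HN pk; have /and3P[cN Ux Wy] := pk.
have b0 := valid_ext vX c i; have b1 := valid_ext vX c i.+1.
case=> [sl Li fX|sl A1 fX|sl A0 E0 fX].
- have [Ep1 Ap1 Hi Li1 Aqi] := slide_facts vX (HN i) pk sl.
  have [hd [hH hL hE] [hE' hH' hL'] hA] :=
    f_slide_stats Hi Li1 Ep1 (valid_ext vX c.+1 i) (valid_ext vX c.+1 i.+1) fX.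
  have lt : c.+1 < N.
    by rewrite ltn_neqAle cN andbT; apply/eqP => e; move: (HN i); rewrite -e Hi.
  exists c.+1.
    have eN : N - c.+1 = (N - c.+2).+1 by lia.
    rewrite /e_pick lt open_plusS; move: Ux Wy; rewrite eN open_minusS.
    rewrite (@open_plus_ext (xs i X) (ys i X) _ _ c); last by move=> d dc; apply: hd; lia.
    rewrite (@open_minus_ext (xs i X) (ys i X) _ _ (N - c.+2) c.+2); last by move=> d dc; apply: hd; lia.
    have := valid_ext vX c.+1 i.+1; rewrite /xs /ys !hA hE /nE hH hL hH' hL' -/(nE X' c.+1 i) hE'.
    move: Ep1 Ap1 Aqi Hi Li1; rewrite /nE; clear; lia.
  have sl2 : e_slides X' i c.+1.
    rewrite /e_slides /= hL hH' hE' hA Aqi eqxx andbT /= /tight.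
    have /and3P[/eqP tg _ _] := sl.
    have e1 : hlt X' c i.+2 = hlt X c i.+2.
      apply: hlt_eq => v; have [+ _ _] := fX c v.
      have -> : (c == c.+1) = false by lia.
      by rewrite !addn0.
    have e2 : hlt X' c.+1 i.+1 + true && (i < i.+1) = hlt X c.+1 i.+1 + true && (i.+1 < i.+1).
      by apply: hlt_move => v; have [+ _ _] := fX c.+1 v; rewrite eqxx.
    move: e2; rewrite e1 !(hltS X c i.+1) -tg (hltS X c.+1 i) Hi.
    move: Ep1; rewrite /nE ltnSn ltnn; clear; lia.
  move=> X'' [_ eX|/negP//|/negP//] d v.
  move: (fX d v) (eX d v); clear; rewrite [c.+1.-1]/=; gen_terms => -[? ? ?] [? ? ?]; split; lia.
- have [hd hE hA hA1] := f_arm_stats fX.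
  exists c.
    rewrite /e_pick cN.
    rewrite (@open_plus_ext (xs i X) (ys i X) _ _ c); last by move=> d dc; apply: hd; lia.
    rewrite (@open_minus_ext (xs i X) (ys i X) _ _ (N - c.+1) c.+1); last by move=> d dc; apply: hd; lia.
    by move: Ux Wy; rewrite /xs /ys !hE -hA hA1; clear; lia.
  have x0 : nE X' c i + nA X' c i = 0 -> nE X' c i.+1 = 0.
    by rewrite !hE; move: Ux; rewrite /xs -hA; clear; lia.
  have x1 : nH X' c i.+1 <= nE X' c i.+1 by rewrite /nE leq_addr.
  move=> X'' [/and5P[_ _ h1 _ /eqP/x0 h2]|_ /x0 -> //|_ _ _ eX] d v.
    by move: h1 x1; rewrite h2; clear; lia.
  move: (fX d v) (eX d v); clear; gen_terms => -[? ? ?] [? ? ?]; split; lia.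
- have e1 : nE X c i.+1 = 0 by move: Ux; rewrite /xs A0; move: b0 b1; clear; lia.
  have e0 : nE X c i = 1 by move: E0 b0; clear; lia.
  have [hd [hH hL hH0 hL0] hA] := f_ext_stats e1 e0 fX.
  exists c.
    rewrite /e_pick cN.
    rewrite (@open_plus_ext (xs i X) (ys i X) _ _ c); last by move=> d dc; apply: hd; lia.
    rewrite (@open_minus_ext (xs i X) (ys i X) _ _ (N - c.+1) c.+1); last by move=> d dc; apply: hd; lia.
    by move: Ux Wy e0 e1; rewrite /xs /ys /nE hH hL hH0 hL0 !hA A0; clear; lia.
  have nsl : ~~ e_slides X' i c.
    apply/negP => /and5P[c0 L1 H1 /eqP + _]; rewrite prednK // => tg.
    have nc : (c.-1 == c) = false by move: c0; clear; lia.
    have e2 v : hlt X' c.-1 v = hlt X c.-1 v.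
      by apply: hlt_eq => w; have [+ _ _] := fX c.-1 w; rewrite nc !andbF !addn0.
    have := valid_row vX (c := c.-1) (v := i.+1).
    have [_ + _] := fX c.-1 i.+1; rewrite nc !andbF !addn0 => eL; rewrite prednK // /nE -eL.
    move=> /(_ ltac:(move: L1; clear; lia)); move: tg; rewrite e2 !(hltS _ c i) hH0 => <-.
    have e3 : hlt X' c i + (0 < nH X c i) && (i < i) = hlt X c i + (0 < nH X c i) && (i.+1 < i).
      by apply: hlt_move => w; have [+ _ _] := fX c w; rewrite eqxx.
    move: e3 H1; rewrite ltnn hH; have -> : (i.+1 < i) = false by clear; lia.
    by rewrite !andbF; clear; lia.
  move=> X'' [/(negP nsl)//|_ _ _ eX|_ + _ _] d v.
    move: (fX d v) (eX d v); rewrite hH hL; clear; gen_terms => -[? ? ?] [? ? ?]; split; lia.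
  by rewrite /nE hH0 hL0 hA A0 /= hH hL; move: e0; rewrite /nE; clear; lia.
Qed.

(** Column [c] contains no [i], so it cannot pair any [+] coming from column [c.-1]; being left of
    the chosen [+], that column must have no free [+] at all. *)
Lemma e_slide_facts X i N c : valid X -> e_at i X N c -> e_slides X i c ->
  [/\ nH X c.-1 i.+1 = 0, nL X c.-1 i.+1 = 1, nA X c.-1 i.+1 = 0, 0 < nE X c.-1 i + nA X c.-1 i &
   [/\ nE X c i = 0, nA X c i = 0, nH X c i.+1 = 1 & nL X c i.+1 = 0]].
Proof.
move=> vX /and3P[_ _ +] /and5P[c0 L1 H1 _ E0].
have b0 := valid_ext vX c i.+1; have b1 := valid_ext vX c.-1 i.+1.
case: c c0 L1 H1 E0 b0 b1 => //= c _; rewrite /xs /ys /nE.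
by clear => ? ? ? ? ? ?; split; [..|split]; lia.
Qed.

Lemma e_f_inverse X X' i N c : valid X -> valid X' ->
  e_at i X N c -> e_rel i c X X' ->
  exists2 d, f_at i X' N d & forall X'', f_rel i d X' X'' -> eqc X X''.
Proof.
move=> vX vX' pk; have /and3P[cN Wy Ux] := pk.
have b0 := valid_ext vX c i; have b1 := valid_ext vX c i.+1.
have ni : (i == i.+1) = false by clear; lia.
have ni' : (i.+1 == i) = false by clear; lia.
case=> [sl eX|sl E0 E1 eX|sl c0 A1 eX].
- have [H0 L0 A0 I0 [Ei Ai H1 L1]] := e_slide_facts vX pk sl.
  have /and5P[c0 _ _ /eqP tg _] := sl.
  case: c pk cN Wy Ux b0 b1 sl eX H0 L0 A0 I0 Ei Ai H1 L1 c0 tg => // c pk cN Wy Ux b0 b1 sl eX.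
  rewrite [c.+1.-1]/= in eX * => H0 L0 A0 I0 Ei Ai H1 L1 _ tg.
  have nc : (c == c.+1) = false by clear; lia.
  have nc' : (c.+1 == c) = false by clear; lia.
  have hA d v : nA X' d v = nA X d v by have [] := eX d v.
  have hd d : d != c -> d != c.+1 -> xs i X' d = xs i X d /\ ys i X' d = ys i X d.
    by move=> n n'; apply: stats_ext => v; have [+ + +] := eX d v; rewrite ?(negPf n) ?(negPf n') ?addn0.
  have [hH hL hE] : [/\ nH X' c i.+1 = 0, nL X' c i.+1 = 0 & nE X' c i = nE X c i].
    have := eX c i; have := eX c i.+1; rewrite !eqxx ni nc /= !addn0.
    by move: H0 L0; rewrite /nE; clear=> ? ? [? ? _] [? ? _]; split; lia.
  have [hH' hL' hE'] : [/\ nH X' c.+1 i = 1, nL X' c.+1 i.+1 = 1 & nE X' c.+1 i = 1 /\ nH X' c.+1 i.+1 = 0].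
    have := eX c.+1 i; have := eX c.+1 i.+1; rewrite !eqxx ni ni' nc' /= !addn0.
    by move: H1 L1 Ei; rewrite /nE; clear=> ? ? ? [? ? _] [? ? _]; split; lia.
  exists c.
    have eN : N - c.+1 = (N - c.+2).+1 by move: cN; clear; lia.
    rewrite /f_pick (ltnW cN) /= eN open_minusS; move: Ux Wy; rewrite open_plusS.
    rewrite (@open_plus_ext (xs i X) (ys i X) _ _ c); last by move=> d dc; apply: hd; move: dc; clear; lia.
    rewrite (@open_minus_ext (xs i X) (ys i X) _ _ (N - c.+2) c.+2); last by move=> d dc; apply: hd; move: dc; clear; lia.
    have e1 : nE X' c i.+1 = 0 by rewrite /nE hH hL.
    have e2 : nE X' c.+1 i.+1 = 1 by rewrite /nE hL' hE'.2.
    rewrite /xs /ys !hA hE hE'.1 Ei Ai A0 e1 e2.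
    move: H0 L0 H1 L1 I0; rewrite /nE; clear; lia.
  have sl2 : slides X' i c.
    rewrite /slides hH' hH eqxx andbT /= /tight.
    have e1 : hlt X' c i.+1 = hlt X c i.+1.
      by apply: hlt_eq => v; have [+ _ _] := eX c v; rewrite nc !addn0.
    have e2 : hlt X' c.+1 i + true && (i.+1 < i) = hlt X c.+1 i + true && (i < i).
      by apply: hlt_move => v; have [+ _ _] := eX c.+1 v; rewrite eqxx.
    have -> : hlt X' c.+1 i = hlt X c.+1 i by move: e2; clear; lia.
    move: tg Ei H0; rewrite e1 (hltS X c i.+1) (hltS X c.+1 i) /nE; clear; lia.
  move=> X'' [_ _ fX|/negP//|/negP//] d v.
  move: (fX d v) (eX d v); clear; gen_terms => -[? ? ?] [? ? ?]; split; lia.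
- have e1 : nE X c i.+1 = 1 by move: E1 b1; clear; lia.
  have [hA hc] : (forall d v, nA X' d v = nA X d v) /\
     [/\ nH X' c i = nH X c i.+1, nL X' c i = nL X c i.+1, nH X' c i.+1 = 0 & nL X' c i.+1 = 0].
    split; first by move=> d v; have [] := eX d v.
    have := eX c i; have := eX c i.+1; rewrite !eqxx ni ni'.
    rewrite !andbF !andbT; move: E0 e1; rewrite /nE; clear=> ? ? [? ? _] [? ? _]; split; lia.
  have [hH hL hH0 hL0] := hc.
  have hd d : d != c -> xs i X' d = xs i X d /\ ys i X' d = ys i X d.
    by move=> n; apply: stats_ext => v; have [+ + +] := eX d v; rewrite ?(negPf n) ?andbF ?addn0.
  exists c.
    rewrite /f_pick cN.
    rewrite (@open_plus_ext (xs i X) (ys i X) _ _ c); last by move=> d dc; apply: hd; move: dc; clear; lia.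
    rewrite (@open_minus_ext (xs i X) (ys i X) _ _ (N - c.+1) c.+1); last by move=> d dc; apply: hd; move: dc; clear; lia.
    by move: Ux Wy E0 e1; rewrite /xs /ys /nE hH hL hH0 hL0 !hA; clear; lia.
  have nsl : ~~ slides X' i c.
    apply/negP => /and3P[/eqP tg H1 _].
    have nc : (c.+1 == c) = false by clear; lia.
    have h1 v : nH X' c.+1 v = nH X c.+1 v by have [+ _ _] := eX c.+1 v; rewrite nc !andbF !addn0.
    have e2 v : hlt X' c.+1 v = hlt X c.+1 v by apply: hlt_eq.
    have := valid_row vX (c := c) (v := i.+1); rewrite e1 => /(_ isT).
    have e3 : hlt X' c i.+1 + (0 < nH X c i.+1) && (i.+1 < i.+1) = hlt X c i.+1 + (0 < nH X c i.+1) && (i < i.+1).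
      by apply: hlt_move => w; have [+ _ _] := eX c w; rewrite eqxx.
    move: tg e3 H1 E0 e1; rewrite e2 h1 ltnn ltnSn !(hltS X _ i.+1) (hltS X c.+1 i) /nE !andbF !andbT.
    by clear; lia.
  move=> X'' [/(negP nsl)//|_ + _|_ _ _ fX] d v; first by rewrite hA; move: E0; clear; lia.
  move: (fX d v) (eX d v); rewrite hH hL; clear; gen_terms => -[? ? ?] [? ? ?]; split; lia.
- have [hE hA0 hA1] : [/\ forall d v, nE X' d v = nE X d v, nA X' c i = (nA X c i).+1 & (nA X' c i.+1).+1 = nA X c i.+1].
    split; first by move=> d v; rewrite /nE; have [-> -> _] := eX d v.
      by have [_ _] := eX c i; rewrite !eqxx ni /=; clear; lia.
    by have [_ _] := eX c i.+1; rewrite !eqxx ni' /=; clear; lia.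
  have hd d : d != c -> xs i X' d = xs i X d /\ ys i X' d = ys i X d.
    by move=> n; apply: stats_ext => v; have [+ + +] := eX d v; rewrite ?(negPf n) ?andbF ?addn0.
  exists c.
    rewrite /f_pick cN.
    rewrite (@open_plus_ext (xs i X) (ys i X) _ _ c); last by move=> d dc; apply: hd; move: dc; clear; lia.
    rewrite (@open_minus_ext (xs i X) (ys i X) _ _ (N - c.+1) c.+1); last by move=> d dc; apply: hd; move: dc; clear; lia.
    by move: Ux Wy c0 b0 b1; rewrite /xs /ys !hE hA0 -hA1; clear; lia.
  have nsl : ~~ slides X' i c.
    apply/negP => sl'; have eH d v : nH X' d v = nH X d v by have [] := eX d v.
    have sl2 : slides X i c.
      by move: sl'; rewrite /slides /tight !eH !(hlt_eq (eH _)).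
    by have := slides_none vX sl2; rewrite -hA1; clear; lia.
  move=> X'' [/(negP nsl)//|_ _ fX|_ + _ _] d v; last by rewrite hA0.
  move: (fX d v) (eX d v); clear; gen_terms => -[? ? ?] [? ? ?]; split; lia.
Qed.

(** * Tableaux and their counts *)

(** The conditions between adjacent cells only, with the hook entry as minimum of its cell: the form
    in which a change of one or two cells can be checked. *)
Record hvt (T : tableau) : Prop := Hvt {
  hvt_row0 : forall r, r < size T -> in_tab T r 0;
  hvt_down : forall r c, in_tab T r.+1 c -> in_tab T r c;
  hvt_hook : forall r c, in_tab T r c -> is_hook (cell T r c);
  hvt_row : forall r c, in_tab T r c.+1 -> {in hentries (cell T r c), forall y, y <= hx (cell T r c.+1)};
  hvt_col : forall r c, in_tab T r.+1 c -> {in hentries (cell T r c), forall y, y < hx (cell T r.+1 c)} }.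

Lemma in_tab_left T r c c' : c' <= c -> in_tab T r c -> in_tab T r c'.
Proof. by rewrite /in_tab => h; apply: leq_ltn_trans. Qed.

Lemma hvt_down_le T r r' c : hvt T -> r' <= r -> in_tab T r c -> in_tab T r' c.
Proof.
move=> hT le; rewrite -(subnKC le); elim: (r - r') => [|n IH]; first by rewrite addn0.
by rewrite addnS => /(hvt_down hT).
Qed.

Lemma hx_entries h : hx h \in hentries h.
Proof. by rewrite /hentries mem_cat inE eqxx. Qed.

Lemma is_hook_min h : is_hook h -> {in hentries h, forall y, hx h <= y}.
Proof.
case/and4P=> _ /= so _ /allP al y; rewrite /hentries mem_cat inE => /orP[/orP[/eqP->//|yl]|/al//].
by move: so; rewrite (path_sortedE ltn_trans) => /andP[/allP/(_ _ yl)/ltnW].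
Qed.

Lemma hminE h : is_hook h -> hmin h = hx h.
Proof.
move=> hh; have := is_hook_min hh; rewrite /hmin; move: (hentries h) => s.
elim: s => //= y s IH hs; rewrite IH; last by move=> z zs; apply: hs; rewrite inE zs orbT.
by apply/minn_idPr; apply: hs; rewrite inE eqxx.
Qed.

Lemma hmax_le h m : (hmax h <= m) = all (fun y => y <= m) (hentries h).
Proof.
rewrite /hmax; elim: (hentries h) => [|y s IH]; first by rewrite big_nil.
by rewrite big_cons geq_max IH.
Qed.

Lemma hmax_lt h m : 0 < m -> (hmax h < m) = all (fun y => y < m) (hentries h).
Proof.
move=> m0; rewrite /hmax; elim: (hentries h) => [|y s IH]; first by rewrite big_nil.
by rewrite big_cons gtn_max IH.
Qed.

Lemma is_hook_gt0 h : is_hook h -> 0 < hx h.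
Proof. by case/and4P. Qed.

Lemma hvt_row_lt T r c1 c2 : hvt T -> c1 < c2 -> in_tab T r c2 ->
  {in hentries (cell T r c1), forall y, y <= hx (cell T r c2)}.
Proof.
move=> hT; elim: c2 => // c2 IH; rewrite ltnS leq_eqVlt => /orP[/eqP->|lt] it y hy.
  exact: (hvt_row hT it).
apply: leq_trans (IH lt (in_tab_left (leqnSn _) it) y hy) _.
exact: (hvt_row hT it (hx_entries _)).
Qed.

Lemma hvt_col_lt T r1 r2 c : hvt T -> r1 < r2 -> in_tab T r2 c ->
  {in hentries (cell T r1 c), forall y, y < hx (cell T r2 c)}.
Proof.
move=> hT; elim: r2 => // r2 IH; rewrite ltnS leq_eqVlt => /orP[/eqP->|lt] it y hy.
  exact: (hvt_col hT it).
apply: ltn_trans (IH lt (hvt_down hT it) y hy) _.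
exact: (hvt_col hT it (hx_entries _)).
Qed.

Lemma hvtP T : is_HVT T <-> hvt T.
Proof.
split=> [[/andP[so /allP ne] [hk [hr hc]]]|hT].
  have dn r c : in_tab T r.+1 c -> in_tab T r c.
    rewrite /in_tab; have [lt|ge] := ltnP r.+1 (size T); last by rewrite nth_default.
    move/(sortedP 0): so => /(_ r); rewrite size_map => /(_ lt).
    by rewrite (nth_map [::] _ _ lt) (nth_map [::] _ _ (ltnW lt)) => h it; exact: leq_trans it h.
  split=> // [r lt|r c it y hy|r c it y hy].
  - by rewrite /in_tab; apply/ne/mem_nth.
  - have := hr r c c.+1 (ltnSn c) it; rewrite hminE; last exact: hk.
    by rewrite hmax_le => /allP/(_ y hy).
  - have := hc r r.+1 c (ltnSn r) it; rewrite hminE; last exact: hk.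
    by rewrite hmax_lt ?is_hook_gt0 ?hk // => /allP/(_ y hy).
split; [apply/andP; split|split; [exact: hvt_hook|split]].
- apply/(sortedP 0) => r; rewrite size_map => lt; rewrite (nth_map [::] _ _ lt) (nth_map [::] _ _ (ltnW lt)).
  have := @hvt_down _ hT r; rewrite /in_tab /geq /=.
  case: (size (nth [::] T r.+1)) => // n /(_ n); rewrite ltnSn; exact.
- by apply/(all_nthP [::]) => r lt; exact: (hvt_row0 hT lt).
- move=> r c1 c2 lt it; rewrite hminE; last exact: hvt_hook.
  by rewrite hmax_le; apply/allP; apply: hvt_row_lt.
- move=> r1 r2 c lt it; have hk := hvt_hook hT it; rewrite hminE // hmax_lt ?is_hook_gt0 //.
  by apply/allP; apply: hvt_col_lt.
Qed.

(* [(r, c)] is a cell of [T] or an addable one. *)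
Definition slot T r c := (0 < c -> in_tab T r c.-1) /\ (0 < r -> in_tab T r.-1 c).

Lemma slot_in T r c : hvt T -> in_tab T r c -> slot T r c.
Proof.
move=> hT it; split=> [_|]; first exact: in_tab_left (leq_pred c) it.
by case: r it => // r it _; apply: (hvt_down hT).
Qed.

Lemma in_tab_upd T r c h r' c' : slot T r c ->
  in_tab (upd T r c h) r' c' = in_tab T r' c' || (r' == r) && (c' == c).
Proof.
case=> sl _; rewrite /in_tab /upd /set_cell nth_set_nth /=.
have [->|n] := eqVneq r' r; last by rewrite orbF.
rewrite size_set_nth /= leq_max ltnS orbC; have [//|ge] := ltnP c' _ => /=.
case: c sl => [|c] sl; first by case: c' ge.
have := sl isT; rewrite /in_tab /=; move: ge; lia.
Qed.

Lemma cell_upd T r c h r' c' :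
  cell (upd T r c h) r' c' = if (r' == r) && (c' == c) then h else cell T r' c'.
Proof.
rewrite /cell /upd /set_cell nth_set_nth /=.
by have [->|n] //= := eqVneq r' r; rewrite nth_set_nth.
Qed.

Lemma size_upd T r c h : size (upd T r c h) = maxn r.+1 (size T).
Proof. by rewrite size_set_nth. Qed.

Lemma hvt_upd T r c h : hvt T -> slot T r c -> is_hook h ->
  (0 < c -> {in hentries (cell T r c.-1), forall y, y <= hx h}) ->
  (in_tab T r c.+1 -> {in hentries h, forall y, y <= hx (cell T r c.+1)}) ->
  (0 < r -> {in hentries (cell T r.-1 c), forall y, y < hx h}) ->
  (in_tab T r.+1 c -> {in hentries h, forall y, y < hx (cell T r.+1 c)}) ->
  hvt (upd T r c h).
Proof.
move=> hT sl hh hl hr hd hu; split.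
- move=> r'; rewrite size_upd leq_max in_tab_upd // ltnS leq_eqVlt -orbA => /or3P[/eqP->|lt|/(hvt_row0 hT)->//].
    rewrite eqxx; case: c sl {hl hr hd hu} => [|c] [sl _]; first by rewrite orbT.
    by rewrite (in_tab_left (leq0n c) (sl isT)).
  have [_] := sl; case: r lt {sl hl hr hd hu} => // r lt /(_ isT) it; rewrite ltnS in lt.
  by rewrite (in_tab_left (leq0n c) (hvt_down_le hT lt it)).
- move=> r' c'; rewrite !in_tab_upd // => /orP[/(hvt_down hT)->//|/andP[/eqP e /eqP->]].
  by have [_] := sl; rewrite -e => /(_ isT)->.
- move=> r' c'; rewrite in_tab_upd // cell_upd; case: ifP => //= _; rewrite orbF; exact: hvt_hook.
- move=> r' c'; rewrite in_tab_upd // !cell_upd => /orP[it|/andP[/eqP-> /eqP e]].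
    have [/andP[/eqP er /eqP ec]|n1] := boolP (_ && (c'.+1 == c)).
      rewrite er -ec (_ : (c' == c'.+1) = false) ?andbF; last by lia.
      by have := hl; rewrite -ec; apply.
    have [/andP[/eqP er /eqP ec]|n2] := boolP (_ && (c' == c)).
      by move: it; rewrite er ec; exact: hr.
    exact: (hvt_row hT it).
  by rewrite eqxx e eqxx -e /= (_ : (c' == c'.+1) = false) ?andbF; [rewrite -e in hl; exact: hl|lia].
- move=> r' c'; rewrite in_tab_upd // !cell_upd => /orP[it|/andP[/eqP e /eqP->]].
    have [/andP[/eqP er /eqP ec]|n1] := boolP ((r'.+1 == r) && (c' == c)).
      rewrite -er ec (_ : (r' == r'.+1) = false) /=; last by lia.
      by have := hd; rewrite -er; apply.
    have [/andP[/eqP er /eqP ec]|n2] := boolP (_ && (c' == c)).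
      by move: it; rewrite er ec; exact: hu.
    exact: (hvt_col hT it).
  by rewrite eqxx e eqxx -e /= (_ : (r' == r'.+1) = false) /=; [rewrite -e in hd; exact: hd|lia].
Qed.

Definition nG (g : hook -> nat) T c := \sum_(r < size T) in_tab T r c * g (cell T r c).

Definition cnt (T : tableau) : counts :=
  Counts (fun c v => nG (fun h => hx h == v) T c)
         (fun c v => nG (fun h => count_mem v (hleg h)) T c)
         (fun c v => nG (fun h => count_mem v (harm h)) T c).

Lemma in_tab_size T r c : in_tab T r c -> r < size T.
Proof. by have [|ge] := ltnP r (size T); rewrite // /in_tab nth_default. Qed.

Lemma nG_wide g T c n : size T <= n -> nG g T c = \sum_(r < n) in_tab T r c * g (cell T r c).
Proof.
move=> le; rewrite /nG (big_ord_widen_cond _ xpredT (fun r => in_tab T r c * g (cell T r c)) le).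
rewrite [RHS](bigID (fun r : 'I_n => r < size T)) /= [X in _ = _ + X]big1 ?addn0 // => r ge.
by case: (boolP (in_tab T r c)) => [/in_tab_size lt|] //; rewrite lt in ge.
Qed.

Lemma nG_upd g T r c h d : slot T r c ->
  nG g (upd T r c h) d + (d == c) && in_tab T r c * g (cell T r c) = nG g T d + (d == c) * g h.
Proof.
move=> sl; set n := maxn r.+1 (size T).
have rn : r < n by rewrite /n; lia.
rewrite (@nG_wide g T d n) ?leq_maxr // (@nG_wide g _ d n) ?size_upd //.
rewrite (bigD1 (Ordinal rn)) //= [in RHS](bigD1 (Ordinal rn)) //=.
rewrite in_tab_upd // cell_upd eqxx /=.
under eq_bigr => r' nr.
  have nr' : (nat_of_ord r' == r) = false by apply: negbTE; move: nr; apply: contra => /eqP e; apply/eqP/val_inj.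
  rewrite in_tab_upd // cell_upd nr' /= orbF; over.
move: (\sum_(i < n | _) _) => S.
have [->|nd] := eqVneq d c; last by rewrite /= !orbF !mul0n !addn0.
by rewrite orbT /= !mul1n; case: (in_tab T r c); rewrite ?mul1n ?mul0n; lia.
Qed.

Lemma sum_lt n k : \sum_(r < n) (r < k : nat) = minn n k.
Proof.
elim: n => [|n IH]; first by rewrite big_ord0 min0n.
by rewrite big_ord_recr /= IH; lia.
Qed.

Lemma hlt_cnt T c v : hlt (cnt T) c v = nG (fun h => hx h < v) T c.
Proof.
rewrite /hlt /= /nG exchange_big /=; apply: eq_bigr => r _.
rewrite -big_distrr /=; congr (_ * _); elim: v => [|v IH]; first by rewrite big_ord0.
by rewrite big_ord_recr /= IH; lia.
Qed.

(** Up to row [r] all hook entries are [<= y], and those of the higher rows exceed every entry of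
    row [r]. This is how counts remember rows. *)
Lemma hlt_row T r c y : hvt T -> in_tab T r c -> y \in hentries (cell T r c) ->
  hlt (cnt T) c y.+1 = r.+1.
Proof.
move=> hT it hy; rewrite hlt_cnt /nG.
transitivity (\sum_(r' < size T) (r' < r.+1 : nat)); last first.
  by rewrite sum_lt; apply/minn_idPr; exact: in_tab_size it.
apply: eq_bigr => r' _; rewrite !ltnS; case: (leqP r' r) => [le|lt].
  rewrite (hvt_down_le hT le it) mul1n; move: le; rewrite leq_eqVlt => /orP[/eqP->|lt].
    by rewrite (is_hook_min (hvt_hook hT it)).
  by rewrite ltnW // (leq_trans (hvt_col_lt hT lt it (hx_entries _))) // (is_hook_min (hvt_hook hT it)).
case: (boolP (in_tab T r' c)) => //= it'.
by rewrite leqNgt (hvt_col_lt hT lt it').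
Qed.

Lemma hlt_in_tab T r c v : hvt T -> r < hlt (cnt T) c v -> in_tab T r c.
Proof.
move=> hT; rewrite hlt_cnt; apply: contraTT => nit; rewrite -leqNgt.
have -> : r = \sum_(r' < maxn r (size T)) (r' < r : nat) by rewrite sum_lt; lia.
rewrite (nG_wide _ _ (leq_maxr r _)); apply: leq_sum => r' _.
case: (boolP (in_tab T r' c)) => // it'; rewrite mul1n.
case: (ltnP r' r) => [_|ge]; first exact: leq_b1.
by rewrite (hvt_down_le hT ge it') in nit.
Qed.

(** All occurrences of [v] in a column lie in one row, so a count over the column is a count in a
    single cell. *)
Lemma nG_at g T r c v : hvt T -> hlt (cnt T) c v.+1 = r.+1 ->
  (forall h, 0 < g h -> v \in hentries h) -> nG g T c = g (cell T r c).
Proof.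
move=> hT hr hg; have it : in_tab T r c by apply: (hlt_in_tab hT (v := v.+1)); rewrite hr.
rewrite /nG (bigD1 (Ordinal (in_tab_size it))) //= it mul1n big1 ?addn0 // => r' nr.
case: (boolP (in_tab T r' c)) => // it'; rewrite mul1n; apply/eqP; rewrite -leqn0 leqNgt.
apply/negP => /hg/(hlt_row hT it'); rewrite hr => -[] e.
by case/eqP: nr; apply: val_inj.
Qed.

Lemma nG_gt0 g T c : 0 < nG g T c -> exists2 r, in_tab T r c & 0 < g (cell T r c).
Proof.
rewrite /nG lt0n sum_nat_eq0 negb_forall => /existsP[r]; rewrite /= muln_eq0 negb_or.
by rewrite -!lt0n lt0b => /andP[? ?]; exists r.
Qed.

Lemma count_gt0 (v : nat) s : (0 < count_mem v s) = (v \in s).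
Proof. by rewrite -has_count has_pred1. Qed.

Lemma hx_ent h v : 0 < (hx h == v) -> v \in hentries h.
Proof. by rewrite lt0b => /eqP <-; exact: hx_entries. Qed.
Lemma leg_ent h v : 0 < count_mem v (hleg h) -> v \in hentries h.
Proof. by rewrite count_gt0 /hentries mem_cat inE => ->; rewrite orbT. Qed.
Lemma arm_ent h v : 0 < count_mem v (harm h) -> v \in hentries h.
Proof. by rewrite count_gt0 /hentries mem_cat => ->; rewrite orbT. Qed.

Lemma nH_at T r c v : hvt T -> hlt (cnt T) c v.+1 = r.+1 -> nH (cnt T) c v = (hx (cell T r c) == v).
Proof. by move=> hT hr; exact: (nG_at hT hr (fun h => @hx_ent h v)). Qed.

Lemma nL_at T r c v : hvt T -> hlt (cnt T) c v.+1 = r.+1 ->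
  nL (cnt T) c v = count_mem v (hleg (cell T r c)).
Proof. by move=> hT hr; exact: (nG_at hT hr (fun h => @leg_ent h v)). Qed.

Lemma nA_at T r c v : hvt T -> hlt (cnt T) c v.+1 = r.+1 ->
  nA (cnt T) c v = count_mem v (harm (cell T r c)).
Proof. by move=> hT hr; exact: (nG_at hT hr (fun h => @arm_ent h v)). Qed.

Lemma nE_at T r c v : hvt T -> hlt (cnt T) c v.+1 = r.+1 ->
  nE (cnt T) c v = count_mem v (hextleg (cell T r c)).
Proof. by move=> hT hr; rewrite /nE (nH_at hT hr) (nL_at hT hr). Qed.

Lemma cnt_gt0 T c v : hvt T -> 0 < nE (cnt T) c v + nA (cnt T) c v ->
  exists r, [/\ in_tab T r c, hlt (cnt T) c v.+1 = r.+1 & v \in hentries (cell T r c)].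
Proof.
move=> hT h; suff [r it hv] : exists2 r, in_tab T r c & v \in hentries (cell T r c).
  by exists r; split=> //; exact: hlt_row hv.
move: h; rewrite /nE !addn_gt0 => /orP[/orP[]|] /nG_gt0[r it]; exists r => //.
- exact: hx_ent.
- exact: leg_ent.
- exact: arm_ent.
Qed.

Lemma cnt_entry T r c v : hvt T -> in_tab T r c -> v \in hentries (cell T r c) ->
  0 < nE (cnt T) c v + nA (cnt T) c v.
Proof.
move=> hT it hv; have hr := hlt_row hT it hv; rewrite (nE_at hT hr) (nA_at hT hr) -count_cat.
by rewrite count_gt0.
Qed.

Lemma valid_cnt T : hvt T -> valid (cnt T).
Proof.
move=> hT; split.
- move=> c v; rewrite leqNgt; apply/negP => h.
  have [|r [it hr _]] := @cnt_gt0 T c v hT; first by rewrite ltn_addr // ltnW.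
  move: h; rewrite (nE_at hT hr) count_uniq_mem; first by case: (_ \in _).
  by have /and4P[_ so _ _] := hvt_hook hT it; exact: (sorted_uniq ltn_trans ltnn so).
- move=> c v /(cnt_gt0 hT)[r [it hr hv]]; rewrite hr ltnS leqNgt; apply/negP => lt.
  have it' := hlt_in_tab hT lt.
  have e := hlt_row hT it' (hx_entries _); have := e; rewrite hltS (nH_at hT e) eqxx addn1 => -[e1].
  by have := hlt_mono (cnt T) c.+1 (hvt_row hT it' hv); rewrite e1 leqNgt lt.
(* A crude value above all hook entries of column [c], at which [hlt] has reached the height of the
   column. *)
- move=> c v; exists (\sum_(r < size T) (hx (cell T r c)).+1); rewrite !hlt_cnt.
  apply: leq_sum => r _; case: (boolP (in_tab T r c.+1)) => // it.
  rewrite (in_tab_left (leqnSn c) it) !mul1n; apply: leq_trans (leq_b1 _) _.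
  by rewrite lt0b (bigD1 r) //= leq_addr.
Qed.

Lemma hvt_size T1 T2 : hvt T1 -> hvt T2 -> (forall r c, in_tab T1 r c = in_tab T2 r c) -> size T1 = size T2.
Proof.
move=> h1 h2 e; apply/eqP; rewrite eqn_leq; apply/andP; split; rewrite leqNgt; apply/negP.
  by move=> /(hvt_row0 h1); rewrite e => /in_tab_size; rewrite ltnn.
by move=> /(hvt_row0 h2); rewrite -e => /in_tab_size; rewrite ltnn.
Qed.

Lemma hvt_ext T1 T2 : hvt T1 -> hvt T2 -> (forall r c, in_tab T1 r c = in_tab T2 r c) ->
  (forall r c, in_tab T1 r c -> cell T1 r c = cell T2 r c) -> T1 = T2.
Proof.
move=> h1 h2 e ec; apply: (@eq_from_nth _ [::]); first exact: hvt_size.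
move=> r _; have es : size (nth [::] T1 r) = size (nth [::] T2 r).
  apply/eqP; rewrite eqn_leq; apply/andP; split; rewrite leqNgt; apply/negP => lt.
    by have := e r (size (nth [::] T2 r)); rewrite /in_tab lt ltnn.
  by have := e r (size (nth [::] T1 r)); rewrite /in_tab lt ltnn.
by apply: (@eq_from_nth _ dflt_hook) => // c lt; apply: ec.
Qed.

Lemma count_eq_sorted (leT : rel nat) s1 s2 : transitive leT -> antisymmetric leT ->
  sorted leT s1 -> sorted leT s2 -> (forall v, count_mem v s1 = count_mem v s2) -> s1 = s2.
Proof.
move=> tr asym so1 so2 e; apply: (sorted_eq tr asym so1 so2).
by apply/allP => v _; apply/eqP; rewrite e.
Qed.

(** Equal hook counts give equal heights and put each value in the same row; within a cell, the
    sorted leg and arm are determined by multiplicities. *)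
Lemma cnt_inj T1 T2 : hvt T1 -> hvt T2 -> eqc (cnt T1) (cnt T2) -> T1 = T2.
Proof.
move=> h1 h2 e.
have eh c v : hlt (cnt T1) c v = hlt (cnt T2) c v by apply: hlt_eq => w; have [] := e c w.
have it r c : in_tab T1 r c = in_tab T2 r c.
  apply/idP/idP => it.
    by apply: (hlt_in_tab h2 (v := (hx (cell T1 r c)).+1)); rewrite -eh (hlt_row h1 it (hx_entries _)).
  by apply: (hlt_in_tab h1 (v := (hx (cell T2 r c)).+1)); rewrite eh (hlt_row h2 it (hx_entries _)).
have at_cell (g : hook -> nat) r c v : in_tab T1 r c ->
    (forall h, 0 < g h -> v \in hentries h) -> nG g T1 c = nG g T2 c -> g (cell T1 r c) = g (cell T2 r c).
  move=> i1 hg en; have i2 := i1; rewrite it in i2.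
  have [hr|nr] := eqVneq (hlt (cnt T1) c v.+1) r.+1.
    by rewrite -(nG_at h1 hr hg) en; apply: (nG_at h2 _ hg); rewrite -eh.
  have z T (hT : hvt T) : in_tab T r c -> hlt (cnt T) c v.+1 != r.+1 -> g (cell T r c) = 0.
    move=> ii ne; apply: eq0_contra => /hg/(hlt_row hT ii) /eqP.
    by rewrite (negPf ne).
  by rewrite (z _ h1) // (z _ h2) // -eh.
apply: hvt_ext => // r c i1; have i2 := i1; rewrite it in i2.
have /and4P[_ s1 a1 _] := hvt_hook h1 i1; have /and4P[_ s2 a2 _] := hvt_hook h2 i2.
have ex : hx (cell T1 r c) = hx (cell T2 r c).
  have [en _ _] := e c (hx (cell T2 r c)).
  have := at_cell _ r c _ i1 (fun h => @hx_ent h (hx (cell T2 r c))) en.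
  by rewrite eqxx; case: eqP.
have el : hleg (cell T1 r c) = hleg (cell T2 r c).
  apply: (count_eq_sorted leq_trans anti_leq).
  - by move/path_sorted: s1; apply: sub_sorted => ? ?; apply: ltnW.
  - by move/path_sorted: s2; apply: sub_sorted => ? ?; apply: ltnW.
  - by move=> v; have [_ en _] := e c v; exact: (at_cell _ r c v i1 (fun h => @leg_ent h v) en).
have ea : harm (cell T1 r c) = harm (cell T2 r c).
  apply: (count_eq_sorted leq_trans anti_leq) => // v.
  by have [_ _ en] := e c v; exact: (at_cell _ r c v i1 (fun h => @arm_ent h v) en).
by move: ex el ea; rewrite /hx /hleg /harm; case: (cell T1 r c) => -[? ?] ?; case: (cell T2 r c) => -[? ?] ? /= -> -> ->.
Qed.

(** * The signature rule, column by column *)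

Definition row_of T c v := (hlt (cnt T) c v.+1).-1.
Definition ext_seq T c := flatten [seq rev (hextleg (cell T r c)) | r <- rev (col_cells T c)].
Definition arm_seq T c := flatten [seq harm (cell T r c) | r <- col_cells T c].

Lemma mem_col_cells T c r : (r \in col_cells T c) = in_tab T r c.
Proof.
rewrite mem_filter mem_iota add0n /=; apply/andP/idP => [[]//|it].
by rewrite it (in_tab_size it).
Qed.

Lemma pairwise_flatten (R : rel nat) (I : Type) (f : I -> seq nat) s :
  all (fun r => pairwise R (f r)) s -> pairwise (fun r r' => allrel R (f r) (f r')) s ->
  pairwise R (flatten [seq f r | r <- s]).
Proof.
elim: s => //= r s IH /andP[h1 h2] /andP[h3 h4]; rewrite pairwise_cat h1 IH // andbT andbT.
elim: s {IH h2 h4} h3 => [|r' s IH] /=; first by rewrite allrel0r.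
by case/andP=> h /IH h'; rewrite allrel_catr h.
Qed.

Lemma col_word_rows T c : pairwise ltn (col_cells T c).
Proof. by apply: pairwise_filter; rewrite -(sorted_pairwise ltn_trans) iota_ltn_sorted. Qed.

Lemma entries_ext h : {subset hextleg h <= hentries h}.
Proof. by move=> v; rewrite /hentries mem_cat => ->. Qed.

Lemma entries_arm h : {subset harm h <= hentries h}.
Proof. by move=> v; rewrite /hentries mem_cat orbC => ->. Qed.

Lemma hvt_col_entries T r r' c : hvt T -> r < r' -> in_tab T r' c ->
  {in hentries (cell T r c) & hentries (cell T r' c), forall y z, y < z}.
Proof.
move=> hT lt it y z hy hz; apply: leq_trans (hvt_col_lt hT lt it hy) _.
exact: (is_hook_min (hvt_hook hT it)).
Qed.

Lemma ext_seq_sorted T c : hvt T -> pairwise (fun x y => y < x) (ext_seq T c).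
Proof.
move=> hT; apply: pairwise_flatten.
  apply/allP => r; rewrite mem_rev mem_col_cells => it; have /and4P[_ so _ _] := hvt_hook hT it.
  by rewrite -(sorted_pairwise (rev_trans ltn_trans)) -/(hextleg _) rev_sorted.
have tr : transitive (fun x y : nat => y < x) by move=> x y z h1 h2; apply: ltn_trans h2 h1.
apply: (sub_in_pairwise (P := [in col_cells T c]) (r := (fun x y => y < x))).
- move=> r r' /=; rewrite !mem_col_cells => i1 i2 lt; apply/allrelP => x y.
  by rewrite !mem_rev => /entries_ext hx /entries_ext hy; exact: (hvt_col_entries hT lt i1).
- by apply/allP => r; rewrite mem_rev.
- rewrite -(sorted_pairwise tr) rev_sorted.
  by have := col_word_rows T c; rewrite -(sorted_pairwise ltn_trans).
Qed.

Lemma arm_seq_sorted T c : hvt T -> pairwise leq (arm_seq T c).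
Proof.
move=> hT; apply: pairwise_flatten.
  apply/allP => r; rewrite mem_col_cells => it; have /and4P[_ _ so _] := hvt_hook hT it.
  by rewrite -(sorted_pairwise leq_trans).
apply: (sub_in_pairwise (P := [in col_cells T c]) (r := ltn)).
- move=> r r' /=; rewrite !mem_col_cells => i1 i2 lt; apply/allrelP => x y.
  by move=> /entries_arm hx /entries_arm hy; apply/ltnW/(hvt_col_entries hT lt i2).
- by apply/allP.
- exact: col_word_rows.
Qed.

Lemma count_col g T c : \sum_(r <- col_cells T c) g (cell T r c) = nG g T c.
Proof.
rewrite /nG /col_cells big_filter big_mkcond -[size T in LHS]subn0 -/(index_iota 0 (size T)) big_mkord.
by apply: eq_bigr => r _; case: (in_tab T r c); rewrite ?mul1n.
Qed.

Lemma count_ext_seq T c v : count_mem v (ext_seq T c) = nE (cnt T) c v.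
Proof.
rewrite count_flatten sumnE big_map big_map -[rev _ in LHS]/(rev _).
under eq_bigr => r _ do rewrite count_rev.
rewrite (perm_big _ (permEl (perm_rev _))) /=.
rewrite (count_col (fun h => count_mem v (hextleg h))) /nE /= /nG -big_split /=.
by apply: eq_bigr => r _; rewrite mulnDr.
Qed.

Lemma count_arm_seq T c v : count_mem v (arm_seq T c) = nA (cnt T) c v.
Proof. by rewrite count_flatten sumnE big_map big_map (count_col (fun h => count_mem v (harm h))). Qed.

Lemma row_ofE T r c v : hvt T -> in_tab T r c -> v \in hentries (cell T r c) -> row_of T c v = r.
Proof. by move=> hT it hv; rewrite /row_of (hlt_row hT it hv). Qed.

(** Read from the bottom cell to the top one, the arms of a column are already weakly increasing, so
    [sort] changes nothing; and the row of a letter depends only on its value. *)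
Lemma col_wordE T c : hvt T -> col_word T c =
  [seq (v, row_of T c v, c, true) | v <- ext_seq T c] ++
  [seq (v, row_of T c v, c, false) | v <- arm_seq T c].
Proof.
move=> hT; rewrite /col_word; congr (_ ++ _).
  rewrite /ext_seq map_flatten -map_comp; congr flatten; apply/eq_in_map => r.
  rewrite mem_rev mem_col_cells => it /=; apply/eq_in_map => v; rewrite mem_rev => hv.
  by rewrite (row_ofE hT it (entries_ext hv)).
have -> : flatten [seq [seq (v, r, c, false) | v <- harm (cell T r c)] | r <- col_cells T c] =
    [seq (v, row_of T c v, c, false) | v <- arm_seq T c].
  rewrite /arm_seq map_flatten -map_comp; congr flatten; apply/eq_in_map => r.
  rewrite mem_col_cells => it /=; apply/eq_in_map => v hv.
  by rewrite (row_ofE hT it (entries_arm hv)).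
by apply: pairwise_sort; rewrite pairwise_map; apply: arm_seq_sorted.
Qed.

Definition col_signs T i c : seq (bool * letter) :=
  nseq (nE (cnt T) c i.+1) (true, (i.+1, row_of T c i.+1, c, true)) ++
  nseq (nE (cnt T) c i) (false, (i, row_of T c i, c, true)) ++
  nseq (nA (cnt T) c i) (false, (i, row_of T c i, c, false)) ++
  nseq (nA (cnt T) c i.+1) (true, (i.+1, row_of T c i.+1, c, false)).

Lemma filter_two (R : rel nat) (s : seq nat) a b : transitive R -> antisymmetric R -> R a b -> R a a -> R b b ->
  a != b -> pairwise R s ->
  [seq v <- s | (v == a) || (v == b)] = nseq (count_mem a s) a ++ nseq (count_mem b s) b.
Proof.
move=> tr asym ab aa bb ne so; apply: (sorted_eq tr asym).
- by rewrite (sorted_pairwise tr) pairwise_filter.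
- rewrite (sorted_pairwise tr) pairwise_cat; apply/and3P; split.
  + by apply/allrelP => x y; rewrite !mem_nseq => /andP[_ /eqP->] /andP[_ /eqP->].
  + by elim: (count_mem a s) => //= n ->; rewrite andbT all_nseq aa orbT.
  + by elim: (count_mem b s) => //= n ->; rewrite andbT all_nseq bb orbT.
apply/allP => v _; rewrite /= count_cat !count_nseq /= count_filter /=.
have [->|na] := eqVneq v a.
  rewrite [b == a]eq_sym (negPf ne) ?eqxx ?mul0n ?addn0 ?mul1n; apply/eqP/eq_count => w /=.
  by case: eqP.
have [->|nb] := eqVneq v b.
  rewrite ?(negPf ne) ?eqxx ?mul0n ?mul1n ?add0n; apply/eqP/eq_count => w /=.
  by case: (w == b); rewrite ?orbT.
rewrite ?[_ == v]eq_sym ?(negPf na) ?(negPf nb) ?mul0n; apply/eqP.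
apply/eqP; rewrite -leqn0 leqNgt -has_count; apply/hasPn => w _ /=.
by case: eqP => // ->; rewrite (negPf na) (negPf nb).
Qed.

Lemma sword_col T i c : hvt T -> sword i (col_word T c) = col_signs T i c.
Proof.
move=> hT; rewrite /sword col_wordE // filter_cat !filter_map map_cat -!map_comp.
have ne : i != i.+1 by lia.
rewrite (eq_filter (a2 := fun v => (v == i.+1) || (v == i))); last by move=> v /=; rewrite orbC.
rewrite (@filter_two (fun x y => y <= x)) //; first last.
- by apply: sub_pairwise (ext_seq_sorted c hT) => x y; apply: ltnW.
- by rewrite eq_sym.
- by move=> x y; rewrite andbC; apply: anti_leq.
- by move=> x y z h1 h2; apply: leq_trans h2 h1.
rewrite (eq_filter (a2 := fun v => (v == i) || (v == i.+1))) //.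
rewrite (@filter_two leq) //; first last.
- exact: arm_seq_sorted.
- exact: anti_leq.
- exact: leq_trans.
rewrite !map_cat !map_nseq !count_ext_seq !count_arm_seq /= !eqxx (negPf ne).
by rewrite /col_signs -!catA.
Qed.

Lemma sword_reading T i : hvt T -> sword i (reading T) = flatten [seq col_signs T i c | c <- iota 0 (ncols T)].
Proof.
move=> hT; rewrite /reading; elim: (iota 0 (ncols T)) => //= c s IH.
by rewrite /sword filter_cat map_cat -/(sword i _) sword_col // -IH.
Qed.

(** * Cancellation of paired signs *)

(** One pass from the left, with [u] open [+], replaces the iterated cancellation; [free_plus] does
    the same from the right, with [w] open [-]. Both are invariant under [cancel1] and trivial on a
    fully reduced word. *)
Fixpoint free_minus (u : nat) (s : seq (bool * letter)) : seq letter :=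
  match s with
  | [::] => [::]
  | (true, _) :: s' => free_minus u.+1 s'
  | (false, l) :: s' => if u is u'.+1 then free_minus u' s' else l :: free_minus 0 s'
  end.

Fixpoint free_plus (w : nat) (s : seq (bool * letter)) : nat * seq letter :=
  match s with
  | [::] => (w, [::])
  | (false, _) :: s' => let: (w', p) := free_plus w s' in (w'.+1, p)
  | (true, l) :: s' => let: (w', p) := free_plus w s' in
      if w' is w''.+1 then (w'', p) else (0, l :: p)
  end.

Lemma cancel1_plus2 l l' s :
  cancel1 ((true, l) :: (true, l') :: s) = (true, l) :: cancel1 ((true, l') :: s).
Proof. by []. Qed.

Lemma free_minus_cancel1 u s : free_minus u (cancel1 s) = free_minus u s.
Proof.
elim: s u => [|[[] l] s IH] u //; last by case: u => [|u]; rewrite /= IH.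
case: s IH => [|[[] l'] s] IH //.
by rewrite cancel1_plus2 -[LHS]/(free_minus u.+1 (cancel1 ((true, l') :: s))) IH.
Qed.

Lemma free_plus_cancel1 w s : free_plus w (cancel1 s) = free_plus w s.
Proof.
elim: s => [|[[] l] s IH] //; last by rewrite /= IH.
case: s IH => [|[[] l'] s] IH //; last by rewrite /=; case: (free_plus w s).
by rewrite cancel1_plus2 [LHS]/= -/(cancel1 ((true, l') :: s)) IH.
Qed.

Lemma cancel1_size_le s : size (cancel1 s) <= size s.
Proof.
elim: s => [|[[] l] s IH]; [by []| |exact: IH].
case: s IH => [|[[] l'] s] IH; [by []|exact: IH|by rewrite /=; lia].
Qed.

Lemma cancel1_size s : size (cancel1 s) = size s -> cancel1 s = s.
Proof.
elim: s => [|[[] l] s IH] //; last by move=> [] /IH e; rewrite /= e.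
case: s IH => [|[[] l'] s] IH //; last by rewrite /=; lia.
by rewrite cancel1_plus2 => -[] /IH ->.
Qed.

(** Every step that changes the word shortens it, so [size s] steps reach a fixed point of
    [cancel1]. *)
Lemma reduce_fixed s : cancel1 (reduce_signs s) = reduce_signs s.
Proof.
rewrite /reduce_signs.
have h n : cancel1 (iter n cancel1 s) = iter n cancel1 s \/ size (iter n cancel1 s) + n <= size s.
  elim: n => [|n [e|le]]; first by right; rewrite addn0.
    by left; rewrite /= !e.
  have [e|lt] := eqVneq (size (cancel1 (iter n cancel1 s))) (size (iter n cancel1 s)).
    by left; rewrite /= !(cancel1_size e).
  by right; have := cancel1_size_le (iter n cancel1 s); rewrite /=; move: lt le; lia.
case: (h (size s)) => // le; have : size (iter (size s) cancel1 s) = 0 by lia.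
by move/size0nil ->.
Qed.

Lemma cancel1_fixed_plus l s : cancel1 ((true, l) :: s) = (true, l) :: s -> all (fun p => p.1) s.
Proof.
elim: s l => [|[[] l'] s IH] l //; first by rewrite cancel1_plus2 => -[] /IH.
by move=> /(congr1 size) /=; lia.
Qed.

Lemma free_minus_plus u s : all (fun p => p.1) s -> free_minus u s = [::].
Proof. by elim: s u => [|[[] l] s IH] u //= /IH. Qed.

Lemma free_plus_plus s : all (fun p => p.1) s -> free_plus 0 s = (0, [seq p.2 | p <- s & p.1]).
Proof. by elim: s => [|[[] l] s IH] //= /IH ->. Qed.

Lemma reduce_minus s : [seq p.2 | p <- reduce_signs s & ~~ p.1] = free_minus 0 s.
Proof.
have <- : free_minus 0 (reduce_signs s) = free_minus 0 s.
  by rewrite /reduce_signs; elim: (size s) => //= n IH; rewrite free_minus_cancel1.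
have := reduce_fixed s; move: (reduce_signs s) => t.
elim: t => [|[[] l] t IH] //; last by move=> [] /IH /= ->.
move=> /cancel1_fixed_plus al; rewrite /= free_minus_plus //.
by rewrite (eq_in_filter (a2 := pred0)) ?filter_pred0 // => p /(allP al) ->.
Qed.

Lemma reduce_plus s : [seq p.2 | p <- reduce_signs s & p.1] = (free_plus 0 s).2.
Proof.
have <- : free_plus 0 (reduce_signs s) = free_plus 0 s.
  by rewrite /reduce_signs; elim: (size s) => //= n IH; rewrite free_plus_cancel1.
have := reduce_fixed s; move: (reduce_signs s) => t.
elim: t => [|[[] l] t IH] //.
  by move=> /cancel1_fixed_plus al; rewrite /= free_plus_plus.
by move=> [] /IH /= ->; case: (free_plus 0 t).
Qed.

Fixpoint left_plus (u : nat) (s : seq (bool * letter)) : nat :=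
  match s with
  | [::] => u
  | (true, _) :: s' => left_plus u.+1 s'
  | (false, _) :: s' => left_plus u.-1 s'
  end.

Lemma free_minus_cat u s t : free_minus u (s ++ t) = free_minus u s ++ free_minus (left_plus u s) t.
Proof. by elim: s u => [|[[] l] s IH] u //=; case: u => [|u] /=; rewrite IH. Qed.

Lemma free_plus_cat w s t : free_plus w (s ++ t) =
  ((free_plus (free_plus w t).1 s).1, (free_plus (free_plus w t).1 s).2 ++ (free_plus w t).2).
Proof.
elim: s => [|[[] l] s IH] //=; first by case: (free_plus w t).
  rewrite IH; case: (free_plus (free_plus w t).1 s) => -[|n] p //.
by rewrite IH; case: (free_plus (free_plus w t).1 s).
Qed.

Lemma left_plus_cat u s t : left_plus u (s ++ t) = left_plus (left_plus u s) t.
Proof. by elim: s u => [|[[] l] s IH] u /=. Qed.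

Lemma left_plus_nseq u n b l : left_plus u (nseq n (b, l)) = if b then u + n else u - n.
Proof.
case: b; first by elim: n u => [|n IH] u /=; rewrite ?addn0 // IH addSnnS.
by elim: n u => [|n IH] u /=; rewrite ?subn0 // IH; lia.
Qed.

Lemma free_minus_nseq u n b l : free_minus u (nseq n (b, l)) = if b then [::] else nseq (n - u) l.
Proof.
case: b; first by elim: n u => [|n IH] u /=.
by elim: n u => [|n IH] [|u] //=; rewrite IH ?subn0.
Qed.

Lemma free_plus_nseq w n b l : free_plus w (nseq n (b, l)) =
  if b then (w - n, nseq (n - w) l) else (w + n, [::]).
Proof.
case: b; last by elim: n => [|n IH] /=; rewrite ?addn0 // IH addnS.
elim: n => [|n IH] /=; first by rewrite subn0.
rewrite IH; case e: (w - n) => [|k].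
  have -> : n.+1 - w = (n - w).+1 by lia.
  by have -> : w - n.+1 = 0 by lia.
have -> : n - w = 0 by lia.
have -> : n.+1 - w = 0 by lia.
by congr (_, _); lia.
Qed.

Definition minus_letters T i c : seq letter :=
  nseq (nE (cnt T) c i) (i, row_of T c i, c, true) ++ nseq (nA (cnt T) c i) (i, row_of T c i, c, false).

Lemma left_plus_col T i c u : left_plus u (col_signs T i c) = ys i (cnt T) c + (u - xs i (cnt T) c).
Proof. by rewrite /col_signs !left_plus_cat !left_plus_nseq /xs /ys; lia. Qed.

Lemma free_minus_col T i c u :
  free_minus u (col_signs T i c) = drop (u + nE (cnt T) c i.+1) (minus_letters T i c).
Proof.
rewrite /col_signs !free_minus_cat !left_plus_nseq !free_minus_nseq cats0 /minus_letters.
rewrite drop_cat size_nseq; case: ltnP => lt; rewrite !drop_nseq.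
  have -> : u + nE (cnt T) c i.+1 - nE (cnt T) c i = 0 by lia.
  by rewrite subn0.
by have -> : nE (cnt T) c i - (u + nE (cnt T) c i.+1) = 0 by lia.
Qed.

Lemma size_minus_letters T i c : size (minus_letters T i c) = nE (cnt T) c i + nA (cnt T) c i.
Proof. by rewrite size_cat !size_nseq. Qed.

Definition signs T i c n := flatten [seq col_signs T i d | d <- iota c n].

Lemma signs_cat T i c n m : signs T i c (n + m) = signs T i c n ++ signs T i (c + n) m.
Proof. by rewrite /signs iotaD map_cat flatten_cat. Qed.

Lemma signsS T i c n : signs T i c n.+1 = col_signs T i c ++ signs T i c.+1 n.
Proof. by []. Qed.

Lemma left_plus_signs T i n : left_plus 0 (signs T i 0 n) = open_plus (xs i (cnt T)) (ys i (cnt T)) n.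
Proof.
elim: n => // n IH; rewrite -addn1 signs_cat left_plus_cat IH addn1 open_plusS.
by rewrite /signs /= cats0 left_plus_col.
Qed.

Lemma size_free_minus T i n c u :
  size (free_minus u (signs T i c n)) = open_minus (xs i (cnt T)) (ys i (cnt T)) n c - u.
Proof.
elim: n c u => // n IH c u; rewrite signsS free_minus_cat size_cat IH left_plus_col free_minus_col.
rewrite size_drop size_minus_letters open_minusS.
have -> : nE (cnt T) c i + nA (cnt T) c i - (u + nE (cnt T) c i.+1) = xs i (cnt T) c - u.
  by rewrite /xs; clear; lia.
by clear; lia.
Qed.

(** The hypothesis says that an unpaired [-] occurs at or after column [c]; the last column for
    which this remains true is the one picked. *)
Lemma pick_exists x y n c : open_plus x y c < open_minus x y n c ->
  exists d, f_pick x y (c + n) d.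
Proof.
elim: n c => // n IH c; rewrite open_minusS => lt.
have [lt'|ge] := ltnP (open_plus x y c.+1) (open_minus x y n c.+1).
  by rewrite addnS -addSn; exact: IH.
exists c; rewrite /f_pick; have -> : c + n.+1 - c.+1 = n by lia.
by move: ge; rewrite open_plusS; move: lt; lia.
Qed.

Lemma e_pick_exists x y c n : open_minus x y n c < open_plus x y c ->
  exists d, e_pick x y (c + n) d.
Proof.
elim: c n => // c IH n; rewrite open_plusS => lt.
have [lt'|ge] := ltnP (open_minus x y n.+1 c) (open_plus x y c).
  by rewrite addSn -addnS; exact: IH.
exists c; rewrite /e_pick; have -> : c.+1 + n - c.+1 = n by lia.
by move: ge; rewrite open_minusS; move: lt; lia.
Qed.

(** Arms are read last, so the rightmost [-] of a column is an arm letter as soon as the column has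
    an arm entry [i]. For [e_letter], the first [+] of a column comes from an extended leg, but any
    [i] of the column cancels it. *)
Definition f_letter T i c : letter := (i, row_of T c i, c, nA (cnt T) c i == 0).
Definition e_letter T i c : letter :=
  (i.+1, row_of T c i.+1, c, (nE (cnt T) c i + nA (cnt T) c i == 0) && (0 < nE (cnt T) c i.+1)).

Lemma f_op_signs i T : hvt T -> f_op i T =
  if rev (free_minus 0 (signs T i 0 (ncols T))) is l :: _ then Some (f_move i T l) else None.
Proof. by move=> hT; rewrite /f_op /unpaired reduce_minus sword_reading. Qed.

Lemma f_op_pick i T c : hvt T -> f_at i (cnt T) (ncols T) c ->
  f_op i T = Some (f_move i T (f_letter T i c)).
Proof.
move=> hT /and3P[lt Ux Wy]; rewrite f_op_signs //.
have -> : ncols T = c + (ncols T - c.+1).+1 by lia.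
rewrite signs_cat add0n signsS free_minus_cat left_plus_signs free_minus_cat left_plus_col free_minus_col.
have -> : free_minus (ys i (cnt T) c + (open_plus (xs i (cnt T)) (ys i (cnt T)) c - xs i (cnt T) c))
   (signs T i c.+1 (ncols T - c.+1)) = [::].
  by apply/size0nil; rewrite size_free_minus; lia.
rewrite cats0 rev_cat.
move: Ux; rewrite /xs /minus_letters; set u := open_plus _ _ _ => lt'.
rewrite drop_cat size_nseq /f_letter.
have [m0|m0] := posnP (nA (cnt T) c i).
  rewrite m0 cats0 drop_nseq; case: ltnP => h; last by move: lt' h; rewrite m0; lia.
  by case e: (_ - _) => [|n]; [lia|rewrite rev_nseq].
case: ltnP => h; rewrite !drop_nseq ?rev_cat !rev_nseq.
  by move: m0; case: (nA _ _ _).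
by case e: (_ - _) => [|n] //; lia.
Qed.

Lemma f_op_some i T T' : hvt T -> f_op i T = Some T' ->
  exists c, f_at i (cnt T) (ncols T) c.
Proof.
move=> hT; rewrite f_op_signs //; case e: (rev _) => [|l s] // _.
have := size_free_minus T i (ncols T) 0 0; rewrite -size_rev e subn0 /= => h.
by apply: (@pick_exists _ _ (ncols T) 0); rewrite -h.
Qed.

Lemma free_plus_col T i c w : free_plus w (col_signs T i c) =
  (xs i (cnt T) c + (w - ys i (cnt T) c),
   nseq (nE (cnt T) c i.+1 - (w - nA (cnt T) c i.+1 + nA (cnt T) c i + nE (cnt T) c i))
     (i.+1, row_of T c i.+1, c, true) ++
   nseq (nA (cnt T) c i.+1 - w) (i.+1, row_of T c i.+1, c, false)).
Proof.
rewrite /col_signs !free_plus_cat !free_plus_nseq /=; congr (_, _).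
by rewrite /xs /ys /=; clear; lia.
Qed.

Lemma free_plus_minus T i c n : (free_plus 0 (signs T i c n)).1 = open_minus (xs i (cnt T)) (ys i (cnt T)) n c.
Proof.
elim: n c => // n IH c; rewrite signsS free_plus_cat free_plus_col [LHS]/fst IH.
by [].
Qed.

Lemma size_free_plus T i n w :
  size (free_plus w (signs T i 0 n)).2 = open_plus (xs i (cnt T)) (ys i (cnt T)) n - w.
Proof.
elim: n w => // n IH w; rewrite -addn1 signs_cat free_plus_cat addn1 open_plusS add0n.
have -> : signs T i n 1 = col_signs T i n by rewrite /signs /= cats0.
rewrite free_plus_col [(_, _).1]/fst ![(_, _).2]/snd size_cat IH size_cat !size_nseq.
set u := open_plus _ _ _; rewrite /xs /ys; clear; lia.
Qed.

Lemma e_op_signs i T : hvt T -> e_op i T =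
  if (free_plus 0 (signs T i 0 (ncols T))).2 is l :: _ then Some (e_move i T l) else None.
Proof. by move=> hT; rewrite /e_op /unpaired reduce_plus sword_reading. Qed.

Lemma e_op_pick i T c : hvt T -> e_at i (cnt T) (ncols T) c ->
  e_op i T = Some (e_move i T (e_letter T i c)).
Proof.
move=> hT /and3P[lt Wy Ux]; rewrite e_op_signs //.
have -> : ncols T = c + (ncols T - c.+1).+1 by lia.
rewrite signs_cat add0n signsS free_plus_cat [free_plus 0 (_ ++ _)]free_plus_cat free_plus_minus.
set W := open_minus _ _ _ _ in Wy *; rewrite free_plus_col ![(_, _).1]/fst ![(_, _).2]/snd.
set L := (free_plus _ (signs T i 0 c)).2.
have -> : L = [::] by apply/size0nil; rewrite /L size_free_plus; move: Wy Ux; clear; lia.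
rewrite cat0s /e_letter; move: Wy; rewrite /ys => Wy; have b := valid_ext (valid_cnt hT) c i.+1.
have [/andP[/eqP h1 h2]|h] := boolP ((nE (cnt T) c i + nA (cnt T) c i == 0) && _).
  case e: (nE (cnt T) c i.+1 - _) => [|n] //; first by move: e Wy h1 h2; clear; lia.
have -> : nE (cnt T) c i.+1 - (W - nA (cnt T) c i.+1 + nA (cnt T) c i + nE (cnt T) c i) = 0.
  by move: Wy h b; clear; lia.
case e: (nA (cnt T) c i.+1 - W) => [|n] //; exfalso; move: e Wy h b; clear; lia.
Qed.

Lemma e_op_some i T T' : hvt T -> e_op i T = Some T' ->
  exists c, e_at i (cnt T) (ncols T) c.
Proof.
move=> hT; rewrite e_op_signs //; case e: (_.2) => [|l s] // _.
have := size_free_plus T i (ncols T) 0; rewrite e subn0 /= => h.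
by rewrite -[ncols T]addn0; apply: e_pick_exists; rewrite -h.
Qed.

(** * Crystal operators on counts *)

Lemma cnt_out T c v : hvt T -> ncols T <= c ->
  [/\ nH (cnt T) c v = 0, nL (cnt T) c v = 0 & nA (cnt T) c v = 0].
Proof.
move=> hT le; have z g : nG g T c = 0.
  apply: eq0_contra => /nG_gt0[r it _].
  by move: (hvt_down_le hT (leq0n r) it); rewrite /in_tab -/(ncols T) ltnNge le.
by split; apply: z.
Qed.

(** * Changes of one or two cells and their counts *)

Definition mult (v : nat) (s : seq nat) : nat := count_mem v s.

Lemma cnt_upd T r c h : hvt T -> in_tab T r c -> forall d v, [/\
  nH (cnt (upd T r c h)) d v + (d == c) * (hx (cell T r c) == v) = nH (cnt T) d v + (d == c) * (hx h == v),
  nL (cnt (upd T r c h)) d v + (d == c) * mult v (hleg (cell T r c)) =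
    nL (cnt T) d v + (d == c) * mult v (hleg h) &
  nA (cnt (upd T r c h)) d v + (d == c) * mult v (harm (cell T r c)) =
    nA (cnt T) d v + (d == c) * mult v (harm h)].
Proof.
move=> hT it d v; have sl := slot_in hT it.
by split; have := nG_upd _ h d sl => /(_ _); rewrite it andbT; apply.
Qed.

Lemma hvt_upd_same T r c h : hvt T -> in_tab T r c -> is_hook h -> hx h = hx (cell T r c) ->
  {in hentries h, forall y, y \in hentries (cell T r c) \/
    (in_tab T r c.+1 -> y <= hx (cell T r c.+1)) /\ (in_tab T r.+1 c -> y < hx (cell T r.+1 c))} ->
  hvt (upd T r c h).
Proof.
move=> hT it hh eh sub; apply: hvt_upd => //.
- exact: slot_in.
- by rewrite eh; case: c it {eh sub} => // c it _; apply: hvt_row.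
- by move=> ir y /sub[/(hvt_row hT ir)//|[+ _]]; apply.
- by rewrite eh; case: r it {eh sub} => // r it _; apply: hvt_col.
- by move=> iu y /sub[/(hvt_col hT iu)//|[_ +]]; apply.
Qed.

Lemma mult_sort v s : mult v (sort leq s) = mult v s.
Proof. by rewrite /mult; apply/permP; rewrite perm_sort. Qed.

Lemma mult_rem v w (s : seq nat) : w \in s -> mult v (rem w s) + (v == w) = mult v s.
Proof.
move=> ws; rewrite /mult count_mem_rem eq_sym; case: eqP => [->|_]; last by rewrite subn0 addn0.
by rewrite subnK // count_gt0.
Qed.

Lemma mult_cons v w s : mult v (w :: s) = (v == w) + mult v s.
Proof. by rewrite /mult /= eq_sym. Qed.

Lemma mult_arm_add v w h : mult v (harm (arm_add w h)) = (v == w) + mult v (harm h).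
Proof. by rewrite -mult_cons -[RHS]mult_sort. Qed.

Lemma mult_arm_rem v w h : w \in harm h -> mult v (harm (arm_rem w h)) + (v == w) = mult v (harm h).
Proof. exact: mult_rem. Qed.

Lemma is_hook_arm_rem h v : is_hook h -> is_hook (arm_rem v h).
Proof.
case/and4P=> h1 h2 h3 /allP h4; apply/and4P; split=> //=.
  exact: (subseq_sorted leq_trans (rem_subseq _ _) h3).
by apply/allP => y /mem_rem; exact: h4.
Qed.

Lemma is_hook_arm_add h v : is_hook h -> hx h <= v -> is_hook (arm_add v h).
Proof.
case/and4P=> h1 h2 h3 h4 hv; apply/and4P; split=> //=; first exact: (sort_sorted leq_total).
by rewrite all_sort /= hv.
Qed.

Lemma entries_arm_add h v y : (y \in hentries (arm_add v h)) = (y == v) || (y \in hentries h).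
Proof.
by rewrite /hentries !mem_cat -[harm (arm_add v h)]/(sort leq (v :: harm h)) mem_sort inE orbCA.
Qed.

Lemma entries_arm_rem h v : {subset hentries (arm_rem v h) <= hentries h}.
Proof.
move=> y; rewrite /hentries !mem_cat -[harm (arm_rem v h)]/(rem v (harm h)) => /orP[|/mem_rem] ->//.
by rewrite orbT.
Qed.

Lemma hvt_arm_rem T r c v : hvt T -> in_tab T r c -> hvt (upd T r c (arm_rem v (cell T r c))).
Proof.
move=> hT it; apply: hvt_upd_same => //; first exact: is_hook_arm_rem (hvt_hook hT it).
by move=> y /entries_arm_rem; left.
Qed.

Lemma hvt_arm_add T r c v : hvt T -> in_tab T r c -> hx (cell T r c) <= v ->
  v \in hentries (cell T r c) \/
    (in_tab T r c.+1 -> v <= hx (cell T r c.+1)) /\ (in_tab T r.+1 c -> v < hx (cell T r.+1 c)) ->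
  hvt (upd T r c (arm_add v (cell T r c))).
Proof.
move=> hT it hv ok; apply: hvt_upd_same => //; first exact: is_hook_arm_add (hvt_hook hT it) hv.
by move=> y; rewrite entries_arm_add => /orP[/eqP->|]; [|left].
Qed.

Lemma cell_upd_eq T r c h : cell (upd T r c h) r c = h.
Proof. by rewrite cell_upd !eqxx. Qed.

Lemma cell_upd_ne T r c h r' c' : (r' != r) || (c' != c) -> cell (upd T r c h) r' c' = cell T r' c'.
Proof. by rewrite cell_upd -negb_and => /negPf ->. Qed.

Lemma in_tab_upd_in T r c h r' c' : hvt T -> in_tab T r c -> in_tab (upd T r c h) r' c' = in_tab T r' c'.
Proof.
move=> hT it; rewrite (in_tab_upd _ _ _ (slot_in hT it)).
by case: andP => [[/eqP-> /eqP->]|_]; rewrite ?it ?orbF.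
Qed.

(** The move (M), for [f_i] and [e_i] alike: [w] already occurs in the receiving cell, so another
    copy in its arm violates no condition with the neighbours. *)
Lemma arm_move T r s c (v w : nat) : hvt T -> in_tab T r c -> in_tab T s c -> r != s -> v \in harm (cell T r c) ->
  hx (cell T s c) <= w -> w \in hentries (cell T s c) ->
  let T' := upd (upd T r c (arm_rem v (cell T r c))) s c (arm_add w (cell T s c)) in
  hvt T' /\ arm_shift c v w (cnt T) (cnt T').
Proof.
move=> hT ir is_ ne hv hw hws T'; pose T1 := upd T r c (arm_rem v (cell T r c)).
have h1 : hvt T1 by apply: hvt_arm_rem.
have i1 : in_tab T1 s c by rewrite in_tab_upd_in.
have e1 : cell T s c = cell T1 s c by rewrite cell_upd_ne // eq_sym ne.
have e2 : T' = upd T1 s c (arm_add w (cell T1 s c)) by rewrite /T' e1.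
split; first by rewrite e2; apply: hvt_arm_add => //; rewrite -e1 //; left.
move=> d u; have [a1 a2 a3] := cnt_upd (arm_rem v (cell T r c)) hT ir d u.
have [b1 b2 b3] := cnt_upd (arm_add w (cell T1 s c)) h1 i1 d u.
rewrite -/T1 -e2 in a1 a2 a3 b1 b2 b3; split; [by move: a1 b1 => /addIn -> /addIn -> |by move: a2 b2 => /addIn -> /addIn -> |].
move: a3 b3; rewrite mult_arm_add -(mult_arm_rem u hv) !mulnDr -!mulnb.
by clear; gen_terms; lia.
Qed.

Lemma arm_replace T r c (v w : nat) : hvt T -> in_tab T r c -> v \in harm (cell T r c) ->
  hx (cell T r c) <= w ->
  (in_tab T r c.+1 -> w <= hx (cell T r c.+1)) -> (in_tab T r.+1 c -> w < hx (cell T r.+1 c)) ->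
  let T' := upd T r c (arm_repl v w (cell T r c)) in
  hvt T' /\ arm_shift c v w (cnt T) (cnt T').
Proof.
move=> hT ir hv hw hr hu T'; split.
  apply: hvt_upd_same => //.
    exact: (@is_hook_arm_add (arm_rem v (cell T r c)) w (is_hook_arm_rem v (hvt_hook hT ir)) hw).
  move=> y; rewrite -[arm_repl v w _]/(arm_add w (arm_rem v (cell T r c))) entries_arm_add.
  by case/orP => [/eqP->|/entries_arm_rem]; [right|left].
move=> d u; have [a1 a2 a3] := cnt_upd (arm_repl v w (cell T r c)) hT ir d u.
split; [by move: a1 => /addIn -> |by move: a2 => /addIn -> |].
move: a3; rewrite -/T' -[arm_repl v w _]/(arm_add w (arm_rem v (cell T r c))) mult_arm_add.
by rewrite -(mult_arm_rem u hv) !mulnDr -!mulnb; clear; gen_terms; lia.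
Qed.

Definition subst_val (v w y : nat) := if y == v then w else y.

Lemma mult_subst v w u s : mult u (map (subst_val v w) s) + (u == v) * mult v s = mult u s + (u == w) * mult v s.
Proof.
elim: s => [|y s IH]; first by rewrite /mult /= !muln0.
rewrite map_cons !mult_cons /subst_val -/(subst_val v w); have [->|n] := eqVneq y v.
  by rewrite ?eqxx; move: IH; case: (u == v); case: (u == w); lia.
by rewrite ?[v == y]eq_sym ?(negPf n); move: IH; case: (u == v); case: (u == w); lia.
Qed.

Lemma ext_replE v w h : ext_repl v w h = (subst_val v w (hx h), map (subst_val v w) (hleg h), harm h).
Proof. by []. Qed.

(** Shared by [f_i], [e_i] and the bumping of type (a). The new value must compare with the rest of
    the extended leg as the old one did; the left and lower neighbours matter only if the hook entry
    is replaced. *)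
Lemma ext_replace T r c (v w : nat) : hvt T -> in_tab T r c -> v \in hextleg (cell T r c) ->
  w \notin hextleg (cell T r c) -> 0 < w ->
  {in hextleg (cell T r c), forall y, y != v -> (y < v) = (y < w)} ->
  (hx (cell T r c) = v -> {in harm (cell T r c), forall y, w <= y}) ->
  (hx (cell T r c) = v -> 0 < c -> {in hentries (cell T r c.-1), forall y, y <= w}) ->
  (hx (cell T r c) = v -> 0 < r -> {in hentries (cell T r.-1 c), forall y, y < w}) ->
  (in_tab T r c.+1 -> w <= hx (cell T r c.+1)) -> (in_tab T r.+1 c -> w < hx (cell T r.+1 c)) ->
  let T' := upd T r c (ext_repl v w (cell T r c)) in
  hvt T' /\ forall d u, [/\
     nH (cnt T') d u + [&& 0 < nat_of_bool (hx (cell T r c) == v), d == c & u == v] =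
     nH (cnt T) d u + [&& 0 < nat_of_bool (hx (cell T r c) == v), d == c & u == w],
     nL (cnt T') d u + [&& 0 < mult v (hleg (cell T r c)), d == c & u == v] =
     nL (cnt T) d u + [&& 0 < mult v (hleg (cell T r c)), d == c & u == w] &
     nA (cnt T') d u = nA (cnt T) d u].
Proof.
move=> hT it hv hw w0 bt harm_w hl hd hr hu T'.
have hk := hvt_hook hT it; have /and4P[x0 so sa /allP al] := hk.
set B := cell T r c in hv hw bt harm_w hl hd hk x0 so sa al T' *.
have ents y : y \in hentries (ext_repl v w B) -> y \in hentries B \/ y = w.
  rewrite /hentries !mem_cat -[hextleg (ext_repl v w B)]/(map (subst_val v w) (hextleg B)).
  case/orP => [/mapP[z hz ->]|h]; last by left; rewrite h orbT.
  by rewrite /subst_val; case: eqP => _; [right|left; rewrite hz].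
have hxE : hx (ext_repl v w B) = subst_val v w (hx B) by [].
split.
  apply: hvt_upd => //.
  - exact: slot_in.
  - apply/and4P; split.
    + by rewrite hxE /subst_val; case: eqP.
    + rewrite -[hextleg (ext_repl v w B)]/(map (subst_val v w) (hextleg B)).
      apply: (homo_sorted_in (P := [in hextleg B]) _ _ so); last by apply/allP.
      move=> x y hx' hy; rewrite /ltn /= => lt; rewrite /subst_val; case: eqP => [ex|/eqP nx]; case: eqP => [ey|/eqP ny] //.
      * by move: lt; rewrite ex ey ltnn.
      * have := bt y hy ny; have : y != w by apply: contraNneq hw => <-.
        by move: lt; rewrite ex; clear; lia.
      * by rewrite -(bt x hx' nx) -ey.
    + exact: sa.
    + rewrite hxE /subst_val; case: eqP => [e|_]; last exact/allP.
      by apply/allP; exact: harm_w.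
  - move=> c0 y hy; rewrite hxE /subst_val; case: eqP => [e|_]; first exact: hl.
    by move: c0 y hy; rewrite /B; case: c it {hw hv bt harm_w hl hd hr hu T' hk x0 so sa al B ents hxE} => // c it _; exact: hvt_row.
  - by move=> ir y /ents[/(hvt_row hT ir)|->] //; exact: hr.
  - move=> r0 y hy; rewrite hxE /subst_val; case: eqP => [e|_]; first exact: hd.
    by move: r0 y hy; rewrite /B; case: r it {hw hv bt harm_w hl hd hr hu T' hk x0 so sa al B ents hxE} => // r it _; exact: hvt_col.
  - by move=> iu y /ents[/(hvt_col hT iu)|->] //; exact: hu.
move=> d u; have [a1 a2 a3] := cnt_upd (ext_repl v w B) hT it d u.
rewrite -/B -/T' in a1 a2 a3; split.
- move: a1; rewrite hxE /subst_val lt0b; have [->|_] := eqVneq (hx B) v.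
    by rewrite !andTb -!mulnb ![u == _]eq_sym.
  by rewrite !andFb !addn0 => /addIn.
- move: a2; rewrite -[hleg (ext_repl v w B)]/(map (subst_val v w) (hleg B)).
  have := mult_subst v w u (hleg B).
  have m1 : mult v (hleg B) <= 1.
    have := sorted_uniq ltn_trans ltnn so; rewrite /= => /andP[_ un].
    by rewrite /mult count_uniq_mem //; case: (_ \in _).
  case: (mult v (hleg B)) m1 => [|[|//]] _; rewrite ?muln0 ?muln1 ?addn0.
    by move=> -> /addIn.
  rewrite !andTb -!mulnb => e; case: (d == c); last by rewrite !mul0n !addn0 => ->.
  by rewrite !mul1n; move: e; clear; gen_terms; lia.
- by move: a3 => /addIn.
Qed.

Lemma mem_hentries h y : (y \in hentries h) = [|| y == hx h, y \in hleg h | y \in harm h].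
Proof. by rewrite /hentries mem_cat inE orbA. Qed.

Lemma leg_uniq h : is_hook h -> uniq (hleg h).
Proof. by case/and4P=> _ so _ _; exact: (sorted_uniq ltn_trans ltnn (path_sorted so)). Qed.

Lemma leg_gt h y : is_hook h -> y \in hleg h -> hx h < y.
Proof. by case/and4P=> _ so _ _ hy; move: so; rewrite /= (path_sortedE ltn_trans) => /andP[/allP/(_ _ hy)]. Qed.

Lemma sorted_ltn_sort s : uniq s -> sorted ltn (sort leq s).
Proof. by move=> u; rewrite ltn_sorted_uniq_leq sort_uniq u (sort_sorted leq_total). Qed.

Lemma is_hook_leg_add h v : is_hook h -> hx h < v -> v \notin hleg h -> is_hook (leg_add v h).
Proof.
move=> hk lt nv; have /and4P[x0 so sa al] := hk; apply/and4P; split=> //.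
rewrite -[hextleg _]/(hx h :: sort leq (v :: hleg h)) /= (path_sortedE ltn_trans) all_sort /= lt.
rewrite sorted_ltn_sort /= ?nv ?leg_uniq // andbT.
by apply/allP => y; exact: leg_gt.
Qed.

Lemma is_hook_leg_rem h v : is_hook h -> is_hook (leg_rem v h).
Proof.
move=> hk; have /and4P[x0 so sa al] := hk; apply/and4P; split=> //.
rewrite -[hextleg _]/(hx h :: rem v (hleg h)).
apply: (subseq_sorted ltn_trans _ so); rewrite -[hextleg h]/(hx h :: hleg h) /= eqxx.
exact: rem_subseq.
Qed.

Lemma slide_left T r c v : hvt T -> in_tab T r c.+1 -> hx (cell T r c.+1) = v ->
  v.+1 \in hleg (cell T r c.+1) -> v \notin harm (cell T r c.+1) ->
  v.+1 \notin hleg (cell T r c) -> hx (cell T r c) <= v ->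
  (in_tab T r.+1 c -> v.+1 < hx (cell T r.+1 c)) ->
  let T' := upd (upd T r c.+1 (ext_rem v (cell T r c.+1))) r c (leg_add v.+1 (cell T r c)) in
  hvt T' /\ leg_slide c.+1 v v.+1 c.+1 c v.+1 (cnt T) (cnt T').
Proof.
move=> hT ir ex ev na nl le hu T'; have il := in_tab_left (leqnSn c) ir.
have hkR := hvt_hook hT ir; have hkB := hvt_hook hT il.
set R := cell T r c.+1 in ex ev na hkR T' *; set B := cell T r c in nl le hkB T' *.
(* Nothing fits between the hook entry [v] and [v.+1], so [v.+1] is the first leg entry and becomes
   the hook entry once [v] is removed. *)
have [l' el] : exists l', hleg R = v.+1 :: l'.
  have /and4P[_ so _ _] := hkR; move: so ev; rewrite /= ex.
  case: (hleg R) => //= y l /andP[vy so]; rewrite inE => /orP[/eqP<-|yl]; first by exists l.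
  by move: so; rewrite (path_sortedE ltn_trans) => /andP[/allP/(_ _ yl)]; move: vy; clear; lia.
have eR : ext_rem v R = (v.+1, l', harm R).
  by rewrite /ext_rem -[hextleg R]/(hx R :: hleg R) /= ex eqxx el.
have exR : hx (ext_rem v R) = v.+1 by rewrite eR.
pose T1 := upd T r c.+1 (ext_rem v R).
have hk1 : is_hook (ext_rem v R).
  have /and4P[x0 so sa /allP al] := hkR; rewrite eR; apply/and4P; split=> //.
    by move: so; rewrite /= el => /andP[_].
  apply/allP => y hy; have := al y hy; rewrite /= ex leq_eqVlt => /orP[/eqP e|//].
  by move: hy na; rewrite -e => ->.
have sub1 y : y \in hentries (ext_rem v R) -> y \in hentries R.
  by rewrite eR !mem_hentries /= el inE => /or3P[->|->|->]; rewrite ?orbT.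
have h1 : hvt T1.
  apply: hvt_upd => //.
  - exact: slot_in.
  - by move=> _ y /(hvt_row hT ir); rewrite exR -/R ex; apply: leqW.
  - by move=> irr y /sub1/(hvt_row hT irr).
  - move=> r0 y; rewrite exR -ex /R; case: (r) ir r0 => // r' ir _ /(hvt_col hT ir).
    exact: leqW.
  - by move=> iu y /sub1/(hvt_col hT iu).
have i1 : in_tab T1 r c by rewrite in_tab_upd_in.
have e1 : cell T1 r c = B by rewrite cell_upd_ne //; clear; lia.
have eR1 : hx (cell T1 r c.+1) = v.+1 by rewrite cell_upd_eq eR.
have h2 : hvt T'.
  rewrite /T' -/T1; apply: hvt_upd_same => //; rewrite ?e1 //.
    by apply: is_hook_leg_add.
  move=> y; rewrite !mem_hentries -[hleg (leg_add _ _)]/(sort leq (v.+1 :: hleg B)) mem_sort inE eR1.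
  case/or3P => [/eqP->|/orP[/eqP->|h]|h]; [by left; rewrite eqxx| right |by left; rewrite h orbT|by left; rewrite [_ \in harm B]h !orbT].
  split=> // iu; rewrite cell_upd_ne; last by clear; lia.
  by apply: hu; move: iu; rewrite in_tab_upd_in.
split=> // d u; have [a1 a2 a3] := cnt_upd (ext_rem v R) hT ir d u.
have [b1 b2 b3] := cnt_upd (leg_add v.+1 B) h1 i1 d u.
rewrite -/R -/T1 e1 -/T' in a1 a2 a3 b1 b2 b3; rewrite -/T1 in T' h2 b1 b2 b3 *; split.
- move: a1 => + ; rewrite eR ex -!mulnb ![u == _]eq_sym => <-; congr (_ + _).
  by move: b1 => /addIn.
- move: a2 b2; rewrite eR -[hleg (leg_add _ _)]/(sort leq (v.+1 :: hleg B)) mult_sort mult_cons.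
  rewrite el mult_cons -[hleg (_, _, _)]/l' !mulnDr -!mulnb.
  by clear; gen_terms; lia.
- by move: a3 b3; rewrite eR => /addIn <- /addIn.
Qed.

(** The inverse of [slide_left]: the added [v] becomes the hook entry, and the former hook entry
    [v.+1] joins the leg. *)
Lemma slide_right T r c v : hvt T -> 0 < v -> in_tab T r c.+1 -> hx (cell T r c.+1) = v.+1 ->
  v.+1 \in hleg (cell T r c) -> v.+1 \notin harm (cell T r c) ->
  (0 < r -> {in hentries (cell T r.-1 c.+1), forall y, y < v}) ->
  let T' := upd (upd T r c (leg_rem v.+1 (cell T r c))) r c.+1 (ext_add v (cell T r c.+1)) in
  hvt T' /\ leg_slide c.+1 v.+1 v c c.+1 v.+1 (cnt T) (cnt T').
Proof.
move=> hT v0 ir ex lv na hd T'; have il := in_tab_left (leqnSn c) ir.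
have hkR := hvt_hook hT ir; have hkB := hvt_hook hT il.
set R := cell T r c.+1 in ex hkR T' *; set B := cell T r c in lv na hkB T' *.
have eR : ext_add v R = (v, hextleg R, harm R).
  rewrite /ext_add; have -> : sort leq (v :: hextleg R) = v :: hextleg R; last by [].
  apply: sorted_sort; first exact: leq_trans.
  have /and4P[_ so _ _] := hkR; rewrite /= ex leqnSn.
  by move: so; rewrite /= ex; apply: sub_path => x y; apply: ltnW.
pose T1 := upd T r c (leg_rem v.+1 B).
have sub1 y : y \in hentries (leg_rem v.+1 B) -> y \in hentries B.
  by rewrite !mem_hentries => /or3P[->|/mem_rem->|->]; rewrite ?orbT.
have h1 : hvt T1.
  apply: hvt_upd_same => //; first exact: is_hook_leg_rem.
  by move=> y /sub1; left.
have i1 : in_tab T1 r c.+1 by rewrite in_tab_upd_in.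
have e1 : cell T1 r c.+1 = R by rewrite cell_upd_ne //; clear; lia.
have exR : hx (ext_add v R) = v by rewrite eR.
have h2 : hvt T'.
  rewrite /T' -/T1; apply: hvt_upd => //.
  - exact: slot_in.
  - have /and4P[x0 so sa /allP al] := hkR; rewrite eR; apply/and4P; split=> //.
      rewrite -[hextleg _]/(v :: hextleg R) /= ex ltnSn /=.
      by move: so; rewrite /= ex.
    by apply/allP => y /al; rewrite ex; apply: ltnW.
  - move=> _ y; rewrite cell_upd_eq exR => hy.
    have := hvt_row hT ir (sub1 y hy); rewrite -/R ex leq_eqVlt => /orP[/eqP e|//].
    move: hy; rewrite mem_hentries e -[hleg (leg_rem _ _)]/(rem v.+1 (hleg B)) (mem_rem_uniq _ (leg_uniq hkB)).
    rewrite inE eqxx /= (negPf na) orbF => /eqP e2.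
    by have := leg_gt hkB lv; rewrite -[hx (leg_rem _ _)]/(hx B) in e2 *; rewrite -e2 ltnn.
  - move=> irr y hy; rewrite cell_upd_ne; last by clear; lia.
    rewrite in_tab_upd_in // in irr; move: hy; rewrite mem_hentries eR /hx /hleg /harm /=.
    case/orP => [/eqP->|h]; last by apply: (hvt_row hT irr); rewrite -/R mem_hentries -/(hx R); move: h; rewrite inE -orbA.
    by have := hvt_row hT irr (hx_entries R); rewrite ex; apply: leq_trans; exact: leqnSn.
  - by move=> r0 y; rewrite exR cell_upd_ne; [exact: hd | move: r0; clear; lia].
  - move=> iu y hy; rewrite cell_upd_ne; last by clear; lia.
    rewrite in_tab_upd_in // in iu; move: hy; rewrite mem_hentries eR /hx /hleg /harm /=.
    case/orP => [/eqP->|h]; last by apply: (hvt_col hT iu); rewrite -/R mem_hentries -/(hx R); move: h; rewrite inE -orbA.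
    by have := hvt_col hT iu (hx_entries R); rewrite ex; apply: leq_trans; exact: leqnSn.
split=> // d u; have [a1 a2 a3] := cnt_upd (leg_rem v.+1 B) hT il d u.
have [b1 b2 b3] := cnt_upd (ext_add v R) h1 i1 d u.
rewrite -/B -/T1 in a1 a2 a3; rewrite e1 -/T1 -/T' in b1 b2 b3; split.
- move: b1; rewrite exR ex -!mulnb ![u == _]eq_sym => ->; congr (_ + _).
  by move: a1 => /addIn.
- move: a2 b2; rewrite eR -[hleg (_, _, _)]/(hx R :: hleg R) mult_cons ex.
  rewrite -[hleg (leg_rem _ _)]/(rem v.+1 (hleg B)) -(mult_rem u lv) !mulnDr -!mulnb.
  by clear; gen_terms; lia.
- by move: a3 b3; rewrite eR => /addIn <- /addIn.
Qed.

Lemma hlt_hook T r c : hvt T -> in_tab T r c -> hlt (cnt T) c (hx (cell T r c)) = r.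
Proof.
move=> hT it; have e := hlt_row hT it (hx_entries _).
by have := e; rewrite hltS (nH_at hT e) eqxx addn1 => -[].
Qed.

Lemma nH_row T r c v : hvt T -> 0 < nH (cnt T) c v -> hlt (cnt T) c v.+1 = r.+1 ->
  in_tab T r c /\ hx (cell T r c) = v.
Proof.
move=> hT h hr; split; first by apply: (hlt_in_tab hT (v := v.+1)); rewrite hr.
by move: h; rewrite (nH_at hT hr) lt0b => /eqP.
Qed.

Lemma hvt_row_pred T r c : hvt T -> in_tab T r c -> 0 < c ->
  {in hentries (cell T r c.-1), forall y, y <= hx (cell T r c)}.
Proof. by move=> hT; case: c => // c it _; exact: hvt_row. Qed.

Lemma hvt_col_pred T r c : hvt T -> in_tab T r c -> 0 < r ->
  {in hentries (cell T r.-1 c), forall y, y < hx (cell T r c)}.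
Proof. by move=> hT; case: r => // r it _; exact: hvt_col. Qed.

(** * The operators on tableaux realise the relations on counts *)

Lemma f_move_spec T i c N : hvt T -> ncols T <= N -> f_at i (cnt T) N c ->
  hvt (f_move i T (f_letter T i c)) /\ f_rel i c (cnt T) (cnt (f_move i T (f_letter T i c))).
Proof.
move=> hT leN pk; have vX := valid_cnt hT.
have HN v : nH (cnt T) N v = 0 by have [] := cnt_out v hT leN.
have x0 : 0 < xs i (cnt T) c by case/and3P: pk => _ + _; apply: leq_ltn_trans.
have [|r [it hr hi]] := @cnt_gt0 T c i hT; first by move: x0; rewrite /xs; clear; lia.
have er : row_of T c i = r by rewrite /row_of hr.
set B := cell T r c in hi *; have hkB := hvt_hook hT it.
have le_i := is_hook_min hkB hi.
have b0 := valid_ext vX c i; have b1 := valid_ext vX c i.+1.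
have up_gt : in_tab T r.+1 c -> i < hx (cell T r.+1 c) by move=> iu; exact: (hvt_col hT iu hi).
have right_ge : in_tab T r c.+1 -> i <= hx (cell T r c.+1) by move=> ir; exact: (hvt_row hT ir hi).
have nAE : nA (cnt T) c i = mult i (harm B) := nA_at hT hr.
have nEE : nE (cnt T) c i = mult i (hextleg B) := nE_at hT hr.
rewrite /f_move /f_letter /lrow /lcol /lkind /= er -/B.
case: ifP => [/andP[iu hiu]|nM].
  have hr1 : hlt (cnt T) c i.+2 = r.+2 := hlt_row hT iu hiu.
  (* An [i+1] one row above an [i] must be the hook entry there; it uses up one [-] of the column,
     so the unpaired one comes from an arm. *)
  have H1 : nH (cnt T) c i.+1 = 1 by move: hr1; rewrite hltS hr; move: b1; rewrite /nE; clear; lia.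
  have A0 : 0 < nA (cnt T) c i by move: x0; rewrite /xs {2}/nE H1; move: b0; clear; lia.
  have hA : i \in harm B by move: A0; rewrite nAE /mult count_gt0.
  have [_ exu] := nH_row hT (ltac:(by rewrite H1) : 0 < nH (cnt T) c i.+1) hr1.
  have [||h fX] := arm_move (v := i) (w := i.+1) hT it iu _ hA _ hiu; first by rewrite neq_ltn ltnSn.
    by rewrite exu.
  by split=> //; apply: F_arm => //; rewrite /slides H1 !andbF.
have up_gt1 : in_tab T r.+1 c -> i.+1 < hx (cell T r.+1 c).
  move=> iu; have := up_gt iu; rewrite leq_eqVlt => /orP[/eqP e|//].
  by move: nM; rewrite iu e hx_entries.
(* A hook entry [i+1] of the column would sit directly above [B], and (M) would have applied. *)
have H0 : nH (cnt T) c i.+1 = 0.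
  apply: eq0_contra => H1.
  have hr1 : hlt (cnt T) c i.+2 = r.+2 by rewrite hltS hr; move: H1 b1; rewrite /nE; clear; lia.
  by have [iu e] := nH_row hT H1 hr1; have := up_gt1 iu; rewrite e ltnn.
case: ifP => [/andP[ir hir]|nS].
  have ex : hx (cell T r c.+1) = i.
    apply/eqP; rewrite eqn_leq right_ge // andbT.
    exact: (is_hook_min (hvt_hook hT ir) (entries_ext hir)).
  have e1 : hlt (cnt T) c.+1 i = r by rewrite -ex; exact: hlt_hook.
  have hr1 : hlt (cnt T) c.+1 i.+1 = r.+1 := hlt_row hT ir (entries_ext hir).
  have sl : slides (cnt T) i c.
    by rewrite /slides /tight e1 hr H0 !eqxx andbT andTb (nH_at hT hr1) ex eqxx.
  have [Ep1 Ap1 Hi Li1 Aqi] := slide_facts vX (HN i) pk sl.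
  have hr2 : hlt (cnt T) c.+1 i.+2 = r.+1.
    by rewrite hltS hr1; have := valid_ext vX c.+1 i.+1; rewrite /nE Li1; clear; lia.
  have [|||h fX] := slide_left (v := i) hT ir ex _ _ _ le_i up_gt1.
  - by move: Li1; rewrite (nL_at hT hr2) => e; rewrite -count_gt0 e.
  - by move: Aqi; rewrite (nA_at hT hr1) => e; rewrite -count_gt0 e.
  - apply/negP => h; have hB : i.+1 \in hentries B by rewrite mem_hentries h orbT.
    by have := cnt_entry hT it hB; rewrite Ep1 Ap1.
  by split=> //; apply: F_slide => //; rewrite Li1.
have nsl : ~~ slides (cnt T) i c.
  apply/negP => /and3P[/eqP tg Hi _].
  have hr1 : hlt (cnt T) c.+1 i.+1 = r.+1.
    by move: tg; rewrite hr [in X in _ -> X]hltS => -[->]; have := valid_ext vX c.+1 i; rewrite /nE; move: Hi; clear; lia.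
  have [ir e] := nH_row hT Hi hr1; move: nS; rewrite ir -e /= => /negP; apply.
  by rewrite /hextleg inE eqxx.
have right_gt : in_tab T r c.+1 -> i < hx (cell T r c.+1).
  move=> ir; have := right_ge ir; rewrite leq_eqVlt => /orP[/eqP e|//].
  by move: nS; rewrite ir e /hextleg inE eqxx.
have [A0|A0] := posnP (nA (cnt T) c i).
  have E1 : nE (cnt T) c i.+1 = 0 by move: x0; rewrite /xs A0; move: b0 b1; clear; lia.
  have E0 : 0 < nE (cnt T) c i by move: x0; rewrite /xs A0; clear; lia.
  have hv : i \in hextleg B by move: E0; rewrite nEE /mult count_gt0.
  have niB : i.+1 \notin hextleg B.
    apply/negP => h; have hr1 := hlt_row hT it (entries_ext h).
    by move: E1; rewrite (nE_at hT hr1) => e; rewrite -count_gt0 e in h.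
  have [||||h fX] := ext_replace (v := i) (w := i.+1) hT it hv niB (ltn0Sn i) _ _ _ _ right_gt up_gt1.
  - by move=> y _; clear; lia.
  - move=> e y hy; rewrite ltn_neqAle; apply/andP; split; last first.
      by rewrite -e; apply: (is_hook_min hkB); exact: entries_arm.
    by apply/negP => /eqP ey; move: A0; rewrite nAE /mult => e2; move: hy; rewrite -ey -count_gt0 e2.
  - by move=> e c0 y /(hvt_row_pred hT it c0); rewrite -/B e; apply: leqW.
  - by move=> e r0 y /(hvt_col_pred hT it r0); rewrite -/B e; apply: leqW.
  split=> //; apply: F_ext => // d v; rewrite (nH_at hT hr) (nL_at hT hr); exact: fX.
have hA : i \in harm B by move: A0; rewrite nAE /mult count_gt0.
have [|h fX] := arm_replace (v := i) (w := i.+1) hT it hA _ right_gt up_gt1.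
- by apply: leqW.
by split=> //; apply: F_arm.
Qed.

Lemma e_move_spec T i c N : hvt T -> 0 < i -> e_at i (cnt T) N c ->
  hvt (e_move i T (e_letter T i c)) /\ e_rel i c (cnt T) (cnt (e_move i T (e_letter T i c))).
Proof.
move=> hT i0 pk; have vX := valid_cnt hT.
have y0 : 0 < ys i (cnt T) c by case/and3P: pk => _ + _; apply: leq_ltn_trans.
have [|r [it hr hi]] := @cnt_gt0 T c i.+1 hT; first by move: y0; rewrite /ys; clear; lia.
have er : row_of T c i.+1 = r by rewrite /row_of hr.
set B := cell T r c in hi *; have hkB := hvt_hook hT it.
have le_i := is_hook_min hkB hi.
have b0 := valid_ext vX c i; have b1 := valid_ext vX c i.+1.
have up_gt : in_tab T r.+1 c -> i.+1 < hx (cell T r.+1 c) by move=> iu; exact: (hvt_col hT iu hi).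
have right_ge : in_tab T r c.+1 -> i.+1 <= hx (cell T r c.+1) by move=> ir; exact: (hvt_row hT ir hi).
have nAE : nA (cnt T) c i.+1 = mult i.+1 (harm B) := nA_at hT hr.
have nEE : nE (cnt T) c i.+1 = mult i.+1 (hextleg B) := nE_at hT hr.
rewrite /e_move /e_letter /lrow /lcol /lkind /= er -/B.
case: ifP => [/andP[/andP[r0 id] hid]|nM].
  have hr1 : hlt (cnt T) c i.+1 = r by have := hlt_row hT id hid; rewrite prednK.
  have H1 : nH (cnt T) c i.+1 = 1 by move: hr; rewrite hltS hr1; move: b1; rewrite /nE; clear; lia.
  have EA : 0 < nE (cnt T) c i + nA (cnt T) c i by exact: cnt_entry hid.
  have A0 : 0 < nA (cnt T) c i.+1.
    by move: y0 b1 EA; rewrite /ys; clear; lia.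
  have hA : i.+1 \in harm B by move: A0; rewrite nAE /mult count_gt0.
  have le2 : hx (cell T r.-1 c) <= i by apply: (is_hook_min (hvt_hook hT id)).
  have [|h eX] := arm_move (v := i.+1) (w := i) hT it id _ hA le2 hid; first by move: r0; clear; lia.
  split=> //; apply: E_arm => //; last by rewrite EA.
  by rewrite /e_slides (gtn_eqF EA) !andbF.
(* An [i] of the column lies below [B]; strictness between [i] and the hook entry [i+1] leaves no
   room for a row in between, so it lies in the cell directly below, the excluded case (M). *)
have no : hx B = i.+1 -> nE (cnt T) c i + nA (cnt T) c i = 0.
  move=> ex; apply: eq0_contra => h.
  have [s [is_ hs hsi]] := cnt_gt0 hT h.
  have sr : s < r by move: (hlt_hook hT it); rewrite -/B ex hs => <-.
  move/negP: nM; apply; have r0 : 0 < r by apply: leq_trans sr.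
  have -> : r.-1 = s; last by rewrite r0 is_ hsi.
  apply/eqP; rewrite eqn_leq andbC; apply/andP; split; first by move: sr; clear; lia.
  rewrite leqNgt; apply/negP => lt.
  have ip : in_tab T r.-1 c by apply: hvt_down_le it => //; exact: leq_pred.
  have h1 := hvt_col_lt hT lt ip hsi; have h2 := hvt_col_pred hT it r0 (hx_entries _).
  by move: h1 h2; rewrite -/B ex; clear; lia.
case: ifP => [/andP[/andP[c0 il] hil]|nS].
  have [c' ec] : exists c', c = c'.+1 by exists c.-1; rewrite prednK.
  subst c; rewrite [c'.+1.-1]/= in il hil *.
  have hle : i.+1 \in hentries (cell T r c') by rewrite mem_hentries hil orbT.
  have ex : hx B = i.+1 by apply/eqP; rewrite eqn_leq le_i; exact: (hvt_row hT it hle).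
  have hr1 : hlt (cnt T) c' i.+2 = r.+1 := hlt_row hT il hle.
  have e3 : hlt (cnt T) c'.+1 i.+1 = r by rewrite -ex; exact: hlt_hook.
  have sl : e_slides (cnt T) i c'.+1.
    rewrite /e_slides [c'.+1.-1]/= (no ex) eqxx andbT /tight hr1 e3 eqxx andbT.
    by rewrite (nL_at hT hr1) (nH_at hT hr) -/B ex eqxx andbT /= count_gt0.
  have [H0 L0 A0 I0 _] := e_slide_facts vX pk sl.
  have [||h eX] := slide_right hT i0 it ex hil.
  - by move: A0; rewrite [c'.+1.-1]/= (nA_at hT hr1) => e; rewrite -count_gt0 e.
  - move=> r0 y hy; have := hvt_col_pred hT it r0 hy; rewrite -/B ex ltnS leq_eqVlt => /orP[/eqP e|//].
    by move: nM; rewrite r0 -e hy andbT (hvt_down_le hT (leq_pred r) it).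
  by split=> //; apply: E_slide.
(* The left neighbour could contain [i+1] only as its hook entry: in the leg it would give (S), in
   the arm a free [+] too far left. Then column [c.-1] has an [i] in a lower row [s], and the row
   and column conditions force hook entry [i] in cell [(s, c)], against [no]. *)
have left_le : 0 < c -> {in hentries (cell T r c.-1), forall y, y <= i}.
  move=> c0 y hy; have := leq_trans (hvt_row_pred hT it c0 hy) le_i.
  rewrite leq_eqVlt => /orP[/eqP ey|//]; exfalso.
  have ex : hx B = i.+1 by apply/eqP; rewrite eqn_leq le_i -ey; exact: (hvt_row_pred hT it c0 hy).
  have il : in_tab T r c.-1 by apply: in_tab_left it; exact: leq_pred.
  have hr1 : hlt (cnt T) c.-1 i.+2 = r.+1 by rewrite -ey; exact: hlt_row.
  have yl : ys i (cnt T) c.-1 = 0.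
    have /and3P[_ _] := pk; rewrite -{1}(prednK c0) open_plusS /xs.
    by move: (no ex); clear; lia.
  have Al : nA (cnt T) c.-1 i.+1 = 0 by move: yl; rewrite /ys; clear; lia.
  have hxl : hx (cell T r c.-1) = i.+1.
    move: hy; rewrite mem_hentries ey => /or3P[/eqP->//|h|h].
      by move: nS; rewrite c0 il h.
    by move: Al; rewrite (nA_at hT hr1) => e; move: h; rewrite -count_gt0 e.
  have El : 0 < nE (cnt T) c.-1 i + nA (cnt T) c.-1 i.
    have : 0 < nH (cnt T) c.-1 i.+1 by rewrite (nH_at hT hr1) hxl eqxx.
    by move: yl; rewrite /ys {1}/nE; clear; lia.
  have [s [is_ hs hsi]] := cnt_gt0 hT El.
  have sr : s < r by move: (hlt_hook hT il); rewrite hxl hs => <-.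
  have isc : in_tab T s c := hvt_down_le hT (ltnW sr) it.
  have h1 := hvt_row_pred hT isc c0 hsi; have h2 := hvt_col_lt hT sr it (hx_entries _).
  have e : hx (cell T s c) = i by move: h1 h2; rewrite -/B ex; clear; lia.
  have := cnt_entry hT isc (hx_entries _); rewrite e no //.
have down_lt : 0 < r -> {in hentries (cell T r.-1 c), forall y, y < i}.
  move=> r0 y hy; have := leq_trans (hvt_col_pred hT it r0 hy) le_i.
  rewrite ltnS leq_eqVlt => /orP[/eqP e|//].
  by move: nM; rewrite r0 -e hy andbT (hvt_down_le hT (leq_pred r) it).
have nsl : ~~ e_slides (cnt T) i c.
  apply/negP => /and5P[c0 L1 H1 /eqP + _]; rewrite prednK //.
  have [_ ex] := nH_row hT H1 hr; have := hlt_hook hT it; rewrite ex => -> hr1.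
  have il : in_tab T r c.-1 by apply: in_tab_left it; exact: leq_pred.
  by move: L1 nS; rewrite (nL_at hT (esym hr1)) count_gt0 c0 il => ->.
case: ifP => [/andP[/eqP EA0 E1]|nk].
  have hv : i.+1 \in hextleg B by move: E1; rewrite nEE /mult count_gt0.
  have niB : i \notin hextleg B.
    by apply/negP => h; have := cnt_entry hT it (entries_ext h); rewrite EA0.
  have [||||h fX] := ext_replace (v := i.+1) (w := i) hT it hv niB i0 _ _ _ _
     (fun h => ltnW (right_ge h)) (fun h => ltnW (up_gt h)).
  - move=> y hy n; have : y != i by apply: contraNneq niB => <-.
    by move: n; clear; lia.
  - by move=> e y hy; apply: ltnW; rewrite -e; apply: (is_hook_min hkB); exact: entries_arm.
  - by move=> _; exact: left_le.
  - by move=> _; exact: down_lt.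
  split=> //; apply: E_ext => // d v; rewrite (nH_at hT hr) (nL_at hT hr); exact: fX.
have c0 : (0 < nE (cnt T) c i + nA (cnt T) c i) || (nE (cnt T) c i.+1 == 0).
  by move/negbT: nk; rewrite negb_and -lt0n -eqn0Ngt.
have A0 : 0 < nA (cnt T) c i.+1 by move: y0 c0 b1; rewrite /ys; clear; lia.
have hA : i.+1 \in harm B by move: A0; rewrite nAE /mult count_gt0.
have hxB : hx B <= i.
  rewrite -ltnS ltn_neqAle le_i andbT; apply/negP => /eqP ex.
  have := nH_at hT hr; rewrite -/B ex eqxx => H1.
  by move: c0; rewrite (no ex) /nE H1.
have [h fX] := arm_replace (v := i.+1) (w := i) hT it hA hxB (fun h => ltnW (right_ge h)) (fun h => ltnW (up_gt h)).
by split=> //; apply: E_arm.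
Qed.

(** * Bumping on counts *)

Lemma mem_flatten_cell T h : h \in flatten T -> exists r c, in_tab T r c /\ cell T r c = h.
Proof.
move=> /flattenP[row /(nthP [::])[r lr <-]] /(nthP dflt_hook)[c lc <-].
by exists r, c.
Qed.

Lemma cell_mem_flatten T r c : in_tab T r c -> cell T r c \in flatten T.
Proof.
move=> it; apply/flattenP; exists (nth [::] T r).
  by apply: mem_nth; exact: in_tab_size it.
exact: mem_nth it.
Qed.

Lemma arm_excess_gt0P T : reflect (exists r c, in_tab T r c /\ harm (cell T r c) != [::]) (0 < arm_excess T).
Proof.
rewrite /arm_excess sumnE big_map; apply: (iffP idP) => [h|[r [c [it ne]]]].
  suff /hasP[h0 hf ne] : has (fun h => harm h != [::]) (flatten T).
    by have [r [c [it e]]] := mem_flatten_cell hf; exists r, c; rewrite e.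
  apply: contraTT h => /hasPn no; rewrite -leqNgt leqn0; apply/eqP.
  by rewrite big_seq big1 // => h /no; rewrite negbK => /eqP ->.
rewrite (big_rem _ (cell_mem_flatten it)) /= addn_gt0; apply/orP; left.
by case: (harm _) ne.
Qed.

Lemma nA_gt0 T c v : hvt T -> 0 < nA (cnt T) c v -> exists2 r, in_tab T r c & v \in harm (cell T r c).
Proof. by move=> hT /nG_gt0[r it h]; exists r => //; rewrite -count_gt0. Qed.

Lemma arm_nA T r c v : hvt T -> in_tab T r c -> v \in harm (cell T r c) -> 0 < nA (cnt T) c v.
Proof.
by move=> hT it h; rewrite (nA_at hT (hlt_row hT it (entries_arm h))) count_gt0.
Qed.

Lemma amax_mem h : harm h != [::] -> amax h \in harm h.
Proof.
rewrite /amax; case: h => -[x l] s; rewrite /harm /=.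
elim: s => // y [|z s] IH _; first by rewrite big_seq1 inE.
rewrite big_cons; have := IH isT; set m := \big[_/_]_(_ <- _) _ => hm.
by rewrite /maxn inE; case: ltnP; rewrite ?eqxx ?hm ?orbT.
Qed.

Lemma leq_bigmax_mem (s : seq nat) y : y \in s -> y <= \max_(z <- s) z.
Proof. by move=> ys; apply: (leq_bigmax_seq (P := xpredT) (F := id)). Qed.

Lemma amax_ub h y : y \in harm h -> y <= amax h.
Proof. exact: leq_bigmax_mem. Qed.

Lemma bigmax_le (I : eqType) (s : seq I) (P : pred I) F m : (forall j, j \in s -> P j -> F j <= m) ->
  \max_(j <- s | P j) F j <= m.
Proof.
move=> h; rewrite big_seq_cond; elim/big_ind: _ => // [x y|j /andP[]]; last exact: h.
by rewrite geq_max => -> ->.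
Qed.

Lemma bigmax_eq (I : eqType) (s : seq I) (P : pred I) F j m : j \in s -> P j -> F j = m ->
  (forall j, j \in s -> P j -> F j <= m) -> \max_(j <- s | P j) F j = m.
Proof.
move=> js Pj Fj h; apply/eqP; rewrite eqn_leq bigmax_le //= -Fj.
exact: leq_bigmax_seq.
Qed.

Lemma foldr_minn_eq x s k : k \in s -> k <= x -> {in s, forall y, k <= y} -> foldr minn x s = k.
Proof.
move=> ks kx ub; apply/eqP; rewrite eqn_leq; apply/andP; split.
  elim: s ks {ub} => // y s IH; rewrite inE /= => /orP[/eqP->|/IH]; first exact: geq_minl.
  by apply: leq_trans; exact: geq_minr.
elim: s {ks} ub => //= y s IH ub; rewrite leq_min ub ?mem_head // IH // => z zs.
by apply: ub; rewrite inE zs orbT.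
Qed.

Lemma arm_col_eq T p a hk k : hvt T -> V_sel (cnt T) p a hk k -> arm_col T = p.
Proof.
move=> hT sX; have [r it ha] := nA_gt0 hT (Vsel_arm sX).
apply: (bigmax_eq (j := p)) => //.
- rewrite mem_iota add0n /=; have := hvt_down_le hT (leq0n r) it; by rewrite /in_tab.
- apply/hasP; exists r; first by rewrite mem_col_cells.
  by apply: contraTneq ha => ->.
- move=> c _ /hasP[s]; rewrite mem_col_cells => is_ ne; rewrite leqNgt; apply/negP => lt.
  have := arm_nA hT is_ (amax_mem ne); by rewrite (Vsel_right sX _ lt).
Qed.

Lemma nth0_filter (I : eqType) (d : I) P s : has P s ->
  P (nth d (filter P s) 0) && (nth d (filter P s) 0 \in s).
Proof. by move=> h; rewrite -mem_filter; apply: mem_nth; rewrite size_filter -has_count. Qed.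

Lemma V_sel_arm0 T p a hk k r : hvt T -> V_sel (cnt T) p a hk k -> in_tab T r p.+1 ->
  harm (cell T r p.+1) = [::].
Proof.
move=> hT sX it; case: (eqVneq (harm (cell T r p.+1)) [::]) => // ne.
by have := arm_nA hT it (amax_mem ne); rewrite (Vsel_right sX).
Qed.

Lemma V_sel_ext T p a hk k r v : hvt T -> V_sel (cnt T) p a hk k -> in_tab T r p.+1 ->
  (v \in hentries (cell T r p.+1)) = (v \in hextleg (cell T r p.+1)).
Proof. by move=> hT sX it; rewrite /hentries (V_sel_arm0 hT sX it) cats0. Qed.

Lemma ext_nE T r c v : hvt T -> in_tab T r c -> v \in hextleg (cell T r c) -> 0 < nE (cnt T) c v.
Proof.
by move=> hT it h; rewrite (nE_at hT (hlt_row hT it (entries_ext h))) count_gt0.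
Qed.

Lemma nE_gt0 T c v : hvt T -> 0 < nE (cnt T) c v ->
  exists2 r, in_tab T r c & v \in hextleg (cell T r c).
Proof.
move=> hT h; have [r [it hr _]] := cnt_gt0 hT (ltn_addr (nA (cnt T) c v) h).
by exists r => //; rewrite -count_gt0 -(nE_at hT hr).
Qed.

Lemma V_sel_excess T p a hk k : hvt T -> V_sel (cnt T) p a hk k -> arm_excess T != 0.
Proof.
move=> hT sX; have [r it ha] := nA_gt0 hT (Vsel_arm sX).
by rewrite -lt0n; apply/arm_excess_gt0P; exists r, p; split=> //; apply: contraTneq ha => ->.
Qed.

Definition Vb_diff T p a (hk : bool) k r rt :=
  let T1 := upd T r p (arm_rem a (cell T r p)) in
  upd T1 rt p.+1 (if hk then arm_add k (ext_repl k a (cell T1 rt p.+1)) else (a, [::], [::])).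

Definition Vb_same T p a (hk : bool) k r :=
  let h := cell T r p in
  let hb := if hk then cell T r p.+1 else (a, [::], [::]) in
  upd (upd T r p (hx h, [seq y <- hleg h | y <= a], rem a (harm h))) r p.+1
    (a, sort leq (hleg hb ++ [seq y <- hleg h | a < y]),
     if hk then sort leq (k :: harm hb) else harm hb).

(** The searches in [Vb] are resolved by the choices of [V_sel]. The bound [ell] disappears, being
    the largest leg entry. *)
Lemma Vb_explicit T p a hk k : hvt T -> V_sel (cnt T) p a hk k -> exists r rt, [/\
  in_tab T r p, a \in harm (cell T r p),
  if hk then in_tab T rt p.+1 && (k \in hextleg (cell T rt p.+1)) else rt == size (col_cells T p.+1) &
  Vb T = if rt != r then Vb_diff T p a hk k r rt else Vb_same T p a hk k r].
Proof.
move=> hT sX; rewrite /Vb (negPf (V_sel_excess hT sX)) (arm_col_eq hT sX).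
lazy zeta.
set rs := [seq r <- col_cells T p | harm (cell T r p) != [::]].
have rsP r : (r \in rs) = in_tab T r p && (harm (cell T r p) != [::]).
  by rewrite mem_filter mem_col_cells andbC.
have le_a r : r \in rs -> amax (cell T r p) <= a.
  rewrite rsP => /andP[it ne]; rewrite leqNgt; apply/negP => lt.
  by have := arm_nA hT it (amax_mem ne); rewrite (Vsel_max sX lt).
have [r0 it0 ha0] := nA_gt0 hT (Vsel_arm sX).
have r0s : r0 \in rs by rewrite rsP it0; apply: contraTneq ha0 => ->.
have e0 : amax (cell T r0 p) = a by apply/eqP; rewrite eqn_leq le_a // amax_ub.
have -> : \max_(r <- rs) amax (cell T r p) = a.
  by apply: (bigmax_eq r0s) => // j js _; exact: le_a.
have /nth0_filter-/(_ 0) : has (fun r => amax (cell T r p) == a) rs.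
  by apply/hasP; exists r0 => //; rewrite e0.
set r := nth 0 [seq r <- rs | amax (cell T r p) == a] 0 => /andP[/eqP er].
rewrite rsP => /andP[it ne]; rewrite er.
have ha : a \in harm (cell T r p) by rewrite -er amax_mem.
set ents := flatten _; set cands := [seq p0 <- ents | a <= p0.1].
have entsP v s : ((v, s) \in ents) = in_tab T s p.+1 && (v \in hextleg (cell T s p.+1)).
  apply/flattenP/andP=> [[w /mapP[s' h ->] /mapP[v' hv [-> ->]]]|[is_ hv]].
    rewrite mem_col_cells in h; by rewrite -(V_sel_ext _ hT sX).
  exists [seq (v, s) | v <- hentries (cell T s p.+1)]; first by apply: map_f; rewrite mem_col_cells.
  by apply: map_f; rewrite (V_sel_ext _ hT sX).
have candsP v s : ((v, s) \in cands) = [&& a <= v, in_tab T s p.+1 & v \in hextleg (cell T s p.+1)].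
  by rewrite mem_filter entsP.
have feq1 : [seq y <- hleg (cell T r p) | a < y <= \max_(y <- hleg (cell T r p)) y] =
            [seq y <- hleg (cell T r p) | a < y].
  by apply: eq_in_filter => y /leq_bigmax_mem ->; rewrite andbT.
have feq2 : [seq y <- hleg (cell T r p) | ~~ (a < y <= \max_(y <- hleg (cell T r p)) y)] =
            [seq y <- hleg (cell T r p) | y <= a].
  by apply: eq_in_filter => y /leq_bigmax_mem ->; rewrite andbT -leqNgt.
rewrite feq1 feq2; clearbody cands r.
case: hk sX => sX; last first.
  have -> : cands = [::].
    case: cands candsP => // -[v s] w /(_ v s); rewrite mem_head => /esym/and3P[av is_ hv].
    by have := ext_nE hT is_ hv; rewrite (Vsel_min sX av).
  by exists r, (size (col_cells T p.+1)).
have /andP[Ek ak] := Vsel_k sX isT.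
have [rk ik hk] := nE_gt0 hT Ek.
have kin : (k, rk) \in cands by rewrite candsP ak ik.
have vin : k \in [seq p.1 | p <- cands] by apply/mapP; exists (k, rk).
have vmin : {in [seq p.1 | p <- cands], forall y, k <= y}.
  move=> y /mapP[[v s] h ->]; move: h; rewrite candsP /= => /and3P[av is_ hv].
  rewrite leqNgt; apply/negP => lt.
  by have := ext_nE hT is_ hv; rewrite (Vsel_min sX av).
have ek : foldr minn (head 0 [seq p.1 | p <- cands]) [seq p.1 | p <- cands] = k.
  apply: foldr_minn_eq => //; case: ([seq p.1 | p <- cands]) vin vmin => // y s _; apply; exact: mem_head.
rewrite ek; have /nth0_filter-/(_ (0, 0)) : has (fun q => q.1 == k) cands.
  by apply/hasP; exists (k, rk) => /=.
case: cands candsP kin {ek vin vmin} => // c0 cs candsP kin.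
set pr := nth _ _ 0; case: pr => v s /andP[/= /eqP->].
rewrite candsP => /and3P[_ is_ hs].
by exists r, s; split=> //; rewrite ?is_.
Qed.

Lemma V_sel_below T p a hk k s y : hvt T -> V_sel (cnt T) p a hk k -> in_tab T s p.+1 ->
  y \in hentries (cell T s p.+1) -> (hk -> y < k) -> y < a.
Proof.
move=> hT sX is_; rewrite (V_sel_ext _ hT sX is_) => hy lk; rewrite ltnNge; apply/negP => le.
by have := ext_nE hT is_ hy; rewrite (Vsel_min sX le).
Qed.

Lemma size_col_cells T c v : hvt T -> (forall r, in_tab T r c -> hx (cell T r c) < v) ->
  size (col_cells T c) = hlt (cnt T) c v.
Proof.
move=> hT h; rewrite hlt_cnt /nG size_filter -sum1_count big_mkcond /=.
rewrite -(big_mkord xpredT (fun r => in_tab T r c * (hx (cell T r c) < v))) /index_iota subn0.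
by apply: eq_bigr => r _; case: ifP => // /h ->.
Qed.

(** Column [p.+1] has no hook entry in the interval from [a] to [k], with [k] excluded, so the
    target row is [hlt (cnt T) p.+1 a] if [k] is a hook entry or missing, and one less if [k] is a
    leg entry. The row condition at [a] bounds this number by [r]; hence type (b) means tightness
    with [k] not in a leg. *)
Lemma V_geom T p a hk k r rt : hvt T -> V_sel (cnt T) p a hk k ->
  in_tab T r p -> a \in harm (cell T r p) ->
  (if hk then in_tab T rt p.+1 && (k \in hextleg (cell T rt p.+1)) else rt == size (col_cells T p.+1)) ->
  [/\ rt <= r, ((hk ==> (0 < nH (cnt T) p.+1 k)) && tight (cnt T) p a) = (rt == r),
      hk -> nH (cnt T) p.+1 k = (hx (cell T rt p.+1) == k),
      hk -> rt = r -> hx (cell T rt p.+1) = k &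
      ~~ hk -> in_tab T rt p.+1 = false /\ (0 < rt -> in_tab T rt.-1 p.+1)].
Proof.
move=> hT sX it ha hrt; have hr := hlt_row hT it (entries_arm ha).
have ltr : hlt (cnt T) p.+1 a <= r.
  have := valid_row (valid_cnt hT) (ltn_addl (nE (cnt T) p a) (arm_nA hT it ha)).
  by rewrite hr ltnS.
have tE : tight (cnt T) p a = (hlt (cnt T) p.+1 a == r) by rewrite /tight hr eqSS.
case: hk hrt sX => [/andP[irt hk] sX|/eqP ert sX].
  have hkr := hlt_row hT irt (entries_ext hk).
  have eH := nH_at hT hkr.
  have gap : hlt (cnt T) p.+1 k = hlt (cnt T) p.+1 a.
    have /andP[_ ak] := Vsel_k sX isT.
    apply: hlt_gap => // u /andP[au uk].
    by have := Vsel_min sX au (fun _ => uk); rewrite /nE; move: (nH _ _ _) (nL _ _ _); lia.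
  have := hkr; rewrite hltS gap eH => e2.
  have [eh|nh] := eqVneq (hx (cell T rt p.+1)) k.
    move: e2; rewrite eh eqxx addn1 => -[e2]; split=> //.
    - by rewrite -e2.
    - by rewrite /= tE e2.
  move: e2; rewrite (negPf nh) addn0 => e2; split=> //.
  - by move: ltr e2; clear; lia.
  - by rewrite /=; apply/esym/eqP; move: ltr e2; clear; lia.
  - by move=> _ e; move: ltr e2; rewrite e; clear; lia.
have lt s : in_tab T s p.+1 -> hx (cell T s p.+1) < a.
  by move=> is_; apply: (V_sel_below hT sX is_ (hx_entries _)).
rewrite (size_col_cells hT lt) in ert.
split=> //; first by rewrite ert.
  by rewrite tE ert.
move=> _; split.
  apply/negP => irt; have := hlt_row hT irt (hx_entries _).
  have := hlt_mono (cnt T) p.+1 (lt _ irt); rewrite -ert; clear; lia.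
by move=> rt0; apply: (hlt_in_tab hT (v := a)); rewrite -ert; move: rt0; clear; lia.
Qed.

Lemma moved_eq T p a hk k r rt v : hvt T ->
  in_tab T r p -> a \in harm (cell T r p) ->
  ((hk ==> (0 < nH (cnt T) p.+1 k)) && tight (cnt T) p a) = (rt == r) ->
  moved (cnt T) p a hk k v = (rt == r) * ((a < v) * mult v (hleg (cell T r p))).
Proof.
move=> hT it ha e; rewrite /moved andbA e (hlt_row hT it (entries_arm ha)).
case: (rt == r); last by [].
case: (a < v); last by [].
rewrite !andTb !mul1n.
case: eqP => [hv|ne]; first by rewrite (nL_at hT hv).
apply/esym/eqP; rewrite -leqn0 leqNgt /mult count_gt0; apply/negP => h; case: ne.
by apply: (hlt_row hT it); rewrite mem_hentries h orbT.
Qed.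

Lemma upd_upd T r c h1 h2 : upd (upd T r c h1) r c h2 = upd T r c h2.
Proof. by rewrite /upd /set_cell nth_set_nth /= eqxx set_set_nth eqxx set_set_nth eqxx. Qed.

Lemma ext_repl_id v h : ext_repl v v h = h.
Proof.
have e s : map (subst_val v v) s = s.
  by rewrite -[RHS]map_id; apply: eq_map => y; rewrite /subst_val; case: eqP.
by rewrite ext_replE e /subst_val; case: h => -[x l] s; rewrite /hx /=; case: eqP => // ->.
Qed.

Lemma cnt_slot T r c h : slot T r c -> forall d v, [/\
  nH (cnt (upd T r c h)) d v + (d == c) && in_tab T r c * (hx (cell T r c) == v) =
    nH (cnt T) d v + (d == c) * (hx h == v),
  nL (cnt (upd T r c h)) d v + (d == c) && in_tab T r c * mult v (hleg (cell T r c)) =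
    nL (cnt T) d v + (d == c) * mult v (hleg h) &
  nA (cnt (upd T r c h)) d v + (d == c) && in_tab T r c * mult v (harm (cell T r c)) =
    nA (cnt T) d v + (d == c) * mult v (harm h)].
Proof. by move=> sl d v; split; apply: nG_upd. Qed.

Lemma V_rel_of_moves T p a hk k r rt Y : hvt T -> in_tab T r p -> a \in harm (cell T r p) ->
  ((hk ==> (0 < nH (cnt T) p.+1 k)) && tight (cnt T) p a) = (rt == r) ->
  rt != r ->
  (forall d v, [/\
    nH Y d v + [&& hk, 0 < nH (cnt T) p.+1 k, d == p.+1 & v == k] =
    nH (cnt T) d v + [&& hk ==> (0 < nH (cnt T) p.+1 k), d == p.+1 & v == a],
    nL Y d v + [&& hk, nH (cnt T) p.+1 k == 0, d == p.+1 & v == k] =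
    nL (cnt T) d v + [&& hk, nH (cnt T) p.+1 k == 0, d == p.+1 & v == a] &
    nA Y d v + (d == p) && (v == a) = nA (cnt T) d v + [&& hk, d == p.+1 & v == k]]) ->
  V_rel (cnt T) p a hk k Y.
Proof.
move=> hT it ha e ne h d v; have [e1 e2 e3] := h d v.
by rewrite (moved_eq v hT it ha e) (negPf ne) mul0n !muln0 !addn0.
Qed.

Lemma cnt_arm_rem T r c (w : nat) : hvt T -> in_tab T r c -> w \in harm (cell T r c) ->
  forall d u, let T' := upd T r c (arm_rem w (cell T r c)) in
  [/\ nH (cnt T') d u = nH (cnt T) d u, nL (cnt T') d u = nL (cnt T) d u &
      nA (cnt T') d u + (d == c) && (u == w) = nA (cnt T) d u].
Proof.
move=> hT it hw d u T'; have [a1 a2 a3] := cnt_upd (arm_rem w (cell T r c)) hT it d u.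
rewrite -/T' in a1 a2 a3; split; [exact: addIn a1|exact: addIn a2|].
have m := mult_arm_rem u hw; move: m a3; clear; case: (d == c); last by rewrite !mul0n !addn0.
by rewrite !mul1n andTb; lia.
Qed.

Lemma cnt_arm_add T r c (w : nat) : hvt T -> in_tab T r c ->
  forall d u, let T' := upd T r c (arm_add w (cell T r c)) in
  [/\ nH (cnt T') d u = nH (cnt T) d u, nL (cnt T') d u = nL (cnt T) d u &
      nA (cnt T') d u = nA (cnt T) d u + (d == c) && (u == w)].
Proof.
move=> hT it d u T'; have [a1 a2 a3] := cnt_upd (arm_add w (cell T r c)) hT it d u.
rewrite -/T' in a1 a2 a3; split; [exact: addIn a1|exact: addIn a2|].
have m := mult_arm_add u w (cell T r c); move: m a3; clear; case: (d == c); last by rewrite !mul0n !addn0.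
by rewrite !mul1n andTb; lia.
Qed.

Lemma Vb_diff_spec T p a hk k r rt : hvt T -> V_sel (cnt T) p a hk k ->
  in_tab T r p -> a \in harm (cell T r p) ->
  (if hk then in_tab T rt p.+1 && (k \in hextleg (cell T rt p.+1)) else rt == size (col_cells T p.+1)) ->
  rt != r ->
  hvt (Vb_diff T p a hk k r rt) /\ V_rel (cnt T) p a hk k (cnt (Vb_diff T p a hk k r rt)).
Proof.
move=> hT sX it ha hrt ne; have [le eT eH _ new] := V_geom hT sX it ha hrt.
have ltr : rt < r by rewrite ltn_neqAle ne.
have nq : (p.+1 == p) = false by apply/negbTE; rewrite neq_ltn ltnSn orbT.
rewrite /Vb_diff; set T1 := upd T r p _.
have hT1 : hvt T1 := hvt_arm_rem _ hT it.
have c1 := cnt_arm_rem hT it ha; rewrite -/T1 in c1.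
have iT1 s d : in_tab T1 s d = in_tab T s d by rewrite in_tab_upd_in.
have cq s : cell T1 s p.+1 = cell T s p.+1 by rewrite cell_upd_ne // nq orbT.
have cqq s : cell T1 s p.+2 = cell T s p.+2.
  by rewrite cell_upd_ne //; apply/orP; right; apply/eqP; clear; lia.
have cl : cell T1 rt p = cell T rt p by rewrite cell_upd_ne // ne.
have a0 : 0 < a.
  have := is_hook_min (hvt_hook hT it) (entries_arm ha).
  by apply: leq_trans; have /and4P[] := hvt_hook hT it.
(* In type (a) the target row is strictly below the row of [a], so the left neighbour of the target
   has only entries smaller than [a]. *)
have left : {in hentries (cell T1 rt p), forall y, y <= a}.
  rewrite cl => y hy; apply: ltnW; apply: leq_trans _ (is_hook_min (hvt_hook hT it) (entries_arm ha)).
  exact: (hvt_col_lt hT ltr it).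
rewrite cq; case: hk sX hrt eT eH new => [sX /andP[irt hk] eT eH _|sX hrt eT _ /(_ isT)[nirt below]].
  have {}eH := eH isT; have /andP[_ ak] := Vsel_k sX isT.
  have irt1 : in_tab T1 rt p.+1 by rewrite iT1.
  have hxk : hx (cell T rt p.+1) <= k := is_hook_min (hvt_hook hT irt) (entries_ext hk).
  have ur : in_tab T1 rt p.+2 -> k <= hx (cell T1 rt p.+2).
    by rewrite iT1 cqq => i2; apply: (hvt_row hT i2); apply: entries_ext.
  have uu : in_tab T1 rt.+1 p.+1 -> k < hx (cell T1 rt.+1 p.+1).
    by rewrite iT1 cq => i2; apply: (hvt_col hT i2); apply: entries_ext.
  (* For [k = a] the replacement is the identity; [ext_replace] needs a value that is new to the
     extended leg. *)
  have [ea|na] := eqVneq k a.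
    subst k; rewrite ext_repl_id.
    have e : arm_add a (cell T rt p.+1) = arm_add a (cell T1 rt p.+1) by rewrite cq.
    split.
      by rewrite e; apply: (hvt_arm_add hT1 irt1); rewrite cq //; left; exact: entries_ext.
    apply: (V_rel_of_moves hT it ha eT ne) => d v.
    rewrite e; have [-> -> ->] := cnt_arm_add a hT1 irt1 d v.
    have [-> -> <-] := c1 d v; split=> //.
    by rewrite addnAC.
  have lt : a < k by rewrite ltn_neqAle eq_sym na.
  have ha' : a \notin hextleg (cell T rt p.+1).
    by apply/negP => /(ext_nE hT irt); rewrite (Vsel_min sX (leqnn a)).
  pose T2 := upd T1 rt p.+1 (ext_repl k a (cell T1 rt p.+1)).
  have [|||||||||hT2 c2] := @ext_replace T1 rt p.+1 k a hT1 irt1; rewrite ?cq //.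
  - move=> y hy yk; have := V_sel_below hT sX irt (entries_ext hy); move: yk lt; clear; lia.
  - by move=> _ y; rewrite (V_sel_arm0 hT sX irt).
  - move=> eh r0 y hy; have i1 := hvt_down_le hT (leq_pred rt) irt.
    apply: (V_sel_below hT sX i1 hy) => _; rewrite -eh.
    by apply: (hvt_col_lt hT _ irt hy); rewrite ltn_predL.
  - by move=> i2; apply: leq_trans (ur i2); apply: ltnW.
  - by move=> i2; rewrite -(cq rt.+1); apply: ltn_trans lt (uu i2).
  have hx2 : hx (cell T2 rt p.+1) <= k.
    rewrite cell_upd_eq cq ext_replE /subst_val; move: hxk ak; clear; rewrite /hx /=; case: eqP; lia.
  have i2T s d : in_tab T2 s d = in_tab T s d by rewrite (in_tab_upd_in _ _ _ hT1 irt1).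
  have e2 : upd T1 rt p.+1 (arm_add k (ext_repl k a (cell T rt p.+1))) =
            upd T2 rt p.+1 (arm_add k (cell T2 rt p.+1)).
    by rewrite upd_upd cell_upd_eq cq.
  have irt2 : in_tab T2 rt p.+1 by rewrite i2T.
  rewrite e2; split.
    apply: (hvt_arm_add hT2 irt2 hx2); right; rewrite !i2T -!iT1.
    have n1 : p.+2 != p.+1 by apply/eqP; clear; lia.
    have n2 : rt.+1 != rt by apply/eqP; clear; lia.
    by split=> i2; rewrite (@cell_upd_ne T1) ?n1 ?n2 ?orbT //; [exact: ur|exact: uu].
  apply: (V_rel_of_moves hT it ha eT ne) => d v.
  have [-> -> ->] := cnt_arm_add k hT2 irt2 d v.
  have [d1 d2 d3] := c2 d v; have [g1 g2 g3] := c1 d v.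
  have eL : (nH (cnt T) p.+1 k == 0) = (0 < mult k (hleg (cell T1 rt p.+1))).
    rewrite cq eH /mult count_gt0; have := hk; rewrite inE eq_sym.
    have := leg_gt (y := k) (hvt_hook hT irt).
    case: (eqVneq (hx _) k) => [->|_] h /=; last by move=> ->.
    by move=> _; apply/esym/negP => /h; rewrite ltnn.
  rewrite eL eH lt0b implyTb !andTb -cq; rewrite lt0b in d1; rewrite -g1 -g2 -g3.
  by split; rewrite ?d1 ?d2 ?d3 // addnAC.
have sl : slot T1 rt p.+1.
  by split=> [_|/below]; rewrite iT1 //; exact: (hvt_down_le hT le it).
have hN : hvt (upd T1 rt p.+1 (a, [::], [::])).
  apply: hvt_upd => //.
  - by apply/and4P; split.
  - by rewrite iT1 => /(in_tab_left (leqnSn _)); rewrite nirt.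
  - move=> r0 y; rewrite cq => hy; exact: (V_sel_below hT sX (below r0) hy).
  - by rewrite iT1 => /(hvt_down hT); rewrite nirt.
split=> //; apply: (V_rel_of_moves hT it ha eT ne) => d v.
have [a1 a2 a3] := cnt_slot (a, [::], [::]) sl d v; have [g1 g2 g3] := c1 d v.
rewrite iT1 nirt !andbF !mul0n !addn0 g1 g2 in a1 a2 a3.
rewrite -[hx (a, [::], [::])]/a in a1; rewrite -[mult v _]/0 muln0 addn0 in a2.
rewrite -[mult v _]/0 muln0 addn0 in a3; rewrite a1 a2 a3 -g3 mulnb [a == v]eq_sym.
by rewrite !andFb !addn0.
Qed.

Lemma mult_filter v P s : mult v (filter P s) = P v * mult v s.
Proof.
rewrite /mult; elim: s => [|y s IH] /=; first by rewrite muln0.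
by case Py: (P y); rewrite /= IH; case: eqP => [<-|_]; rewrite ?Py ?add0n ?mul0n ?mul1n.
Qed.

Lemma mult_cat v s1 s2 : mult v (s1 ++ s2) = mult v s1 + mult v s2.
Proof. exact: count_cat. Qed.

Lemma Vb_same_spec T p a hk k r : hvt T -> V_sel (cnt T) p a hk k ->
  in_tab T r p -> a \in harm (cell T r p) ->
  (if hk then in_tab T r p.+1 && (k \in hextleg (cell T r p.+1)) else r == size (col_cells T p.+1)) ->
  hvt (Vb_same T p a hk k r) /\ V_rel (cnt T) p a hk k (cnt (Vb_same T p a hk k r)).
Proof.
move=> hT sX it ha hrt; have [le eT eH hx0 new] := V_geom hT sX it ha hrt.
have nq : (p.+1 == p) = false by apply/negbTE; rewrite neq_ltn ltnSn orbT.
have hook := hvt_hook hT it; have /and4P[x0 so sa al] := hook.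
rewrite /Vb_same; set h := cell T r p in ha hook x0 so sa al *.
set h1 := (hx h, _, _); set T1 := upd T r p h1.
have xa : hx h <= a := is_hook_min hook (entries_arm ha).
have a0 : 0 < a by apply: leq_trans xa.
have h1_sub : {subset hentries h1 <= hentries h}.
  move=> y; rewrite !mem_hentries -[hx h1]/(hx h) -[hleg h1]/[seq y <- hleg h | y <= a] -[harm h1]/(rem a (harm h)).
  rewrite mem_filter => /or3P[->//|/andP[_ ->]|/mem_rem ->]; by rewrite !orbT.
have h1_le : {in hentries h1, forall y, y <= a}.
  move=> y; rewrite mem_hentries -[hx h1]/(hx h) -[hleg h1]/[seq y <- hleg h | y <= a] -[harm h1]/(rem a (harm h)).
  rewrite mem_filter => /or3P[/eqP->//|/andP[]//|/mem_rem hy].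
  by rewrite leqNgt; apply/negP => lt; have := arm_nA hT it hy; rewrite (Vsel_max sX lt).
have h1_hook : is_hook h1.
  apply/and4P; split=> //.
  - apply: (subseq_sorted ltn_trans _ so); rewrite -[hextleg h1]/(hx h :: [seq y <- hleg h | y <= a]).
    by rewrite -[hextleg h]/(hx h :: hleg h) /= eqxx filter_subseq.
  - exact: (subseq_sorted leq_trans (rem_subseq _ _) sa).
  - by apply/allP => y /mem_rem hy; apply: (allP al).
have hT1 : hvt T1 by apply: hvt_upd_same => // y hy; left; exact: h1_sub.
have c1 := cnt_upd h1 hT it; rewrite -/h -/T1 in c1.
have iT1 s d : in_tab T1 s d = in_tab T s d by rewrite in_tab_upd_in.
have cq s d : d != p -> cell T1 s d = cell T s d by move=> n; rewrite cell_upd_ne // n orbT.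
have np1 : p.+1 != p by rewrite nq.
have np2 : p.+2 != p by apply/eqP; clear; lia.
have sl : slot T1 r p.+1.
  split=> [_|r0]; rewrite iT1 //; case: hk sX hrt {eT eH hx0} new => [_ /andP[i _] _|_ _ /(_ isT)[_]]; last exact.
  exact: (hvt_down_le hT (leq_pred r) i).
set hb := if hk then cell T r p.+1 else (a, [::], [::]).
have hb_hook : is_hook hb.
  rewrite /hb; case: (hk) hrt => [/andP[i _]|_]; first exact: (hvt_hook hT i).
  by apply/and4P.
have hb_arm : harm hb = [::].
  by rewrite /hb; case: (hk) sX hrt => // sX /andP[i _]; exact: (V_sel_arm0 hT sX i).
have hb_leg y : y \in hleg hb -> a < y.
  move=> hy; apply: leq_ltn_trans (leg_gt hb_hook hy); rewrite /hb.
  case: (hk) sX hx0 => // sX /(_ isT erefl) ->; by have /andP[] := Vsel_k sX isT.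
have hS y : y \in [seq y <- hleg h | a < y] -> a < y /\ y \in hleg h.
  by rewrite mem_filter => /andP[].
have S_le y : hk -> y \in [seq y <- hleg h | a < y] -> y <= k.
  move=> hk_ /hS[_ hy]; rewrite -(hx0 hk_ erefl); apply: (hvt_row hT); last by rewrite mem_hentries hy orbT.
  by case: (hk) hk_ hrt => // _ /andP[].
set h2 := (a, _, _).
have h2E y : y \in hentries h2 -> [\/ y = a, y \in hleg hb, y \in [seq y <- hleg h | a < y] | hk /\ y = k].
  rewrite mem_hentries -[hx h2]/a -[hleg h2]/(sort leq (hleg hb ++ [seq y <- hleg h | a < y])).
  rewrite mem_sort mem_cat => /or3P[/eqP|/orP[]|]; [by constructor 1|by constructor 2|by constructor 3|].
  rewrite -[harm h2]/(if hk then sort leq (k :: harm hb) else harm hb) hb_arm.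
  by case: (hk) => //; rewrite mem_sort inE => /eqP; constructor 4.
have h2_hook : is_hook h2.
  apply/and4P; split=> //.
  - rewrite -[hextleg h2]/(a :: sort leq (hleg hb ++ [seq y <- hleg h | a < y])) /=.
    rewrite (path_sortedE ltn_trans) all_sort all_cat sorted_ltn_sort ?andbT.
      by apply/andP; split; apply/allP => y; [exact: hb_leg|case/hS].
    (* The incoming leg entries are at most [k], and the old leg of the right cell lies above its
       hook entry [k]; the two are disjoint, so the merged leg is strictly increasing. *)
    rewrite cat_uniq leg_uniq // filter_uniq ?leg_uniq // andbT; apply/hasPn => y yS.
    apply/negP => yb; case: (boolP hk) => hk_; last by move: yb; rewrite /hb (negPf hk_).
    have := leg_gt hb_hook yb; rewrite {1}/hb hk_ (hx0 hk_ erefl); have := S_le y hk_ yS.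
    by clear; lia.
  - rewrite -[harm h2]/(if hk then sort leq (k :: harm hb) else harm hb) hb_arm.
    by case: (hk) => //; apply: (sort_sorted leq_total).
  - rewrite -[harm h2]/(if hk then sort leq (k :: harm hb) else harm hb) hb_arm.
    case: (hk) sX => // sX; rewrite all_sort /= andbT; by have /andP[] := Vsel_k sX isT.
have h2_bd m : hk -> (forall y, y \in hentries (cell T r p.+1) -> y <= m) -> {in hentries h2, forall y, y <= m}.
  move=> hk_ bd; have km : k <= m by rewrite -(hx0 hk_ erefl); apply: bd; exact: hx_entries.
  move=> y /h2E[->|hy|/(S_le _ hk_) h'|[_ ->]] //; last by apply: leq_trans h' km.
    by have /andP[_ ak] := Vsel_k sX hk_; apply: leq_trans ak km.
  by apply: bd; rewrite mem_hentries; move: hy; rewrite /hb hk_ => ->; rewrite orbT.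
have ihk s d : in_tab T s d -> r <= s -> p < d -> hk.
  move=> i rs pd; case: (boolP hk) => // nk; have [nirt _] := new nk.
  by rewrite -nirt; apply: (hvt_down_le hT rs); apply: in_tab_left i.
split.
  apply: hvt_upd => //.
  - by move=> _ y; rewrite -[p.+1.-1]/p cell_upd_eq; exact: h1_le.
  - rewrite iT1 cq // => i2; apply: (h2_bd _ (ihk _ _ i2 (leqnn _) (leqnSn _))).
    by move=> y; exact: hvt_row.
  - move=> r0 y; rewrite cq // => hy.
    have i1 : in_tab T r.-1 p.+1 by have := sl.2 r0; rewrite iT1.
    apply: (V_sel_below hT sX i1 hy) => hk_; rewrite -(hx0 hk_ erefl).
    apply: (hvt_col_lt hT _ _ hy); first by rewrite ltn_predL.
    by case: (hk) hk_ hrt => // _ /andP[].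
  - rewrite iT1 cq // => i2 y hy.
    have := is_hook_gt0 (hvt_hook hT i2); have bd := @hvt_col _ hT r p.+1 i2.
    (* The strict bound by a positive hook entry [m.+1] is read as the weak bound by [m], to which
       [h2_bd] applies. *)
    case: (hx (cell T r.+1 p.+1)) bd => // m bd _.
    rewrite ltnS; apply: (h2_bd m (ihk _ _ i2 (leqnSn _) (leqnn _)) _ y hy).
    by move=> z /bd.
have iq : in_tab T r p.+1 = hk.
  by case: (hk) hrt new => [/andP[]//|_ /(_ isT)[]].
have eK : hk ==> (0 < nH (cnt T) p.+1 k) by move: eT; rewrite eqxx => /andP[].
move=> d v; rewrite (moved_eq v hT it ha eT) eqxx mul1n -/h eK.
have [a1 a2 a3] := cnt_slot h2 sl d v; have [f1 f2 f3] := c1 d v.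
have {}f1 : nH (cnt T1) d v = nH (cnt T) d v := addIn f1.
rewrite iT1 cq // iq in a1 a2 a3.
have zH : hk && (nH (cnt T) p.+1 k == 0) = false.
  by case: (hk) eK => //=; rewrite lt0n => /negbTE.
have zK : hk && (0 < nH (cnt T) p.+1 k) = hk by case: (hk) eK.
have mL : mult v (hleg h2) = hk * mult v (hleg (cell T r p.+1)) + (a < v) * mult v (hleg h).
  rewrite -[hleg h2]/(sort leq (hleg hb ++ [seq y <- hleg h | a < y])) mult_sort mult_cat mult_filter.
  by congr (_ + _); rewrite /hb; case: (hk); rewrite ?mul1n ?mul0n.
have mA : mult v (harm h2) = hk && (v == k).
  rewrite -[harm h2]/(if hk then sort leq (k :: harm hb) else harm hb) hb_arm.
  by case: (hk); rewrite ?mult_sort // mult_cons addn0.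
have mC : hk * mult v (harm (cell T r p.+1)) = 0.
  by case: (hk) sX iq => // sX i; rewrite (V_sel_arm0 hT sX i).
rewrite -[hx h2]/a f1 in a1; rewrite mL in a2; rewrite mA in a3.
rewrite -[hleg h1]/[seq y <- hleg h | y <= a] mult_filter in f2.
rewrite -[harm h1]/(rem a (harm h)) in f3; have mr := mult_rem v ha.
rewrite !andbA zH zK; split.
- have eC : hk * (hx (cell T r p.+1) == v) = hk && (v == k).
    by case: (hk) hx0 => // /(_ isT erefl) ->; rewrite mul1n eq_sym.
  move: eC a1; rewrite [a == v]eq_sym; clear; case: (d == p.+1); case: (hk); lia.
- move: f2 a2; clear; rewrite ltnNge; case: (v <= a); case: (d == p.+1); case: (d == p); case: (hk); lia.
- move: f3 a3 mr mC; clear; case: (d == p.+1); case: (d == p); case: (hk); lia.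
Qed.

Lemma Vb_spec T p a hk k : hvt T -> V_sel (cnt T) p a hk k ->
  hvt (Vb T) /\ V_rel (cnt T) p a hk k (cnt (Vb T)).
Proof.
move=> hT sX; have [r [rt [it ha hrt ->]]] := Vb_explicit hT sX.
have [e|ne] := eqVneq rt r; last exact: Vb_diff_spec.
by apply: Vb_same_spec; rewrite // -e.
Qed.

(** * Uncrowding along an edge of the crystal *)

Lemma col_has_armP T c : hvt T -> reflect (exists v, 0 < nA (cnt T) c v) (col_has_arm T c).
Proof.
move=> hT; apply: (iffP hasP) => [[r]|[v /(nA_gt0 hT)[r it hv]]].
  by rewrite mem_col_cells => it /amax_mem/(arm_nA hT it); exists (amax (cell T r c)).
by exists r; rewrite ?mem_col_cells //; apply: contraTneq hv => ->.
Qed.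

Lemma V_sel_exists T : hvt T -> arm_excess T != 0 -> exists p a hk k, V_sel (cnt T) p a hk k.
Proof.
move=> hT; rewrite -lt0n => /arm_excess_gt0P[r0 [c0 [it0 ne0]]].
have col0 : exists c, col_has_arm T c.
  by exists c0; apply/col_has_armP => //; exists (amax (cell T r0 c0)); apply: arm_nA (amax_mem ne0).
have col_bd c : col_has_arm T c -> c <= ncols T.
  case/hasP=> r; rewrite mem_col_cells => it _; apply: ltnW.
  exact: (hvt_down_le hT (leq0n r) it).
case: (ex_maxnP col0 col_bd) => p /col_has_armP-/(_ hT) arms max_p.
have arm_bd v : 0 < nA (cnt T) p v -> v <= \max_(h <- flatten T) amax h.
  case/(nA_gt0 hT)=> r it /amax_ub le; apply: leq_trans le _.
  exact: (@leq_bigmax_seq _ _ xpredT amax _ (cell_mem_flatten it) isT).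
case: (ex_maxnP arms arm_bd) => a a_arm max_a.
pose P v := (0 < nE (cnt T) p.+1 v) && (a <= v).
have right d v : p < d -> nA (cnt T) d v = 0.
  move=> pd; apply: eq0_contra => h.
  have : d <= p by apply: max_p; apply/col_has_armP => //; exists v.
  by rewrite leqNgt pd.
have maxA v : a < v -> nA (cnt T) p v = 0.
  by move=> av; apply: eq0_contra => /max_a; rewrite leqNgt av.
(* A finite search through the cells decides whether an entry [>= a] exists in column [p.+1]. *)
case: (boolP (has (fun r => has (leq a) (hextleg (cell T r p.+1))) (col_cells T p.+1))) => ex.
  have {}ex : exists v, P v.
    case/hasP: ex => r; rewrite mem_col_cells => it /hasP[v hv av].
    by exists v; rewrite /P av (ext_nE hT it hv).
  case: (ex_minnP ex) => k Pk min_k; exists p, a, true, k; split=> //.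
  move=> v av /(_ isT) vk; apply: eq0_contra => h.
  by have := min_k v; rewrite /P h av leqNgt vk => /(_ isT).
exists p, a, false, 0; split=> // v av _; apply: eq0_contra.
case/(nE_gt0 hT) => r it hv; case/hasP: ex; exists r; first by rewrite mem_col_cells.
by apply/hasP; exists v.
Qed.

Lemma hvt_Vb T : hvt T -> hvt (Vb T).
Proof.
move=> hT; have [e|/(V_sel_exists hT)[p [a [hk [k sX]]]]] := eqVneq (arm_excess T) 0.
  by rewrite /Vb e eqxx.
by have [] := Vb_spec hT sX.
Qed.

Lemma open_minus_wide x y M n c : (forall d, M <= d -> x d = 0) -> M <= c + n ->
  open_minus x y n c = open_minus x y (M - c) c.
Proof.
move=> x0; elim: n c => [|n IH] c; first by rewrite addn0 => /eqP ->.
rewrite addnS -addSn => le; case: (leqP M c) => [Mc|cM].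
  have /eqP-> : M - c == 0 by [].
  rewrite /= x0 // IH // (_ : M - c.+1 = 0) //; apply/eqP; exact: leqW.
by rewrite -(subnSK cM) /= IH.
Qed.

(** Columns outside the tableau read the empty word, so any larger number of columns picks the same
    one; tableaux with different numbers of columns can share [N]. *)
Lemma f_pick_wide x y M N c : (forall d, M <= d -> x d = 0) -> M <= N ->
  f_pick x y N c = f_pick x y M c.
Proof.
move=> x0 MN; rewrite /f_pick; case: (leqP M c) => [Mc|cM]; first by rewrite x0 // !andbF.
by rewrite (leq_trans cM MN) (open_minus_wide _ x0) //; move: cM MN; clear; lia.
Qed.

Lemma e_pick_wide x y M N c : (forall d, M <= d -> x d = 0 /\ y d = 0) -> M <= N ->
  e_pick x y N c = e_pick x y M c.
Proof.
move=> h0 MN; rewrite /e_pick; case: (leqP M c) => [Mc|cM].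
  by rewrite (h0 _ Mc).2 ltn0 !andbF.
rewrite (leq_trans cM MN) (@open_minus_wide x y M) // => [d /h0[]//|].
by move: cM MN; clear; lia.
Qed.

Lemma signs_out T i d : hvt T -> ncols T <= d -> xs i (cnt T) d = 0 /\ ys i (cnt T) d = 0.
Proof.
move=> hT le; rewrite /xs /ys /nE.
have [-> -> ->] := cnt_out i hT le; by have [-> -> ->] := cnt_out i.+1 hT le.
Qed.

Lemma f_op_rel i T T' N : hvt T -> ncols T <= N -> f_op i T = Some T' ->
  hvt T' /\ exists2 c, f_at i (cnt T) N c & f_rel i c (cnt T) (cnt T').
Proof.
move=> hT le h; have [c pk] := f_op_some hT h.
have := h; rewrite (f_op_pick hT pk) => -[<-].
have [hT' rel] := f_move_spec hT (leqnn _) pk; split=> //; exists c => //.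
by rewrite (f_pick_wide _ _ _ le) // => d /(signs_out i hT)[].
Qed.

(** The actual [f_move] satisfies [f_rel], and counts determine the tableau, so it suffices that
    every [X] so related to [T] agrees with [T']. *)
Lemma f_rel_op i T T' N c : hvt T -> hvt T' -> ncols T <= N ->
  f_at i (cnt T) N c ->
  (forall X, f_rel i c (cnt T) X -> eqc (cnt T') X) -> f_op i T = Some T'.
Proof.
move=> hT hT' le pk h.
have pk' : f_at i (cnt T) (ncols T) c.
  by move: pk; rewrite (f_pick_wide _ _ _ le) // => d /(signs_out i hT)[].
rewrite (f_op_pick hT pk'); have [hF rel] := f_move_spec hT le pk.
by congr Some; apply/esym/(cnt_inj hT' hF); exact: h.
Qed.

Lemma e_op_rel i T T' N : hvt T -> 0 < i -> ncols T <= N -> e_op i T = Some T' ->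
  hvt T' /\ exists2 c, e_at i (cnt T) N c & e_rel i c (cnt T) (cnt T').
Proof.
move=> hT i0 le h; have [c pk] := e_op_some hT h.
have := h; rewrite (e_op_pick hT pk) => -[<-].
have [hT' rel] := e_move_spec hT i0 pk; split=> //; exists c => //.
by rewrite (e_pick_wide _ _ le) // => d /(signs_out i hT).
Qed.

Lemma e_rel_op i T T' N c : hvt T -> 0 < i -> hvt T' -> ncols T <= N ->
  e_at i (cnt T) N c ->
  (forall X, e_rel i c (cnt T) X -> eqc (cnt T') X) -> e_op i T = Some T'.
Proof.
move=> hT i0 hT' le pk h.
have pk' : e_at i (cnt T) (ncols T) c.
  by move: pk; rewrite (e_pick_wide _ _ le) // => d /(signs_out i hT).
rewrite (e_op_pick hT pk'); have [hE rel] := e_move_spec hT i0 pk.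
by congr Some; apply/esym/(cnt_inj hT' hE); exact: h.
Qed.

Lemma f_op_e_op i T T' : hvt T -> 0 < i -> f_op i T = Some T' -> e_op i T' = Some T.
Proof.
move=> hT i0 h; pose N := maxn (ncols T) (ncols T').
have [hT' [c pk rel]] := f_op_rel hT (leq_maxl _ (ncols T')) h.
have [v|d pk' inv] := f_e_inverse (valid_cnt hT) (valid_cnt hT') _ pk rel.
  by have [] := cnt_out v hT (leq_maxl _ (ncols T')).
exact: (e_rel_op hT' i0 hT (leq_maxr (ncols T) _) pk' inv).
Qed.

Lemma e_op_f_op i T T' : hvt T -> 0 < i -> e_op i T = Some T' -> hvt T' /\ f_op i T' = Some T.
Proof.
move=> hT i0 h; have [hT' [c pk rel]] := e_op_rel hT i0 (leq_maxl _ (ncols T')) h.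
have [d pk' inv] := e_f_inverse (valid_cnt hT) (valid_cnt hT') pk rel.
by split=> //; exact: (f_rel_op hT' hT (leq_maxr (ncols T) _) pk' inv).
Qed.

(** * Invariants of an edge and the iterated bumping *)

Definition crystal_edge i T T' := [/\ hvt T, hvt T' & f_op i T = Some T'].

Lemma f_op_edge i T T' : hvt T -> f_op i T = Some T' -> crystal_edge i T T'.
Proof. by move=> hT h; have [hT' _] := f_op_rel hT (leqnn _) h; split. Qed.

(** Hook entries only trade the values [i] and [i+1] within their column, which a count up to a
    larger value does not notice. For large [v] this compares the heights of the columns. *)
Lemma f_rel_hlt i c X X' d v : f_rel i c X X' -> i.+1 < v -> hlt X' d v = hlt X d v.
Proof.
move=> rel lt; have lt' : i < v := ltnW lt; case: rel => _.
- move=> _ h; have := @hlt_move X X' d (d == c.+1) (d == c.+1) i i.+1 _ v.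
  by rewrite lt lt' => /(_ (fun w => let: And3 e _ _ := h d w in e)) /addIn.
- by move=> _ h; apply: hlt_eq => w; have [] := h d w.
- move=> _ _ h; have := @hlt_move X X' d ((0 < nH X c i) && (d == c)) ((0 < nH X c i) && (d == c)) i i.+1 _ v.
  rewrite lt lt' => /(_ _)/addIn; apply => w; rewrite -!andbA; by have [] := h d w.
Qed.

Lemma f_rel_arms i c X X' d v : f_rel i c X X' -> i.+1 < v ->
  \sum_(w < v) nA X' d w = \sum_(w < v) nA X d w.
Proof.
move=> rel lt; have lt' : i < v := ltnW lt; case: rel => _.
- by move=> _ h; apply: eq_bigr => w _; have [] := h d w.
(* The arm counts are put in the place of the hook counts, so that [hlt_move] applies to them. *)
- move=> _ h; pose A Z := Counts (nA Z) (nL Z) (nA Z).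
  have := @hlt_move (A X) (A X') d (d == c) (d == c) i i.+1 _ v.
  by rewrite lt lt' => /(_ (fun w => let: And3 _ _ e := h d w in e)) /addIn.
- by move=> _ _ h; apply: eq_bigr => w _; have [] := h d w.
Qed.

Lemma in_tab_hlt T r c : hvt T -> in_tab T r c -> exists V, forall v, V <= v -> r < hlt (cnt T) c v.
Proof.
move=> hT it; exists (hx (cell T r c)).+1 => v le.
by apply: leq_trans (hlt_mono _ _ le); rewrite (hlt_row hT it (hx_entries _)).
Qed.

Lemma edge_in_tab i T T' r c : crystal_edge i T T' -> in_tab T' r c = in_tab T r c.
Proof.
case=> hT hT' /(f_op_rel hT (leqnn _))[_ [d _ rel]]; apply/idP/idP.
  case/(in_tab_hlt hT') => V /(_ (V + i.+2) (leq_addr _ _)) h; apply: (hlt_in_tab hT (v := V + i.+2)).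
  by rewrite -(f_rel_hlt _ rel) // ltn_addl.
case/(in_tab_hlt hT) => V /(_ (V + i.+2) (leq_addr _ _)) h; apply: (hlt_in_tab hT' (v := V + i.+2)).
by rewrite (f_rel_hlt _ rel) // ltn_addl.
Qed.

Lemma edge_shape i T T' : crystal_edge i T T' -> shape T' = shape T.
Proof.
move=> ed; have [hT hT' _] := ed; have e r c := edge_in_tab r c ed.
have es := hvt_size hT' hT e; apply: (@eq_from_nth _ 0); rewrite !size_map // => r lr.
rewrite !(nth_map [::]) ?es -?es //; apply/eqP; rewrite eqn_leq; apply/andP.
split; rewrite leqNgt; apply/negP => lt.
  by have := e r (size (nth [::] T r)); rewrite /in_tab lt ltnn.
by have := e r (size (nth [::] T' r)); rewrite /in_tab lt ltnn.
Qed.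

Definition arms T c := nG (fun h => size (harm h)) T c.

Lemma sum_mult (s : seq nat) V : all (fun y => y < V) s -> \sum_(v < V) mult v s = size s.
Proof.
elim: s => [_|y s IH]; first by rewrite big1.
rewrite [all _ _]/= => /andP[yV /IH e]; rewrite [RHS]/= -e; rewrite (eq_bigr (fun v : 'I_V => (y == v) + mult v s)); last first.
  by move=> v _; rewrite mult_cons eq_sym.
rewrite big_split /= (bigD1 (Ordinal yV)) //= eqxx big1 ?addn0 // => v ne.
by apply/eqP; rewrite eqb0 eq_sym.
Qed.

Lemma armsE T c V : (forall h y, h \in flatten T -> y \in harm h -> y < V) ->
  arms T c = \sum_(v < V) nA (cnt T) c v.
Proof.
move=> bd; rewrite /arms /cnt /nA /nG exchange_big; apply: eq_bigr => r _.
rewrite -big_distrr; case: (boolP (in_tab T r c)) => [it|_]; last by rewrite !mul0n.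
congr (_ * _); rewrite -(@sum_mult _ V) //; apply/allP => y; exact: bd (cell_mem_flatten it).
Qed.

Lemma arm_bound T : exists V, forall h y, h \in flatten T -> y \in harm h -> y < V.
Proof.
exists (\max_(h <- flatten T) amax h).+1 => h y hf hy; rewrite ltnS.
exact: leq_trans (amax_ub hy) (@leq_bigmax_seq _ _ xpredT amax _ hf isT).
Qed.

Lemma edge_arms i T T' c : crystal_edge i T T' -> arms T' c = arms T c.
Proof.
case=> hT hT' /(f_op_rel hT (leqnn _))[_ [d _ rel]].
have [V hV] := arm_bound T; have [V' hV'] := arm_bound T'.
rewrite (@armsE T c (V + (V' + i.+2))); last by move=> h y hf hy; apply: ltn_addr; exact: hV hy.
rewrite (@armsE T' c (V + (V' + i.+2))).
  by apply: (f_rel_arms _ rel); rewrite addnA ltn_addl.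
by move=> h y hf hy; apply: ltn_addl; apply: ltn_addr; exact: hV' hy.
Qed.

Lemma col_has_arm_arms T c : col_has_arm T c = (0 < arms T c).
Proof.
rewrite /col_has_arm /arms; apply/hasP/idP => [[r]|/nG_gt0[r it h]].
  rewrite mem_col_cells => it ne; rewrite /nG (bigD1 (Ordinal (in_tab_size it))) //= it mul1n.
  by case: (harm _) ne.
by exists r; rewrite ?mem_col_cells //; case: (harm _) h.
Qed.

Lemma arm_excess_arms T n : (forall row, row \in T -> size row <= n) -> arm_excess T = \sum_(c < n) arms T c.
Proof.
move=> bd; rewrite /arm_excess sumnE big_map big_flatten (big_nth [::]) big_mkord.
rewrite /arms /nG exchange_big; apply: eq_bigr => r _.
rewrite (big_nth dflt_hook) big_mkord (big_ord_widen n (fun c => size (harm (cell T r c)))); last first.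
  by apply: bd; exact: mem_nth.
rewrite big_mkcond; apply: eq_bigr => c _; rewrite /in_tab.
by case: (c < _); rewrite ?mul1n ?mul0n.
Qed.

Lemma edge_arm_excess i T T' : crystal_edge i T T' -> arm_excess T' = arm_excess T.
Proof.
move=> ed; have es := edge_shape ed; pose n := \max_(m <- shape T) m.
have bd S row : shape S = shape T -> row \in S -> size row <= n.
  by move=> e h; apply: leq_bigmax_mem; rewrite -e; exact: map_f.
rewrite !(@arm_excess_arms _ n) => [|row|row]; try exact: bd.
by apply: eq_bigr => c _; exact: edge_arms ed.
Qed.

Lemma nth_shape (T : tableau) r : nth 0 (shape T) r = size (nth [::] T r).
Proof.
have [lt|ge] := ltnP r (size T); first by rewrite (nth_map [::]).
by rewrite (nth_default [::] ge) nth_default ?size_map.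
Qed.

Lemma edge_arm_col i T T' : crystal_edge i T T' -> arm_col T' = arm_col T.
Proof.
move=> ed; rewrite /arm_col /ncols -!nth_shape (edge_shape ed).
by apply: eq_bigl => c; rewrite !col_has_arm_arms (edge_arms _ ed).
Qed.

Lemma edge_Vb i T T' : crystal_edge i T T' -> crystal_edge i (Vb T) (Vb T').
Proof.
move=> ed; have [hT hT' h] := ed; split; try exact: hvt_Vb.
have [e|ne] := eqVneq (arm_excess T) 0.
  by rewrite /Vb (edge_arm_excess ed) e eqxx.
have [p [a [hk [k sX]]]] := V_sel_exists hT ne; have [hV rV] := Vb_spec hT sX.
(* Wide enough for [T], for [Vb T] and for column [p.+1], which may be new; beyond [T] there are no
   hook entries, as the commutation requires of column [N]. *)
pose N := maxn (ncols T) (maxn (ncols (Vb T)) p.+2).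
have leT : ncols T <= N by rewrite leq_maxl.
have leV : ncols (Vb T) <= N by rewrite /N; clear; lia.
have leP : p.+1 < N by rewrite /N; clear; lia.
have [_ [c pk rel]] := f_op_rel hT leT h.
have [v|c2 [a' [k' [pk2 sX' com]]]] :=
  V_f_commute (valid_cnt hT) _ (valid_cnt hV) (valid_cnt hT') sX rV leP pk rel.
  by have [] := cnt_out v hT leT.
have [hV' rV'] := Vb_spec hT' sX'.
exact: (f_rel_op hV hV' leV pk2 (fun X => com _ X rV')).
Qed.

Lemma edge_inj i T1 T2 T' : 0 < i -> crystal_edge i T1 T' -> crystal_edge i T2 T' -> T1 = T2.
Proof.
move=> i0 [h1 _ f1] [h2 _ f2].
by have := f_op_e_op h1 i0 f1; rewrite (f_op_e_op h2 i0 f2) => -[].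
Qed.

(** If [Vb] fixes [T'], then [T] and [Vb T] both have an edge to [T'], and they coincide because
    [e_i] inverts [f_i]. *)
Lemma edge_Vb_fix i T T' : 0 < i -> crystal_edge i T T' -> (Vb T' == T') = (Vb T == T).
Proof.
move=> i0 ed; have edV := edge_Vb ed; apply/eqP/eqP => e.
  by apply: (edge_inj i0 edV); rewrite e.
by have [_ _] := edV; rewrite e; have [_ _ ->] := ed => -[].
Qed.

Lemma ViterS n T :
  Viter n.+1 T = if (shape (Vb T) != shape T) || (Vb T == T) then Vb T else Viter n (Vb T).
Proof. by []. Qed.

(** Both tests of the loop, change of shape and fixed point, have the same outcome on [T] and [T'],
    so the number of bumpings is the same. *)
Lemma edge_Viter i n T T' : 0 < i -> crystal_edge i T T' -> crystal_edge i (Viter n T) (Viter n T').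
Proof.
move=> i0; elim: n T T' => // n IH T T' ed; have edV := edge_Vb ed.
rewrite !ViterS (edge_shape ed) (edge_shape edV) (edge_Vb_fix i0 ed).
by case: ifP => // _; exact: IH.
Qed.

Lemma edge_Vins i T T' : 0 < i -> crystal_edge i T T' -> crystal_edge i (Vins T) (Vins T').
Proof.
move=> i0 ed; rewrite /Vins !size_flatten -!/(shape _) (edge_shape ed).
exact: edge_Viter.
Qed.

(** Isolates the recording step as a function of shapes and of one column index, all of which are
    constant along an edge. *)
Definition record_cell (sh sh' : seq nat) c (Q : rtableau) : rtableau :=
  let rr := find (fun j => nth 0 sh' j != nth 0 sh j) (iota 0 (size sh')) in
  set_cell None Q rr (nth 0 sh rr) (Some (Posz (nth 0 sh rr) - Posz c)%R).

Lemma U_stepE P Q : U_step (P, Q) = (Vins P, record_cell (shape P) (shape (Vins P)) (arm_col P) Q).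
Proof. by rewrite /record_cell size_map. Qed.

Lemma edge_U_step i P P' Q : 0 < i -> crystal_edge i P P' ->
  crystal_edge i (U_step (P, Q)).1 (U_step (P', Q)).1 /\ (U_step (P, Q)).2 = (U_step (P', Q)).2.
Proof.
move=> i0 ed; have edV := edge_Vins i0 ed; rewrite !U_stepE; split=> //.
by rewrite -[LHS]/(record_cell _ _ _ _) -[RHS]/(record_cell _ _ _ _) (edge_shape ed) (edge_shape edV) (edge_arm_col ed).
Qed.

Lemma edge_Umap i T T' : 0 < i -> crystal_edge i T T' ->
  crystal_edge i (Ptab T) (Ptab T') /\ Qtab T = Qtab T'.
Proof.
move=> i0 ed; rewrite /Ptab /Qtab /Umap (edge_arm_excess ed).
have -> : Q0 T' = Q0 T.
  have Q0E S : Q0 S = [seq nseq m None | m <- shape S] by rewrite -map_comp.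
  by rewrite !Q0E (edge_shape ed).
elim: (arm_excess T) (Q0 T) => //= n IH Q; have := IH Q.
case: (iter n U_step (T, Q)) (iter n U_step (T', Q)) => [P1 Q1] [P2 Q2] [/= ed' ->].
exact: edge_U_step.
Qed.

Theorem theorem3p14 (T : tableau) (i : nat) :
  is_HVT T -> 0 < i ->
  (forall T', f_op i T = Some T' ->
     f_op i (Ptab T) = Some (Ptab T') /\ Qtab T = Qtab T') /\
  (forall T', e_op i T = Some T' ->
     e_op i (Ptab T) = Some (Ptab T') /\ Qtab T = Qtab T').
Proof.
move=> /hvtP hT i0; split=> T' h.
  by have [[_ _ hP] hQ] := edge_Umap i0 (f_op_edge hT h).
(* The edge runs from [T'] to [T]; the result for [f_i] is applied to it and then inverted on the
   side of [P]. *)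
have [hT' hf] := e_op_f_op hT i0 h.
have [[hP' _ hP] hQ] := edge_Umap i0 (f_op_edge hT' hf).
by rewrite hQ (f_op_e_op hP' i0 hP).
Qed.
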